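(* Let $1\le p\le q\le r\le\infty$. Then, for all $n\in\mathbb{N}$, $$ \mathrm{vr}\left(\ell_p^n\otimes_\pi\ell_q^n\otimes_\pi\ell_r^n\right)\asymp_{p,q,r} \begin{cases} 1, & r\le 2,\\ n^{\max\left(\frac12-\frac1q-\frac1r,\,0\right)}, & p\le 2\le q,\ \frac1p+\frac1q+\frac1r\ge 1,\\ n^{\frac1p-\frac12}, & p\le 2\le q,\ \frac1p+\frac1q+\frac1r\le 1,\\ n^{\max\left(\frac12-\frac1p-\frac1q-\frac1r,\,0\right)}, & p\ge 2. \end{cases} $$ In the case $p\le q\le 2\le r$, $$ 1\lesssim_{p,q,r}\mathrm{vr}\left(\ell_p^n\otimes_\pi\ell_q^n\otimes_\pi\ell_r^n\right)\lesssim_{p,q,r} n^{\min\left(\frac12-\frac1r,\ \frac1q-\frac12\right)}. $$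
   Context: All spaces are real and $1/\infty=0$. $\ell_p^n$ is $\mathbb{R}^n$ with the $\ell_p$-norm. The space $\ell_p^n\otimes_\pi\ell_q^n\otimes_\pi\ell_r^n$ is $\mathbb{R}^n\otimes\mathbb{R}^n\otimes\mathbb{R}^n\cong\mathbb{R}^{n^3}$ (identified via the basis $e_i\otimes e_j\otimes e_k$) with the projective norm $\|A\|_\pi=\inf\{\sum_{l=1}^m\|x_l\|_p\|y_l\|_q\|z_l\|_r: m\in\mathbb{N},\ A=\sum_{l=1}^m x_l\otimes y_l\otimes z_l\}$. For an $N$-dimensional normed space $X$ with unit ball $B_X$, $\mathrm{vr}(X)=\left(\mathrm{vol}_N(B_X)/\mathrm{vol}_N(\mathcal{E}_X)\right)^{1/N}$, where $\mathcal{E}_X$ is the ellipsoid of maximal volume contained in $B_X$. The notations $\lesssim_{p,q,r}$ and $\gtrsim_{p,q,r}$ mean inequality up to a positive multiplicative constant depending only on $p,q,r$ (not on $n$); $\asymp_{p,q,r}$ means both hold. *)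

(* Defs.v *)
From HB Require Import structures.
From mathcomp Require Import all_boot all_order all_algebra.
From mathcomp Require Import all_classical all_reals all_analysis.

Set Implicit Arguments.
Unset Strict Implicit.
Unset Printing Implicit Defensive.

Import Order.TTheory GRing.Theory Num.Theory.
Import numFieldNormedType.Exports.

Local Open Scope classical_set_scope.
Local Open Scope ring_scope.

Section cons_measure.
Context {R : realType} {N : nat}.
Variable mu : {sigma_finite_measure set (N.-tuple (measurableTypeR R)) -> \bar R}.

Definition cons_pair (x : measurableTypeR R * N.-tuple (measurableTypeR R)) :
  N.+1.-tuple (measurableTypeR R) := [tuple of x.1 :: x.2].

Lemma measurable_cons_pair : measurable_fun [set: _] cons_pair.
Proof. exact: measurable_cons. Qed.

Definition cons_measure : set (N.+1.-tuple (measurableTypeR R)) -> \bar R :=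
  pushforward (product_measure1 (@lebesgue_measure R) mu) cons_pair.

Let cons_measure0 : cons_measure set0 = 0%E.
Proof. by rewrite /cons_measure /pushforward preimage_set0 measure0. Qed.
Let cons_measure_ge0 A : (0 <= cons_measure A)%E.
Proof. by rewrite /cons_measure /pushforward; exact: measure_ge0. Qed.
Let cons_measure_additive : semi_sigma_additive cons_measure.
Proof.
move=> F mF tF mUF; rewrite /cons_measure /pushforward preimage_bigcup.
apply: measure_semi_sigma_additive.
- by move=> n; rewrite -[X in measurable X]setTI; exact: measurable_cons_pair.
- apply/trivIsetP => i j _ _ ij; rewrite -preimage_setI.
  by move/trivIsetP : tF => /(_ _ _ I I ij) ->; rewrite preimage_set0.
- by rewrite -preimage_bigcup -[X in measurable X]setTI; exact: measurable_cons_pair.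
Qed.
HB.instance Definition _ := isMeasure.Build _ _ _ cons_measure
  cons_measure0 cons_measure_ge0 cons_measure_additive.

Let cons_measure_sigma_finite : sigma_finite setT cons_measure.
Proof.
have /sigma_finiteP[F [UF ndF Foo]] :=
  sigma_finiteT [the {sigma_finite_measure set (measurableTypeR R) -> \bar R}
                 of @lebesgue_measure R].
have /sigma_finiteP[G [UG ndG Goo]] := sigma_finiteT mu.
pose hd (t : N.+1.-tuple (measurableTypeR R)) : measurableTypeR R := thead t.
pose tl (t : N.+1.-tuple (measurableTypeR R)) : N.-tuple (measurableTypeR R) :=
  [tuple of behead t].
exists (fun n => hd @^-1` F n `&` tl @^-1` G n).
  apply/esym/seteqP; split=> // t _.
  have [n _ Fn] : (\bigcup_n F n) (hd t) by rewrite -UF.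
  have [m _ Gm] : (\bigcup_n G n) (tl t) by rewrite -UG.
  exists (maxn n m) => //; split => /=.
    by move: (hd t) Fn; exact/subsetPset/ndF/leq_maxl.
  by move: (tl t) Gm; exact/subsetPset/ndG/leq_maxr.
move=> n; have [mF Fn] := Foo n; have [mG Gn] := Goo n; split.
  apply: measurableI; rewrite -[X in measurable X]setTI.
    exact: measurable_tnth.
  exact: measurable_behead.
rewrite /cons_measure /pushforward (_ : _ @^-1` _ = F n `*` G n).
  by rewrite product_measure1E// lte_mul_pinfty// ge0_fin_numE.
have hdE x t : hd (cons_pair (x, t)) = x by rewrite /hd theadE.
have tlE x t : tl (cons_pair (x, t)) = t by exact/val_inj.
by apply/seteqP; split => -[x t] /=; rewrite hdE tlE.
Qed.
HB.instance Definition _ := Measure_isSigmaFinite.Build _ _ _ cons_measure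
  cons_measure_sigma_finite.
End cons_measure.

(* N-dimensional Lebesgue measure, on the product sigma-algebra of R^N. *)
Fixpoint lebesgue_tuple (R : realType) (N : nat) :
    {sigma_finite_measure set (N.-tuple (measurableTypeR R)) -> \bar R} :=
  if N is M.+1 then cons_measure (lebesgue_tuple R M)
  else \d_([tuple] : 0.-tuple (measurableTypeR R)).

Section volume_ratio.
Context {R : realType}.

Definition vol (N : nat) (A : set 'rV[R]_N) : \bar R :=
  lebesgue_tuple R N [set t | A (\row_(i < N) tnth t i)].

(* The value at -oo is junk. *)
Definition lp_norm (p : \bar R) (n : nat) (x : 'rV[R]_n) : R :=
  match p with
  | s%:E => (\sum_(i < n) `|x ord0 i| `^ s) `^ s^-1
  | +oo%E => \big[Num.max/0]_(i < n) `|x ord0 i|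
  | -oo%E => 0
  end.

Definition unit_ball (N : nat) (nu : 'rV[R]_N -> R) : set 'rV[R]_N :=
  [set x | nu x <= 1].

Definition ellipsoid (N : nat) (E : set 'rV[R]_N) : Prop :=
  exists (c : 'rV[R]_N) (T : 'M[R]_N), T \in unitmx /\
    E = [set c + u *m T | u in unit_ball (lp_norm 2%:E (n := N))].

Definition is_max_ellipsoid (N : nat) (K E : set 'rV[R]_N) : Prop :=
  [/\ ellipsoid E, E `<=` K &
      forall E', ellipsoid E' -> E' `<=` K -> (vol E' <= vol E)%E].

(* The unit ball of a norm has a unique ellipsoid of maximal volume (John);
   xget selects it. *)
Definition max_ellipsoid (N : nat) (K : set 'rV[R]_N) : set 'rV[R]_N :=
  xget set0 [set E | is_max_ellipsoid K E].

(* The N-dimensional normed space is given by its norm nu on R^N. *)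
Definition vr (N : nat) (nu : 'rV[R]_N -> R) : R :=
  let B := unit_ball nu in
  (fine (vol B) / fine (vol (max_ellipsoid B))) `^ (N%:R)^-1.

(* Kronecker coordinates: the coordinate at mxvec_index i j is x_i * y_j. *)
Definition tens (m n : nat) (x : 'rV[R]_m) (y : 'rV[R]_n) : 'rV[R]_(m * n) :=
  mxvec (x^T *m y).

Definition tens3 (n : nat) (x y z : 'rV[R]_n) : 'rV[R]_(n * n * n) :=
  tens (tens x y) z.

Definition proj_norm (p q r : \bar R) (n : nat) (A : 'rV[R]_(n * n * n)) : R :=
  inf [set s | exists (m : nat) (x y z : 'I_m -> 'rV[R]_n),
         A = \sum_(l < m) tens3 (x l) (y l) (z l) /\
         s = \sum_(l < m)
               lp_norm p (x l) * lp_norm q (y l) * lp_norm r (z l)].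

Definition vr_proj (p q r : \bar R) (n : nat) : R :=
  vr (proj_norm p q r (n := n)).

(* 1 / p for p in [1, +oo], with 1 / +oo = 0. *)
Definition rinv (p : \bar R) : R := fine (p^-1)%E.

Definition lesssim (f g : nat -> R) : Prop :=
  exists2 C : R, 0 < C & forall n : nat, (0 < n)%N -> f n <= C * g n.

Definition asymp (f g : nat -> R) : Prop := lesssim f g /\ lesssim g f.

End volume_ratio.

(* Main.v *)
(* Write a = 1/p >= b = 1/q >= c = 1/r, N = n^3, and let B be the unit ball.  The sign
   changes and cyclic shifts of the three coordinates act on B, so averaging over them
   shows that the largest Euclidean ball rho B_2 in B is an ellipsoid of maximal volume;
   hence vr = (vol B / vol B_2)^(1/N) / rho, and both factors are estimated separately.

   Upper bounds for vol B: every tensor of norm at most 1 is, up to rescaling, in the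
   convex hull of products of lattice points of l_t balls (1 <= t <= 2).  As l_t has
   type t, Maurey's argument approximates it in l_t^N by an average of n^2 such products,
   so B is covered by C^N cubes of the right size.

   Bounds for rho are dual: one needs |T|_2 <= M sup T(x, y, z) for all trilinear forms T
   on the three unit balls.  If al + be + ga = 1/2 then |T|_2 / 3 is at most the supremum
   of T over |x_i| <= u_i^al, |y_j| <= v_j^be, |z_k| <= w_k^ga, where u, v, w are the
   marginals of T^2 / |T|_2^2: use random signs in two variables and the optimal sign in
   the third, and average over the choice of the third variable.  The cases of the theorem
   apply this to T, to its slices T(e_i, ., .) or to its slices T(e_i, e_j, .).

   Lower bounds for vr: random signs also show that B contains a cube of comparable
   volume, and rho is bounded above with T = e_1 (x) e_1 (x) e_1 or T = sum e_i (x) e_i (x) e_i. *)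
Require Import Defs.
From HB Require Import structures.
From mathcomp Require Import all_boot all_order all_algebra.
From mathcomp Require Import all_classical all_reals all_analysis.
From mathcomp Require Import measurable_realfun.
From mathcomp Require Import ring lra zify.
Import Order.TTheory GRing.Theory Num.Theory.
Local Open Scope ring_scope.

Set Implicit Arguments.
Unset Strict Implicit.
Unset Printing Implicit Defensive.

(** * Lebesgue measure on tuples *)

(** Every duality bound is recorded by one exponent: |T|_2 <= 3 n^e K to place a Euclidean ball in
    B, |T|_1 <= 3 n^e K to place a cube, where K bounds T on the three unit balls. Since sqrt N =
    n^(3/2) and N-th roots absorb factors C^N, the cases then reduce to linear identities between
    exponents. The number n^2 of Maurey terms balances two counts. A product of three lattice points
    has C^n choices, so n^2 of them give C^N centres; the error of their sum has t-th power l_t norm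
    at most C n^2, so it is caught by C^N cubes of side about n^(-1/t). The parameter is t = r when
    r <= 2, and t = 2 otherwise. The projective norm is an infimum over decompositions, so
    membership in B without an explicit decomposition comes from separation by trilinear forms.
    Volumes are computed by Fubini along triangular maps, to which QR decomposition reduces every
    ellipsoid; Euclidean balls are compared with cubes. *)

Section lebesgue_affine.
Local Open Scope classical_set_scope.
Context {R : realType}.
Notation mu := (@lebesgue_measure R).

Lemma measurable_affine (d c : R) :
  measurable_fun [set: measurableTypeR R] (fun x : R => d * x + c : measurableTypeR R).
Proof. by apply: measurable_funD => //; exact: measurable_funM. Qed.

Lemma preimage_affine_itv (d c x y : R) : 0 < d ->
  (fun z : R => d * z + c) @^-1` `]x, y] = `](x - c) / d, (y - c) / d].
Proof.
move=> d0; apply/seteqP; split => z /=; rewrite !in_itv /= ltr_pdivrMr // ler_pdivlMr //;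
  rewrite (mulrC z) => /andP[h1 h2]; apply/andP; split; lra.
Qed.

(** The pushforward scaled by [d] gives every half-open interval its length, so uniqueness of
    Lebesgue measure applies. *)
Lemma lebesgue_measure_affine (d c : R) (A : set (measurableTypeR R)) : 0 < d -> measurable A ->
  mu A = (d%:E * mu ((fun x => d * x + c)%R @^-1` A))%E.
Proof.
move=> d0 mA; pose f := fun x : R => d * x + c : measurableTypeR R.
have mf : measurable_fun [set: measurableTypeR R] f by exact: measurable_affine.
pose nu : {measure set (measurableTypeR R) -> \bar R} :=
  measure_function_pushforward__canonical__measure_function_Measure mu mf.
have d0' : 0 <= d by exact: ltW.
rewrite (@lebesgue_measure_unique _ (mscale (NngNum d0') nu)) // => X [[x y] _ <-] /=.
rewrite /mscale /= /pushforward /f preimage_affine_itv // !lebesgue_measure_itv /=.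
rewrite !lte_fin ltr_pM2r ?invr_gt0 // ltrD2r; case: ifP => _; last by rewrite mule0.
by rewrite -!EFinB -EFinM; congr EFin; field; rewrite gt_eqF.
Qed.

Lemma integral_affine (d c : R) (f : measurableTypeR R -> \bar R) : 0 < d ->
  measurable_fun setT f -> (forall x, 0 <= f x)%E ->
  (\int[mu]_x f x = d%:E * \int[mu]_x f (d * x + c)%R)%E.
Proof.
move=> d0 mf f0; pose phi := fun x : R => d * x + c : measurableTypeR R.
have mphi : measurable_fun [set: measurableTypeR R] phi by exact: measurable_affine.
pose nu : {measure set (measurableTypeR R) -> \bar R} :=
  measure_function_pushforward__canonical__measure_function_Measure mu mphi.
have d0' : 0 <= d by exact: ltW.
rewrite (@eq_measure_integral _ _ _ setT (mscale (NngNum d0') nu)); last first.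
  move=> A mA _ /=; rewrite /mscale /= /pushforward. by rewrite (lebesgue_measure_affine c d0 mA).
rewrite ge0_integral_mscale //=; congr (_ * _)%E.
by rewrite ge0_integral_pushforward.
Qed.

End lebesgue_affine.

Section lebesgue_tuple.
Local Open Scope classical_set_scope.
Context {R : realType}.
Notation mu := (@lebesgue_measure R).
Notation TR := (measurableTypeR R).
Notation lam := (lebesgue_tuple R).

Lemma lebesgue_tupleS N (A : set (N.+1.-tuple TR)) :
  lam N.+1 A = (\int[mu]_x lam N [set t : N.-tuple TR | A (cons_pair (x, t))])%E.
Proof.
rewrite /= /cons_measure /pushforward /product_measure1.
by apply: eq_integral => x _ /=; congr (lam N _); apply/seteqP; split => t; rewrite /xsection /= inE.
Qed.

Lemma measurable_section N (A : set (N.+1.-tuple TR)) (x : TR) : measurable A ->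
  measurable [set t : N.-tuple TR | A (cons_pair (x, t))].
Proof.
move=> mA; rewrite -[X in measurable X]setTI.
exact: (measurable_cons (measurable_cst x) (@measurable_id _ _ setT)).
Qed.

Lemma measurable_fun_section N (A : set (N.+1.-tuple TR)) : measurable A ->
  measurable_fun [set: TR] (fun x => lam N [set t : N.-tuple TR | A (cons_pair (x, t))]).
Proof.
move=> mA; have mB : measurable (cons_pair @^-1` A).
  rewrite -[X in measurable X]setTI; exact: measurable_cons_pair.
have := @measurable_fun_xsection _ _ _ _ _ (lam N) _ mB.
apply: eq_measurable_fun => x _ /=; congr (lam N _).
by apply/seteqP; split => t; rewrite /xsection /= inE.
Qed.

Definition tuple_affine N (U : 'I_N -> 'I_N -> R) (c : 'I_N -> R) (t : N.-tuple TR) : N.-tuple TR :=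
  [tuple \sum_(i < N) tnth t i * U i j + c j | j < N].

Lemma measurable_tuple_affine N U c : measurable_fun setT (@tuple_affine N U c).
Proof.
apply/measurable_fun_tnthP => j; rewrite (_ : _ \o _ = fun t => \sum_(i < N) tnth t i * U i j + c j).
  apply: measurable_funD => //; apply: measurable_sum => i.
  by apply: measurable_funM => //; exact: measurable_tnth.
by apply/funext => t /=; rewrite tnth_mktuple.
Qed.

Lemma tuple_affineS N (U : 'I_N.+1 -> 'I_N.+1 -> R) (c : 'I_N.+1 -> R) (x : TR) (t : N.-tuple TR) :
  (forall i j : 'I_N.+1, (j < i)%N -> U i j = 0) ->
  tuple_affine U c (cons_pair (x, t)) =
  cons_pair (U ord0 ord0 * x + c ord0,
    tuple_affine (fun i j => U (lift ord0 i) (lift ord0 j))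
      (fun j => x * U ord0 (lift ord0 j) + c (lift ord0 j)) t).
Proof.
move=> hU; apply/eq_from_tnth => j; rewrite tnth_mktuple big_ord_recl tnth0.
have [->|j0] := eqVneq j ord0.
  rewrite tnth0 big1 ?addr0 1?mulrC // => i _; rewrite hU ?mulr0 //.
case: (unliftP ord0 j) j0 => [k ->|->]; last by rewrite eqxx.
move=> _; rewrite tnthS tnth_mktuple -addrA addrCA; congr (_ + _).
by apply: eq_bigr => i _; rewrite tnthS.
Qed.

(** Induction with Fubini: the first coordinate of the image depends on the first coordinate alone,
    and once that one is fixed the others undergo a smaller triangular map whose translation absorbs
    its contribution. *)
Lemma lebesgue_tuple_affine N (U : 'I_N -> 'I_N -> R) (c : 'I_N -> R) (A : set (N.-tuple TR)) :
  (forall i j : 'I_N, (j < i)%N -> U i j = 0) -> (forall i, 0 < U i i) -> measurable A ->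
  (lam N A = (\prod_(i < N) U i i)%:E * lam N (tuple_affine U c @^-1` A))%E.
Proof.
elim: N U c A => [|N IH] U c A hU U0 mA.
  rewrite big_ord0 mul1e; congr (lam 0%N _); apply/seteqP.
  by split => t /=; rewrite (tuple0 (tuple_affine U c t)) (tuple0 t).
rewrite !lebesgue_tupleS (@integral_affine _ (U ord0 ord0) (c ord0)) //; last 1 first.
- exact: measurable_fun_section.
rewrite big_ord_recl EFinM -muleA; congr (_ * _)%E.
set P := \prod_(i < N) _.
have P0 : 0 < P by apply: prodr_gt0.
rewrite -ge0_integralZl //; first last.
- by rewrite lee_fin ltW.
- apply: measurable_fun_section; rewrite -[X in measurable X]setTI; exact: measurable_tuple_affine.
apply: eq_integral => x _.
rewrite (IH (fun i j => U (lift ord0 i) (lift ord0 j))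
      (fun j => x * U ord0 (lift ord0 j) + c (lift ord0 j))) //.
- congr (_ * lam N _)%E; apply/seteqP; split => t /=; by rewrite tuple_affineS.
- by move=> i j ij; apply: hU; rewrite /= /bump /= !add1n ltnS.
- exact: measurable_section.
Qed.

Lemma lebesgue_tuple_cube N (c : 'I_N -> R) (h : R) : 0 <= h ->
  measurable [set t : N.-tuple TR | forall i, `|tnth t i - c i| <= h] /\
  lam N [set t | forall i, `|tnth t i - c i| <= h] = (((2 * h) ^+ N)%:E)%E.
Proof.
move=> h0; split.
  rewrite (_ : [set _ | _] = \bigcap_(i in [set: 'I_N]) ((@tnth N TR ^~ i) @^-1` `[c i - h, c i + h])).
    apply: fin_bigcap_measurable => // i _.
    by rewrite -[X in measurable X]setTI; exact: measurable_tnth.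
  apply/seteqP; split => t /= ht i.
    by move=> _ /=; rewrite in_itv /= -ler_distl.
  by have := ht i Logic.I; rewrite /= in_itv /= -ler_distl.
elim: N c => [|N IH] c.
  by rewrite expr0 /= diracE (_ : [set _ | _] = setT) ?in_setT //; apply/seteqP; split => // t _ [].
rewrite lebesgue_tupleS.
transitivity (\int[mu]_x ((2 * h) ^+ N * \1_(`[c ord0 - h, c ord0 + h]) x)%:E)%E.
  apply: eq_integral => x _; rewrite indicE mem_setE in_itv /= -ler_distl.
  case: (boolP (`|x - c ord0| <= h)) => hx; last first.
    rewrite mulr0 (_ : [set _ | _] = set0) ?measure0 //.
    by apply/seteqP; split => t //= /(_ ord0); rewrite tnth0 => ht; rewrite ht in hx.
  rewrite mulr1 -(IH (fun i => c (lift ord0 i))); congr (lam N _).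
  apply/seteqP; split => t /= ht i.
    by have := ht (lift ord0 i); rewrite tnthS.
  by case: (unliftP ord0 i) => [j ->|->]; rewrite ?tnthS ?tnth0.
under eq_integral do rewrite EFinM.
rewrite ge0_integralZl_EFin //; [|by apply/measurable_EFinP|by rewrite exprn_ge0 ?mulr_ge0].
rewrite integral_indic // setIT /= lebesgue_measure_itv /= lte_fin.
rewrite exprSr EFinM; congr (_ * _)%E; case: ifPn => h1; first by rewrite -EFinB; congr EFin; ring.
by congr EFin; lra.
Qed.

End lebesgue_tuple.

Section vol.
Local Open Scope classical_set_scope.
Context {R : realType} {N : nat}.
Notation TR := (measurableTypeR R).
Implicit Types (A B : set 'rV[R]_N) (c : 'rV[R]_N).

Definition row_tuple (t : N.-tuple TR) : 'rV[R]_N := \row_(i < N) (tnth t i : R).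

Definition tmeasurable A := measurable (@row_tuple @^-1` A).

Definition cube c (h : R) : set 'rV[R]_N := [set x | forall i, `|x 0 i - c 0 i| <= h].

Lemma vol_cube c (h : R) : 0 <= h -> tmeasurable (cube c h) /\ vol (cube c h) = ((2 * h) ^+ N)%:E.
Proof.
move=> h0; have [mc <-] := @lebesgue_tuple_cube R N (c 0) h h0.
have E : row_tuple @^-1` cube c h = [set t : N.-tuple TR | forall i, `|tnth t i - c 0 i| <= h].
  by apply/seteqP; split => t /= ht i; have := ht i; rewrite !mxE.
by split; rewrite ?/tmeasurable ?E // /vol -E.
Qed.

Lemma vol_ge0 A : (0 <= vol A)%E.
Proof. exact: measure_ge0. Qed.

Lemma vol_le A B : tmeasurable A -> tmeasurable B -> A `<=` B -> (vol A <= vol B)%E.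
Proof. by move=> mA mB AB; apply: le_measure; rewrite ?inE // => t; exact: AB. Qed.

Lemma vol_ge_cube A c (h : R) : 0 <= h -> tmeasurable A -> cube c h `<=` A ->
  (((2 * h) ^+ N)%:E <= vol A)%E.
Proof. by move=> h0 mA cA; have [mc <-] := vol_cube c h0; exact: vol_le. Qed.

Lemma vol_le_cover A (I : finType) (S : {set I}) (c : I -> 'rV[R]_N) (h : R) : 0 <= h ->
  tmeasurable A -> (forall x, A x -> exists2 i, i \in S & cube (c i) h x) ->
  (vol A <= (#|S|%:R * (2 * h) ^+ N)%:E)%E.
Proof.
move=> h0 mA AS.
pose F (i : I) : set (N.-tuple TR) := row_tuple @^-1` cube (c i) h.
have mF i : measurable (F i) by have [] := vol_cube (c i) h0.
have fS : finite_set [set i | i \in S] by exact: finite_finset.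
have le : (lebesgue_tuple R N (row_tuple @^-1` A) <=
    \sum_(i \in [set i | i \in S]) lebesgue_tuple R N (F i))%E.
  apply: content_sub_fsum => //.
  by move=> t /AS[i iS ci]; exists i.
apply: (le_trans le); rewrite fsbig_finite //=.
rewrite (eq_bigr (fun=> ((2 * h) ^+ N)%:E)); last first.
  by move=> i _; have [_ <-] := vol_cube (c i) h0.
rewrite sumEFin lee_fin big_const_seq iter_addr_0 -[X in X <= _]mulr_natl.
apply: ler_wpM2r.
  by rewrite exprn_ge0 // mulr_ge0.
rewrite ler_nat count_predT; apply: eq_leq.
rewrite cardE; apply/perm_size/uniq_perm; [exact: finmap.fset_uniq|exact: enum_uniq|].
by move=> i; rewrite in_fset_set // mem_enum; apply/idP/idP; rewrite inE.
Qed.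

Lemma tmeasurable_fun (f : 'rV[R]_N -> R) a :
  measurable_fun setT (fun t : N.-tuple TR => f (row_tuple t) : TR) -> tmeasurable [set x | f x <= a].
Proof.
move=> mf; rewrite /tmeasurable (_ : _ @^-1` _ = (fun t => f (row_tuple t)) @^-1` `]-oo, a]).
  by rewrite -[X in measurable X]setTI; exact: mf.
by apply/seteqP; split => t /=; rewrite in_itv.
Qed.

Lemma measurable_coord i : measurable_fun setT (fun t : N.-tuple TR => row_tuple t 0 i : TR).
Proof.
rewrite (_ : (fun _ => _) = (@tnth _ TR ^~ i)); first exact: measurable_tnth.
by apply/funext => t; rewrite mxE.
Qed.

(** A function that is 1-Lipschitz for the l_1 norm is the infimum of the cones [g v] with apex at
    rational points, a countable family of measurable functions. It is meant for the projective
    norm, itself an uncountable infimum. *)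
Lemma tmeasurable_lipschitz (f : 'rV[R]_N -> R) a :
  (forall x y, f x - f y <= \sum_i `|x 0 i - y 0 i|) -> tmeasurable [set x | f x <= a].
Proof.
move=> lf.
pose w (v : N.-tuple rat) : 'rV[R]_N := \row_i ratr (tnth v i).
pose g (v : N.-tuple rat) (x : 'rV[R]_N) : R := f (w v) + \sum_i `|x 0 i - w v 0 i|.
(* [unpickle] enumerates the rational tuples; indices that code none contribute the empty set. *)
pose G (k m : nat) : set (N.-tuple TR) :=
  if unpickle k is Some v then (fun t => g v (row_tuple t)) @^-1` `]-oo, (a + m.+1%:R^-1)[ else set0.
rewrite /tmeasurable (_ : _ @^-1` _ = \bigcap_m \bigcup_k G k m).
  apply: bigcap_measurable => // m _; apply: bigcup_measurable => k _; rewrite /G.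
  case: unpickle => [v|//].
  rewrite -[X in measurable X]setTI.
  have mg : measurable_fun setT (fun t => g v (row_tuple t) : TR).
    apply: measurable_funD => //; apply: measurable_sum => i.
    apply: measurableT_comp => //; apply: measurable_funB => //; exact: measurable_coord.
  exact: mg.
apply/seteqP; split => t /=.
  set x := row_tuple t => fx m _.
  pose e : R := (m.+1%:R^-1) / (2 * N.+1%:R).
  have e0 : 0 < e by rewrite /e divr_gt0.
  have ex i : exists q : rat, `|x 0 i - ratr q| < e.
    have [q hq] := @rat_in_itvoo R (x 0 i - e) (x 0 i + e) ltac:(lra).
    by exists q; move: hq; rewrite in_itv /= distrC ltr_distl.
  have [q hq] := choice ex.
  exists (pickle [tuple q i | i < N]) => //=; rewrite /G pickleK /= in_itv /=.
  have hs : \sum_i `|x 0 i - w [tuple q i | i < N] 0 i| <= N%:R * e.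
    rewrite mulr_natl -[X in _ *+ X](card_ord N) -sumr_const; apply: ler_sum => i _.
   by have := hq i; rewrite [w _ 0 i]mxE tnth_mktuple => /ltW.
  have h2 := lf (w [tuple q i | i < N]) x.
  have h3 : \sum_i `|w [tuple q i | i < N] 0 i - x 0 i| = \sum_i `|x 0 i - w [tuple q i | i < N] 0 i|.
    by apply: eq_bigr => i _; rewrite distrC.
  rewrite /g -/x; rewrite h3 in h2.
  suff : 2 * (N%:R * e) < m.+1%:R^-1.
    by move: h2 hs fx; move: (\sum_i _) (N%:R * e) (f x) (f (w _)) (m.+1%:R^-1) => S E X Y Z; lra.
  rewrite /e; set z := m.+1%:R^-1; have z0 : 0 < z by rewrite invr_gt0.
  have -> : 2 * (N%:R * (z / (2 * N.+1%:R))) = z * (N%:R / N.+1%:R).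
    have : N.+1%:R != 0 :> R by rewrite pnatr_eq0.
    by move: N.+1%:R => M M0; field.
  by rewrite -[X in _ < X]mulr1 ltr_pM2l // ltr_pdivrMr // mul1r ltr_nat.
move=> h; apply/ler_addgt0Pr => e e0.
have [m hm] : exists m : nat, m.+1%:R^-1 < e.
  exists (Num.truncn e^-1); rewrite invf_plt ?posrE //; exact: truncnS_gt.
have [k _] := h m Logic.I; rewrite /G; case: unpickle => // v /=; rewrite in_itv /= /g.
have := lf (row_tuple t) (w v); move: hm; move: (m.+1%:R^-1) => z; lra.
Qed.

Lemma vol_triangular A (U : 'M[R]_N) c :
  (forall i j : 'I_N, (j < i)%N -> U i j = 0) -> (forall i, 0 < U i i) -> tmeasurable A ->
  (vol A = (\prod_(i < N) U i i)%:E * vol [set u | A (c + u *m U)%R])%E.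
Proof.
move=> hU U0 mA; rewrite /vol (@lebesgue_tuple_affine _ _ (fun i j => U i j) (fun j => c 0 j)) //.
congr (_ * lebesgue_tuple R N _)%E; apply/seteqP; split => t /=;
  rewrite (_ : \row_i tnth (tuple_affine _ _ t) i = c + \row_i tnth t i *m U) //;
  apply/rowP => j; rewrite !mxE tnth_mktuple addrC; congr (_ + _);
  by apply: eq_bigr => i _; rewrite mxE.
Qed.

End vol.

(** * Inequalities for real powers and the l_p norms *)

Section powR.
Context {R : realType}.
Implicit Types x y z t a d e : R.

(** The exponential lies above its tangent at the weighted mean [M] of the logarithms; in the
    weighted sum of these tangent bounds the linear terms cancel. A zero [x i] kills the product if
    its weight is nonzero and contributes 0^0 = 1 otherwise. *)
Lemma powR_amgm (I : finType) (w x : I -> R) : (forall i, 0 <= w i) -> \sum_i w i = 1 ->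
  (forall i, 0 <= x i) -> \prod_i x i `^ w i <= \sum_i w i * x i.
Proof.
move=> w0 w1 x0.
have [[i xi wi]|h] := pselect (exists2 i, x i = 0 & w i != 0).
  rewrite (bigD1 i) //= xi powR0 // mul0r.
  by apply: sumr_ge0 => j _; rewrite mulr_ge0.
have P i : x i `^ w i = expR (w i * ln (x i)).
  rewrite /powR; case: eqP => // xi; case: eqP => [->|/eqP wi]; first by rewrite mul0r expR0.
  by case: h; exists i.
rewrite (eq_bigr _ (fun i _ => P i)) -expR_sum.
set M := \sum_i _.
suff le i : expR M * (w i * (1 + ln (x i) - M)) <= w i * x i.
  apply: le_trans (ler_sum _ (fun i _ => le i)); rewrite -mulr_sumr.
  rewrite -[X in X <= _]mulr1 ler_pM2l ?expR_gt0 //.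
  rewrite (eq_bigr (fun i => (1 - M) * w i + w i * ln (x i))); last by move=> j _; ring.
  by rewrite big_split /= -mulr_sumr w1 -/M; lra.
have [wi|wi] := eqVneq (w i) 0; first by rewrite wi !mul0r mulr0.
have xi : 0 < x i.
  by rewrite lt_neqAle x0 andbT eq_sym; apply/eqP => xi; apply: h; exists i.
rewrite mulrCA ler_wpM2l // -[X in _ <= X]lnK ?posrE // -[X in _ <= expR X](subrK M) expRD mulrC.
rewrite ler_pM2r ?expR_gt0 // -addrA; exact: expR_ge1Dx.
Qed.

Lemma powR_bernoulli_le x t : 0 <= x -> 0 <= t <= 1 -> x `^ t <= 1 + t * (x - 1).
Proof.
move=> x0 /andP[t0 t1].
have := @powR_amgm bool (fun b => if b then t else 1 - t) (fun b => if b then x else 1).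
rewrite !big_bool /= powR1 !mulr1 => h.
have -> : 1 + t * (x - 1) = t * x + (1 - t) by ring.
apply: h; [by case; lra|by ring|by case; lra].
Qed.

Lemma powR_bernoulli_ge x t : 0 <= x -> 1 <= t -> 1 + t * (x - 1) <= x `^ t.
Proof.
move=> x0 t1; have t0 : 0 < t by lra.
have := @powR_bernoulli_le (x `^ t) t^-1 (powR_ge0 _ _).
rewrite -powRrM divff ?gt_eqF // powRr1 // invr_ge0 (ltW t0) invf_le1 // => /(_ t1) h.
have : t * (x - 1) <= t * (t^-1 * (x `^ t - 1)) by apply: ler_wpM2l; lra.
by rewrite mulrA divff ?gt_eqF //; lra.
Qed.

Lemma powR_subadd x y t : 0 <= x -> 0 <= y -> 0 <= t <= 1 -> (x + y) `^ t <= x `^ t + y `^ t.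
Proof.
move=> x0 y0 t01; have /andP[t0 t1] := t01.
have [xy|xy] := eqVneq (x + y) 0.
  have -> : x = 0 by lra.
  have -> : y = 0 by lra.
  by rewrite addr0 lerDl powR_ge0.
have s0 : 0 < x + y by rewrite lt_neqAle eq_sym xy; lra.
have key z : 0 <= z -> z <= x + y -> z / (x + y) * (x + y) `^ t <= z `^ t.
  move=> z0 zs; have -> : z `^ t = (z / (x + y)) `^ t * (x + y) `^ t.
    by rewrite -powRM ?divfK // ?divr_ge0 // ltW.
  rewrite ler_wpM2r ?powR_ge0 //.
  have [->|zn] := eqVneq z 0; first by rewrite mul0r powR_ge0.
  apply: ger1_powR => //; rewrite ler_pdivrMr // mul1r zs andbT.
  by rewrite divr_gt0 // lt_def zn.
have -> : (x + y) `^ t = x / (x + y) * (x + y) `^ t + y / (x + y) * (x + y) `^ t.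
  by rewrite -!mulrDl divff // mul1r.
by apply: lerD; apply: key => //; lra.
Qed.

(** The lower bound is convexity. For the upper bound, t/2 <= 1 makes |1 + e|^t a concave power of
    the square (1 + e)^2. *)
Lemma powR_slope1 t e : 1 <= t <= 2 ->
  0 <= `|1 + e| `^ t - 1 - t * e <= 2 * `|e| `^ t.
Proof.
move=> /andP[t1 t2]; apply/andP; split.
  have := @powR_bernoulli_ge `|1 + e| t (normr_ge0 _) t1.
  have h : 1 + e <= `|1 + e| by exact: ler_norm.
  have : 0 <= t * (`|1 + e| - (1 + e)) by apply: mulr_ge0; lra.
  lra.
have ht : 0 <= t / 2 <= 1 by lra.
have e0 : 0 <= `|e| `^ t by exact: powR_ge0.
have sq z : `|z| `^ t = (z ^+ 2) `^ (t / 2).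
  rewrite -(@real_normK _ z) ?num_real // -powR_mulrn // -powRrM.
  by congr (_ `^ _); field.
have [h|h] := leP 0 (1 + 2 * e).
  (* Subadditivity of the power t/2 splits off |e|^t, and Bernoulli bounds (1 + 2e)^(t/2) by 1 +
     te. *)
  rewrite (sq (1 + e)) (_ : (1 + e) ^+ 2 = (1 + 2 * e) + e ^+ 2); last by ring.
  have h1 := @powR_subadd (1 + 2 * e) (e ^+ 2) (t / 2) h (sqr_ge0 _) ht.
  have h2 := @powR_bernoulli_le (1 + 2 * e) (t / 2) h ht.
  rewrite -(sq e) in h1; lra.
(* Now e < -1/2, so |1 + e| <= |e|, and the tangent bound for |e|^t at 1 absorbs the term -te. *)
have h1 : `|1 + e| `^ t <= `|e| `^ t.
  apply: ge0_ler_powR; rewrite ?nnegrE //; first by lra.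
  rewrite [X in _ <= X]ltr0_norm; last by lra.
  by rewrite ler_norml; lra.
have h2 := @powR_bernoulli_ge `|e| t (normr_ge0 _) t1.
rewrite {1}ltr0_norm in h2; last by lra.
by nra.
Qed.

(** This one-variable smoothness, summed over coordinates, is the form in which type [t] enters
    Maurey's argument. Homogeneity reduces it to the base point 1. *)
Lemma powR_slope t a : 1 <= t <= 2 -> exists c, forall d,
  0 <= `|a + d| `^ t - `|a| `^ t - c * d <= 2 * `|d| `^ t.
Proof.
move=> t12; have t0 : t != 0 by lra.
have [->|a0] := eqVneq a 0.
  exists 0 => d; rewrite add0r normr0 powR0 // mul0r !subr0 powR_ge0 /=.
  by have := powR_ge0 `|d| t; lra.
exists (t * `|a| `^ t / a) => d.
have -> : `|a + d| `^ t - `|a| `^ t - t * `|a| `^ t / a * d =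
    `|a| `^ t * (`|1 + d / a| `^ t - 1 - t * (d / a)).
  have -> : `|a + d| `^ t = `|a| `^ t * `|1 + d / a| `^ t.
    by rewrite -powRM // -normrM mulrDr mulr1 mulrCA divff // mulr1.
  by ring.
have -> : 2 * `|d| `^ t = `|a| `^ t * (2 * `|d / a| `^ t).
  by rewrite mulrCA -powRM // -normrM mulrCA divff // mulr1.
have /andP[h1 h2] := powR_slope1 (d / a) t12.
by rewrite mulr_ge0 ?powR_ge0 //= ler_wpM2l ?powR_ge0.
Qed.

Lemma powR_normD t a (b : R) : 1 <= t <= 2 -> `|a + b| `^ t <= 4 * (`|a| `^ t + `|b| `^ t).
Proof.
move=> /andP[t1 t2].
wlog ab : a b / `|b| <= `|a|.
  by move=> H; case: (leP `|b| `|a|) => h; [exact: H|rewrite addrC [X in 4 * X]addrC; apply: H; exact: ltW].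
have h : `|a + b| `^ t <= (2 * `|a|) `^ t.
  apply: ge0_ler_powR; rewrite ?nnegrE ?mulr_ge0 //; first by lra.
  by apply: le_trans (ler_normD _ _) _; lra.
apply: (le_trans h); rewrite powRM //.
have h2 : (2 : R) `^ t <= 4.
  have -> : 4 = (2 : R) `^ 2 by rewrite (@powR_mulrn _ _ 2) // expr2; ring.
  by rewrite ler_powR //; lra.
have ha := powR_ge0 `|a| t; have hb := powR_ge0 `|b| t.
apply: le_trans (_ : 4 * `|a| `^ t <= _); first exact: ler_wpM2r.
by lra.
Qed.

(** Jensen's inequality: the tangent of the concave power at the uniform weight 1/n, supplied by
    Bernoulli, is summed over [i]. *)
Lemma sum_powR_le n (u : 'I_n -> R) t : (0 < n)%N -> (forall i, 0 <= u i) -> \sum_i u i <= 1 ->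
  0 <= t <= 1 -> \sum_i u i `^ t <= n%:R `^ (1 - t).
Proof.
move=> n0 u0 u1 t01; have /andP[t0 t1] := t01.
have N0 : 0 < n%:R :> R by rewrite ltr0n.
have le i : u i `^ t <= n%:R `^ (- t) * (1 + t * (n%:R * u i - 1)).
  have -> : u i `^ t = n%:R `^ (- t) * (n%:R * u i) `^ t.
    rewrite (powRM t (ltW N0) (u0 i)) mulrA -powRD ?addNr ?powRr0 ?mul1r //.
    by rewrite (gt_eqF N0) implybT.
  rewrite ler_wpM2l ?powR_ge0 // powR_bernoulli_le // mulr_ge0 //; exact: ltW.
apply: le_trans (ler_sum _ (fun i _ => le i)) _; rewrite -mulr_sumr.
have -> : n%:R `^ (1 - t) = n%:R `^ (- t) * n%:R :> R.
  rewrite addrC powRD; last by rewrite (gt_eqF N0) implybT.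
  by rewrite (powRr1 (ltW N0)).
rewrite ler_wpM2l ?powR_ge0 // big_split /= -mulr_sumr sumrB -mulr_sumr !sumr_const card_ord.
set S := \sum_i _ in u1 *.
have := mulr_ge0 t0 (mulr_ge0 (ltW N0) (_ : 0 <= 1 - S)); rewrite subr_ge0 => /(_ u1); lra.
Qed.

End powR.

Section lp_norm.
Context {R : realType}.
Implicit Types (p : \bar R) (a s x : R) (n : nat).

Lemma powRVK s x : 0 <= x -> s != 0 -> (x `^ s^-1) `^ s = x.
Proof. by move=> x0 s0; rewrite -powRrM mulVf // powRr1. Qed.

Lemma powR_one s : 1 = 1 `^ s.
Proof. by rewrite powR1. Qed.

Lemma rinv_fin s : rinv s%:E = s^-1.
Proof. exact: fine_invr. Qed.

Lemma rinv_pinfty : rinv (+oo%E : \bar R) = 0.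
Proof. by rewrite /rinv invey. Qed.

Lemma rinv_ge0 p : (1%:E <= p)%E -> 0 <= rinv p.
Proof.
case: p => [s||] //; rewrite ?rinv_pinfty // rinv_fin lee_fin invr_ge0; lra.
Qed.

Lemma rinv_le1 p : (1%:E <= p)%E -> rinv p <= 1.
Proof.
by case: p => [s||] //; rewrite ?rinv_pinfty // rinv_fin lee_fin => s1; rewrite invf_le1 //; lra.
Qed.

Lemma rinv_le p q : (1%:E <= p)%E -> (p <= q)%E -> rinv q <= rinv p.
Proof.
case: p => [s||] //; case: q => [z||] //; rewrite ?rinv_pinfty // ?rinv_fin ?lee_fin => s1.
  by move=> sz; rewrite lef_pV2 // posrE; lra.
by rewrite invr_ge0; lra.
Qed.

Lemma rinv2 : rinv (2%:E : \bar R) = 2^-1.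
Proof. exact: rinv_fin. Qed.

(* The [l_p] norm of [x] is at most 1, where [a = 1/p]; for [p] infinite, [u i `^ 0 = 1]. *)
Definition lpu a n (x : 'rV[R]_n) : Prop := exists u : 'I_n -> R,
  [/\ forall i, 0 <= u i, \sum_i u i <= 1 & forall i, `|x 0 i| <= u i `^ a].

Lemma lp_norm_le1 p n (x : 'rV[R]_n) : (1%:E <= p)%E -> lp_norm p x <= 1 <-> lpu (rinv p) x.
Proof.
case: p => [s||] //= hs; last first.
  rewrite rinv_pinfty; split => [h|[u [u0 u1 xu]]].
    exists (fun=> 0); split => //; first by rewrite big1.
    by move=> i; rewrite powRr0; apply: le_trans h; apply: (le_bigmax 0 (fun i => `|x ord0 i|) i).
  by apply: bigmax_le => // i _; have := xu i; rewrite powRr0.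
have s0 : 0 < s by move: hs; rewrite lee_fin; lra.
have sn : s != 0 by rewrite gt_eqF.
rewrite rinv_fin; split => [h|[u [u0 u1 xu]]].
  exists (fun i => `|x ord0 i| `^ s); split => [i||i]; first exact: powR_ge0.
    have S0 : 0 <= \sum_(i < n) `|x ord0 i| `^ s by apply: sumr_ge0 => i _; exact: powR_ge0.
    rewrite -[X in X <= _](powRVK S0 sn) [X in _ <= X](powR_one s).
    by apply: ge0_ler_powR => //; rewrite ?nnegrE ?powR_ge0 // ltW.
  by rewrite -powRrM divff // powRr1.
rewrite [X in _ <= X](powR_one s^-1).
apply: ge0_ler_powR; rewrite ?nnegrE ?invr_ge0 ?(ltW s0) //.
  by apply: sumr_ge0 => i _; exact: powR_ge0.
apply: le_trans u1; apply: ler_sum => i _.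
rewrite -[X in _ <= X](powRVK (u0 i) sn).
by apply: ge0_ler_powR; rewrite ?nnegrE ?powR_ge0 ?(ltW s0).
Qed.

Lemma lp_norm_ge0 p n (x : 'rV[R]_n) : 0 <= lp_norm p x.
Proof.
case: p => [s||] //=; first exact: powR_ge0.
elim/big_ind: _ => // y z y0 z0; by rewrite le_max y0.
Qed.

Lemma lp_normZ p n c (x : 'rV[R]_n) : (1%:E <= p)%E -> lp_norm p (c *: x) = `|c| * lp_norm p x.
Proof.
case: p => [s||] //= hs.
  have s0 : 0 < s by move: hs; rewrite lee_fin; lra.
  have -> : \sum_(i < n) `|(c *: x) ord0 i| `^ s = `|c| `^ s * \sum_(i < n) `|x ord0 i| `^ s.
    by rewrite mulr_sumr; apply: eq_bigr => i _; rewrite mxE normrM powRM.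
  rewrite powRM ?powR_ge0 //; last by apply: sumr_ge0 => i _; exact: powR_ge0.
  by rewrite -powRrM divff ?gt_eqF // powRr1.
have E (y z : R) : `|c| * Num.max y z = Num.max (`|c| * y) (`|c| * z) by rewrite maxr_pMr.
rewrite (big_morph _ E (mulr0 _)).
by apply: eq_bigr => i _; rewrite mxE normrM.
Qed.

Lemma lp_norm_eq0 p n (x : 'rV[R]_n) : (1%:E <= p)%E -> lp_norm p x = 0 -> x = 0.
Proof.
move=> p1 x0; apply/rowP => i; rewrite mxE; apply/eqP/negPn/negP => xi.
have : lp_norm p (((2 / `|x 0 i|)) *: x) <= 1 by rewrite lp_normZ // x0 mulr0.
move/(lp_norm_le1 _ p1) => [u [u0 u1 xu]]; have := xu i.
rewrite mxE normrM ger0_norm ?divr_ge0 // divfK ?normr_eq0 //.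
have ui : u i <= 1 by apply: le_trans u1; rewrite (bigD1 i) //= lerDl sumr_ge0.
have : u i `^ rinv p <= 1 `^ rinv p.
  by apply: ge0_ler_powR; rewrite ?nnegrE ?rinv_ge0.
rewrite powR1; lra.
Qed.

(** The factor is the norm of the identity from l_(1/al) to l_(1/a), which is 1 when a <= al. *)
Lemma lpu_embed n (al a : R) (x : 'rV[R]_n) : (0 < n)%N -> 0 <= al -> 0 <= a -> lpu al x ->
  lpu a ((n%:R `^ Num.max (a - al) 0)^-1 *: x).
Proof.
move=> n0 al0 a0 [u [u0 u1 xu]].
have N0 : 0 < n%:R :> R by rewrite ltr0n.
have [h|h] := leP a al.
  rewrite max_r ?subr_le0 // powRr0 invr1 scale1r; exists u; split => // i.
  apply: (le_trans (xu i)).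
  have ui : u i <= 1 by apply: le_trans u1; rewrite (bigD1 i) //= lerDl sumr_ge0.
  (* A zero weight is treated apart because 0^0 = 1, so powers of 0 jump at exponent 0. *)
  have [ui0|ui0] := eqVneq (u i) 0; last first.
    by apply: ger_powR => //; rewrite ui lt_def ui0 u0.
  rewrite ui0; have [->|ane] := eqVneq a 0; last by rewrite !powR0 //; lra.
  rewrite powRr0; have [->|alne] := eqVneq al 0; first by rewrite powRr0.
  by rewrite powR0.
rewrite max_l ?subr_ge0 ?ltW //.
have apos : 0 < a by lra.
have t01 : 0 <= al / a <= 1 by rewrite divr_ge0 //= ler_pdivrMr // mul1r ltW.
(* The power al/a converts weights for [al] into weights for [a]; concavity bounds their sum by n^(1
   - al/a), hence the normalisation. *)
exists (fun i => u i `^ (al / a) / n%:R `^ (1 - al / a)); split => [i||i].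
- by rewrite divr_ge0 ?powR_ge0.
- by rewrite -mulr_suml ler_pdivrMr ?powR_gt0 // mul1r sum_powR_le.
rewrite mxE powRM ?powR_ge0 ?invr_ge0 ?powR_ge0 // -powRrM divfK ?gt_eqF //.
have -> : (n%:R `^ (1 - al / a))^-1 `^ a = (n%:R `^ (a - al))^-1 :> R.
  rewrite -powRN -powRrM -powRN; congr (_ `^ _); field; exact: lt0r_neq0.
rewrite normrM ger0_norm ?invr_ge0 ?powR_ge0 // mulrC ler_wpM2r //.
Qed.

Lemma lpu_lp_norm p n al (x : 'rV[R]_n) : (1%:E <= p)%E -> (0 < n)%N -> 0 <= al -> lpu al x ->
  lp_norm p x <= n%:R `^ Num.max (rinv p - al) 0.
Proof.
move=> p1 n0 al0 /(lpu_embed n0 al0 (rinv_ge0 p1)) /(lp_norm_le1 _ p1).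
have N0 : 0 < n%:R `^ Num.max (rinv p - al) 0 :> R by rewrite powR_gt0 // ltr0n.
by rewrite lp_normZ // ger0_norm ?invr_ge0 ?(ltW N0) // mulrC ler_pdivrMr // mul1r.
Qed.

End lp_norm.

(** * The projective norm and separation *)

Section dot.
Context {R : realType} {N : nat}.
Implicit Types T A B : 'rV[R]_N.

Definition dot T A : R := \sum_m T 0 m * A 0 m.

Lemma dotDr T A B : dot T (A + B) = dot T A + dot T B.
Proof. by rewrite /dot -big_split; apply: eq_bigr => m _; rewrite mxE mulrDr. Qed.

Lemma dotZr T c A : dot T (c *: A) = c * dot T A.
Proof. by rewrite /dot mulr_sumr; apply: eq_bigr => m _; rewrite mxE mulrCA. Qed.

Lemma dotC T A : dot T A = dot A T.
Proof. by apply: eq_bigr => m _; rewrite mulrC. Qed.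

Lemma dotNr T A : dot T (- A) = - dot T A.
Proof. by rewrite -scaleN1r dotZr mulN1r. Qed.

Lemma dotBr T A B : dot T (A - B) = dot T A - dot T B.
Proof. by rewrite dotDr dotNr. Qed.

Lemma dotNl T A : dot (- T) A = - dot T A.
Proof. by rewrite dotC dotNr dotC. Qed.

Lemma dotBl T A B : dot (A - B) T = dot A T - dot B T.
Proof. by rewrite !(dotC _ T) dotBr. Qed.

Lemma dot_sumr T (I : Type) (s : seq I) (F : I -> 'rV[R]_N) :
  dot T (\sum_(i <- s) F i) = \sum_(i <- s) dot T (F i).
Proof.
elim/big_ind2: _ => //; last by move=> ? ? ? ? <- <-; rewrite dotDr.
by rewrite /dot big1 // => m _; rewrite mxE mulr0.
Qed.

Lemma dot_ge0 A : 0 <= dot A A.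
Proof. by apply: sumr_ge0 => m _; exact: sqr_ge0. Qed.

Lemma sum_norm_sqr_le A : (\sum_m `|A 0 m|) ^+ 2 <= N%:R * dot A A.
Proof.
rewrite expr2 mulr_suml; pose f (m : 'I_N) := 2^-1 * (A 0 m * A 0 m).
have le (m l : 'I_N) : `|A 0 m| * `|A 0 l| <= f m + f l.
  have := sqr_ge0 (`|A 0 m| - `|A 0 l|); have := @real_normK _ (A 0 m); have := @real_normK _ (A 0 l).
  by move=> /(_ (num_real _)) h1 /(_ (num_real _)) h2; rewrite /f; nra.
apply: (@le_trans _ _ (\sum_m \sum_l (f m + f l))).
  by apply: ler_sum => m _; rewrite mulr_sumr; apply: ler_sum => l _.
have -> : \sum_m \sum_l (f m + f l) = N%:R * \sum_m f m + N%:R * \sum_m f m.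
  rewrite (eq_bigr (fun m => N%:R * f m + \sum_l f l)); last first.
    by move=> m _; rewrite big_split /= sumr_const card_ord mulr_natl.
  by rewrite big_split /= -mulr_sumr sumr_const card_ord mulr_natl.
by rewrite /f -mulr_sumr -/(dot A A); lra.
Qed.

End dot.

Section tensor.
Context {R : realType} {n : nat}.
Implicit Types (T A B : 'rV[R]_(n * n * n)) (x y z : 'rV[R]_n).

Definition tidx (i j k : 'I_n) : 'I_(n * n * n) := mxvec_index (mxvec_index i j) k.

Definition mkten (f : 'I_n -> 'I_n -> 'I_n -> R) : 'rV[R]_(n * n * n) :=
  mxvec (\matrix_(a, k) mxvec (\matrix_(i, j) f i j k) 0 a).

Lemma tidxP m : exists i j k, m = tidx i j k.
Proof. by case/mxvec_indexP: m => a k; case/mxvec_indexP: a => i j; exists i, j, k. Qed.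

Lemma sum_mxvec_index (V : nmodType) (m l : nat) (F : 'I_(m * l) -> V) :
  \sum_s F s = \sum_i \sum_j F (mxvec_index i j).
Proof.
rewrite pair_bigA /= (reindex (uncurry (@mxvec_index m l))).
  by apply: eq_bigr => -[].
exact: curry_mxvec_bij.
Qed.

Lemma mxvec_index_eq (m l : nat) (i i' : 'I_m) (j j' : 'I_l) :
  (mxvec_index i j == mxvec_index i' j') = (i == i') && (j == j').
Proof.
have [g gK _] := curry_mxvec_bij m l.
by rewrite (inj_eq (can_inj (fun u => gK u isT)) (i, j) (i', j')) xpair_eqE.
Qed.

Lemma sum_tidx (V : nmodType) (F : 'I_(n * n * n) -> V) :
  \sum_m F m = \sum_i \sum_j \sum_k F (tidx i j k).
Proof. by rewrite !sum_mxvec_index. Qed.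

Lemma mktenE f i j k : mkten f 0 (tidx i j k) = f i j k.
Proof. by rewrite /mkten /tidx mxvecE mxE mxvecE mxE. Qed.

Lemma tens3E x y z i j k : tens3 x y z 0 (tidx i j k) = x 0 i * y 0 j * z 0 k.
Proof. by rewrite /tens3 /tens /tidx mxvecE mxE big_ord1 mxE mxvecE mxE big_ord1 mxE. Qed.

Lemma dot_tens3 T x y z :
  dot T (tens3 x y z) = \sum_i \sum_j \sum_k T 0 (tidx i j k) * (x 0 i * y 0 j * z 0 k).
Proof.
rewrite /dot sum_tidx; apply: eq_bigr => i _; apply: eq_bigr => j _.
by apply: eq_bigr => k _; rewrite tens3E.
Qed.

Lemma tens3Z a b c x y z : tens3 (a *: x) (b *: y) (c *: z) = (a * b * c) *: tens3 x y z.
Proof.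
apply/rowP => m; have [i [j [k ->]]] := tidxP m.
by rewrite [RHS]mxE !tens3E !mxE; ring.
Qed.

End tensor.

Section proj_norm.
Context {R : realType}.
Variables (p q r : \bar R) (n : nat).
Hypotheses (p1 : (1%:E <= p)%E) (q1 : (1%:E <= q)%E) (r1 : (1%:E <= r)%E).
Implicit Types (T A B : 'rV[R]_(n * n * n)) (x y z : 'rV[R]_n).
Notation pn := (@proj_norm R p q r n).

Definition prep A s : Prop := exists (m : nat) (x y z : 'I_m -> 'rV[R]_n),
  A = \sum_(l < m) tens3 (x l) (y l) (z l) /\
  s = \sum_(l < m) lp_norm p (x l) * lp_norm q (y l) * lp_norm r (z l).

(** This says that [T] has dual (injective) norm at most [K]. A predicate with free [K] takes the
    place of the supremum, and the absolute value is implicit since [x] may change sign. *)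
Definition tbound T (K : R) : Prop := forall x y z,
  lp_norm p x <= 1 -> lp_norm q y <= 1 -> lp_norm r z <= 1 -> dot T (tens3 x y z) <= K.

Lemma prep_ge0 A s : prep A s -> 0 <= s.
Proof.
move=> [m [x [y [z [_ ->]]]]]; apply: sumr_ge0 => l _.
by rewrite !mulr_ge0 // lp_norm_ge0.
Qed.

Lemma lp_norm_delta (t : \bar R) i : (1%:E <= t)%E -> @lp_norm R t n (delta_mx 0 i) <= 1.
Proof.
move=> t1; apply/(lp_norm_le1 _ t1); exists (fun l => (l == i)%:R); split.
- by move=> l; rewrite ler0n.
- by rewrite (bigD1 i) //= eqxx big1 ?addr0 // => l /negPf ->.
move=> l; rewrite mxE eqxx /= ger0_norm ?ler0n //; case: eqP => _; first by rewrite powR1.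
exact: powR_ge0.
Qed.

Lemma lp_norm_coord (t : \bar R) x i : (1%:E <= t)%E -> lp_norm t x <= 1 -> `|x 0 i| <= 1.
Proof.
move=> t1 /(lp_norm_le1 _ t1)[u [u0 u1 xu]]; apply: le_trans (xu i) _.
rewrite [X in _ <= X](powR_one (rinv t)); apply: ge0_ler_powR; rewrite ?nnegrE ?rinv_ge0 //.
by apply: le_trans u1; rewrite (bigD1 i) //= lerDl sumr_ge0.
Qed.

Lemma prepD A B s t : prep A s -> prep B t -> prep (A + B) (s + t).
Proof.
move=> [m1 [x1 [y1 [z1 [-> ->]]]]] [m2 [x2 [y2 [z2 [-> ->]]]]].
pose g (V : Type) (f1 : 'I_m1 -> V) (f2 : 'I_m2 -> V) (l : 'I_(m1 + m2)) : V :=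
  match fintype.split l with inl a => f1 a | inr b => f2 b end.
exists (m1 + m2)%N, (g _ x1 x2), (g _ y1 y2), (g _ z1 z2).
have gl V f1 f2 (a : 'I_m1) : g V f1 f2 (lshift m2 a) = f1 a by rewrite /g -/(unsplit (inl a)) unsplitK.
have gr V f1 f2 (b : 'I_m2) : g V f1 f2 (rshift m1 b) = f2 b by rewrite /g -/(unsplit (inr b)) unsplitK.
by rewrite !big_split_ord /=; split; congr (_ + _); apply: eq_bigr => l _; rewrite ?gl ?gr.
Qed.

Lemma prepZ A s c : prep A s -> prep (c *: A) (`|c| * s).
Proof.
move=> [m [x [y [z [-> ->]]]]]; exists m, (fun l => c *: x l), y, z; split.
  rewrite scaler_sumr; apply: eq_bigr => l _.
  by rewrite -[in RHS](scale1r (y l)) -[in RHS](scale1r (z l)) tens3Z !mulr1.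
by rewrite mulr_sumr; apply: eq_bigr => l _; rewrite lp_normZ // -!mulrA.
Qed.

Lemma prep_tens x y z : prep (tens3 x y z) (lp_norm p x * lp_norm q y * lp_norm r z).
Proof. by exists 1%N, (fun=> x), (fun=> y), (fun=> z); rewrite !big_ord1. Qed.

Lemma prep0 : prep 0 0.
Proof. by exists 0%N, (fun=> 0), (fun=> 0), (fun=> 0); rewrite !big_ord0. Qed.

(** The expansion in unit tensors, each of norm at most 1. It makes the infimum in [proj_norm] run
    over a nonempty set and supplies the Lipschitz bound behind measurability. *)
Lemma prep_l1 A : exists2 s, prep A s & s <= \sum_m `|A 0 m|.
Proof.
have E : A = \sum_m (A 0 m) *: delta_mx 0 m by exact: row_sum_delta.
rewrite {1}E; elim/big_ind2: _ => [|B1 s1 B2 s2 [t1 P1 h1] [t2 P2 h2]|m _].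
- by exists 0 => //; exact: prep0.
- by exists (t1 + t2); [exact: prepD|exact: lerD].
have [i [j [k mE]]] := tidxP m.
have -> : delta_mx 0 m = tens3 (delta_mx 0 i) (delta_mx 0 j) (delta_mx 0 k) :> 'rV[R]_(n * n * n).
  apply/rowP => l; have [i' [j' [k' ->]]] := tidxP l.
  rewrite tens3E !mxE mE !eqxx /= /tidx -!natrM !mulnb; congr ((_ : bool)%:R).
  by rewrite !mxvec_index_eq.
eexists; first exact: (prepZ (A 0 m) (prep_tens _ _ _)).
rewrite -[X in _ <= X]mulr1; apply: ler_wpM2l => //.
rewrite -[X in _ <= X]mulr1; apply: ler_pM; rewrite ?mulr_ge0 ?lp_norm_ge0 ?lp_norm_delta //.
rewrite -[X in _ <= X]mulr1; apply: ler_pM; rewrite ?lp_norm_ge0 ?lp_norm_delta //.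
Qed.

Lemma proj_norm_le A s : prep A s -> pn A <= s.
Proof. by move=> As; apply: ge_inf => //; exists 0 => t; exact: prep_ge0. Qed.

Lemma proj_norm_ge A c : (forall s, prep A s -> c <= s) -> c <= pn A.
Proof.
move=> h; apply: lb_le_inf; last by move=> s; exact: h.
by have [s As _] := prep_l1 A; exists s.
Qed.

Lemma proj_norm_adherent A e : 0 < e -> exists2 s, prep A s & s < pn A + e.
Proof.
move=> e0; have [] := @inf_adherent _ [set s | prep A s]%classic e e0; last by move=> s; exists s.
split; first by have [s As _] := prep_l1 A; exists s.
by exists 0 => t; exact: prep_ge0.
Qed.

Lemma proj_norm_ge0 A : 0 <= pn A.
Proof. by apply: proj_norm_ge => s; exact: prep_ge0. Qed.

Lemma proj_norm_l1 A : pn A <= \sum_m `|A 0 m|.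
Proof. by have [s As h] := prep_l1 A; apply: le_trans h; exact: proj_norm_le. Qed.

Lemma proj_normD A B : pn (A + B) <= pn A + pn B.
Proof.
apply/ler_addgt0Pr => e e0; have e20 : 0 < e / 2 by lra.
have [s As hs] := proj_norm_adherent A e20; have [t Bt ht] := proj_norm_adherent B e20.
apply: le_trans (proj_norm_le (prepD As Bt)) _; lra.
Qed.

Lemma proj_normZ_le c A : pn (c *: A) <= `|c| * pn A.
Proof.
have [->|c0] := eqVneq c 0.
  by rewrite scale0r normr0 mul0r; apply: proj_norm_le; exact: prep0.
rewrite mulrC -ler_pdivrMr ?normr_gt0 //; apply: proj_norm_ge => s As.
rewrite ler_pdivrMr ?normr_gt0 // mulrC; exact: proj_norm_le (prepZ c As).
Qed.

Lemma proj_normZ c A : pn (c *: A) = `|c| * pn A.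
Proof.
apply/eqP; rewrite eq_le proj_normZ_le /=.
have [->|c0] := eqVneq c 0; first by rewrite normr0 mul0r proj_norm_ge0.
rewrite mulrC -ler_pdivlMr ?normr_gt0 // mulrC -normfV.
by apply: le_trans (proj_normZ_le _ _); rewrite scalerA mulVf // scale1r.
Qed.

Lemma proj_normN A : pn (- A) = pn A.
Proof. by rewrite -scaleN1r proj_normZ normrN1 mul1r. Qed.

Lemma proj_normB A B : pn A - pn B <= pn (A - B).
Proof. by have := proj_normD (A - B) B; rewrite subrK; lra. Qed.

Lemma tbound_ge0 T K : tbound T K -> 0 <= K.
Proof.
move=> /(_ 0 0 0).
have l0 (t : \bar R) : (1%:E <= t)%E -> @lp_norm R t n 0 <= 1.
  by move=> t1; rewrite -(scale0r 0) lp_normZ // normr0 mul0r.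
rewrite !l0 // => /(_ isT isT isT); apply: le_trans; rewrite dot_tens3.
by rewrite big1 // => i _; rewrite big1 // => j _; rewrite big1 // => k _; rewrite !mxE !mulr0.
Qed.

(** The easy half of duality: homogeneity gives the bound on each term of a decomposition, and the
    infimum is taken afterwards. A factor of norm 0, which cannot be normalised, is the zero
    vector. *)
Lemma dot_proj_norm T K A : tbound T K -> dot T A <= K * pn A.
Proof.
move=> hT; have K0 := tbound_ge0 hT.
have key x y z : dot T (tens3 x y z) <= K * (lp_norm p x * lp_norm q y * lp_norm r z).
  have z0 : dot T 0 = 0 by rewrite -(scale0r 0) dotZr mul0r.
  have [hx|hx] := eqVneq (lp_norm p x) 0.
    by rewrite hx !mul0r mulr0 (lp_norm_eq0 p1 hx) -(scale0r 0) -[y]scale1r -[z]scale1r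
      tens3Z !mul0r scale0r z0.
  have [hy|hy] := eqVneq (lp_norm q y) 0.
    by rewrite hy mulr0 mul0r mulr0 (lp_norm_eq0 q1 hy) -(scale0r 0) -[x]scale1r -[z]scale1r
      tens3Z mulr0 mul0r scale0r z0.
  have [hz|hz] := eqVneq (lp_norm r z) 0.
    by rewrite hz !mulr0 (lp_norm_eq0 r1 hz) -(scale0r 0) -[x]scale1r -[y]scale1r
      tens3Z mulr0 scale0r z0.
  have E (t : \bar R) (v : 'rV[R]_n) : lp_norm t v != 0 -> v = lp_norm t v *: ((lp_norm t v)^-1 *: v).
    by move=> h; rewrite scalerA divff // scale1r.
  rewrite [in X in X <= _](E _ _ hx) [in X in X <= _](E _ _ hy) [in X in X <= _](E _ _ hz).
  rewrite tens3Z dotZr mulrC ler_wpM2r ?mulr_ge0 ?lp_norm_ge0 //.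
  by apply: hT; rewrite lp_normZ // ger0_norm ?invr_ge0 ?lp_norm_ge0 // mulVf.
have [K00|Kn] := eqVneq K 0.
  rewrite K00 mul0r; have [s [m [x [y [z [-> _]]]]] _] := prep_l1 A.
  rewrite dot_sumr; apply: sumr_le0 => l _.
  by apply: le_trans (key _ _ _) _; rewrite K00 mul0r.
rewrite mulrC -ler_pdivrMr ?lt_def ?Kn //; apply: proj_norm_ge => s [m [x [y [z [-> ->]]]]].
rewrite ler_pdivrMr ?lt_def ?Kn // mulrC dot_sumr mulr_sumr.
by apply: ler_sum => l _; exact: key.
Qed.

(** The coordinate forms, with either sign, are at most 1 on the three unit balls. *)
Lemma coord_proj_norm A m : `|A 0 m| <= pn A.
Proof.
have h (s : R) : `|s| <= 1 -> s * A 0 m <= pn A.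
  move=> s1; have E B : dot (s *: delta_mx 0 m) B = s * B 0 m.
    rewrite dotC dotZr /dot (bigD1 m) //= big1 ?addr0; first by rewrite mxE !eqxx mulr1.
    by move=> l lm; rewrite mxE eqxx (negPf lm) mulr0.
  rewrite -E -[X in _ <= X]mul1r; apply: dot_proj_norm => x y z hx hy hz.
  rewrite E; have [i [j [k ->]]] := tidxP m; rewrite tens3E.
  apply: le_trans (ler_norm _) _; rewrite !normrM -[X in _ <= X]mulr1.
  have := lp_norm_coord i p1 hx; have := lp_norm_coord j q1 hy; have := lp_norm_coord k r1 hz.
  move=> hk hj hi; apply: ler_pM => //; rewrite -[X in _ <= X]mulr1; apply: ler_pM => //.
  by rewrite -[X in _ <= X]mulr1; apply: ler_pM.
rewrite ler_norml; have := h 1; have := h (-1); rewrite normrN1 normr1 mul1r mulN1r lexx.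
by move=> /(_ isT) h1 /(_ isT) h2; apply/andP; split; lra.
Qed.

(** Finite-dimensional Hahn-Banach. The separating form is [A - w] for an almost nearest point [w]
    of the unit ball; near-minimality is enough because the squared distance has the explicit lower
    bound [d0]. *)
Lemma proj_norm_separation A :
  (forall T K, tbound T K -> dot T A <= K) -> pn A <= 1.
Proof.
move=> hA; rewrite leNgt; apply/negP => A1.
pose N := (n * n * n)%N.
have N0 : 0 < N%:R :> R.
  rewrite ltr0n lt0n; apply/negP => /eqP N0; have := proj_norm_l1 A; rewrite big1; first by lra.
  by move=> m _; have := ltn_ord m; rewrite -/N {2}N0.
(* The norm gap is at most the l_1 distance to the ball, hence at most sqrt N times the Euclidean
   distance. *)
pose d0 := (pn A - 1) ^+ 2 / N%:R.
have d00 : 0 < d0 by rewrite divr_gt0 // exprn_gt0 // subr_gt0.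
have far w : pn w <= 1 -> d0 <= dot (A - w) (A - w).
  move=> w1; rewrite ler_pdivrMr // mulrC; apply: le_trans (sum_norm_sqr_le _).
  have h1 := proj_normB A w; have h2 := proj_norm_l1 (A - w).
  by rewrite ler_sqr ?nnegrE; [lra|lra|apply: sumr_ge0].
pose S := [set dot (A - w) (A - w) | w in [set w | pn w <= 1]]%classic.
have S0 : has_inf S.
  split; last by exists 0 => _ [w _ <-]; exact: dot_ge0.
  by exists (dot (A - 0) (A - 0)); exists 0 => //=; rewrite (le_trans (proj_norm_le prep0)).
(* [D] bounds |v - w|^2, whose coordinates lie in [-2, 2]; the summand [d0] forces t <= 1. As t D =
   d0/2, the quadratic term of a step from [w] towards [v] costs at most t d0/2, the same as the
   defect allowed for [w]. *)
pose D := 4 * N%:R + d0; have D0 : 0 < D by rewrite /D; lra.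
pose t := d0 / (2 * D).
have t0 : 0 < t by rewrite divr_gt0 // mulr_gt0.
have t1 : t <= 1 by rewrite ler_pdivrMr ?mulr_gt0 // /D; lra.
have e0 : 0 < t * d0 / 2 by rewrite divr_gt0 // mulr_gt0.
have [_ [w /= w1 <-] hw] := inf_adherent e0 S0.
have := hA (A - w) (dot (A - w) w + d0 / 2) _.
apply/not_implyP; split; last first.
  have -> : dot (A - w) A = dot (A - w) w + dot (A - w) (A - w) by rewrite -dotDr [w + _]addrC subrK.
  by apply/negP; rewrite -ltNge; have := far w w1; lra.
move=> x y z hx hy hz; set v := tens3 x y z.
have v1 : pn v <= 1.
  apply: (le_trans (proj_norm_le (prep_tens x y z))).
  rewrite -[X in _ <= X]mulr1; apply: ler_pM; rewrite ?mulr_ge0 ?lp_norm_ge0 //.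
  by rewrite -[X in _ <= X]mulr1; apply: ler_pM; rewrite ?lp_norm_ge0.
have vw : pn (w + t *: (v - w)) <= 1.
  rewrite (_ : w + _ = (1 - t) *: w + t *: v); last first.
    by apply/rowP => m; rewrite !mxE; ring.
  apply: le_trans (proj_normD _ _) _; rewrite !proj_normZ !ger0_norm; [|lra..].
  have := ler_wpM2l (ltW t0) v1; have := @ler_wpM2l _ (1 - t) _ _ _ w1; rewrite subr_ge0 => /(_ t1).
  by lra.
have h1 : inf S <= dot (A - (w + t *: (v - w))) (A - (w + t *: (v - w))).
  by apply: ge_inf; [case: S0|exists (w + t *: (v - w))].
have E : dot (A - (w + t *: (v - w))) (A - (w + t *: (v - w))) =
    dot (A - w) (A - w) - 2 * t * dot (A - w) (v - w) + t ^+ 2 * dot (v - w) (v - w).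
  have -> : A - (w + t *: (v - w)) = (A - w) - t *: (v - w) by rewrite opprD addrA.
  move: (A - w) (v - w) => a b.
  by rewrite dotBr !dotBl !dotZr (dotC (t *: b) a) (dotC (t *: b) b) !dotZr; ring.
have h2 : dot (v - w) (v - w) <= D.
  apply: le_trans (_ : 4 * N%:R <= _); last by rewrite /D; lra.
  rewrite mulrC mulr_natl -[X in _ *+ X](card_ord N) -sumr_const; apply: ler_sum => m _.
  have := coord_proj_norm v m; have := coord_proj_norm w m; rewrite !mxE !ler_norml.
  by move=> /andP[? ?] /andP[? ?]; nra.
have h3 : t ^+ 2 * dot (v - w) (v - w) <= t * (d0 / 2).
  apply: le_trans (_ : t ^+ 2 * D <= _); first by rewrite ler_wpM2l // sqr_ge0.
  rewrite expr2 -mulrA ler_wpM2l ?(ltW t0) // (_ : t * D = d0 / 2) // /t.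
  by field; rewrite gt_eqF.
have -> : dot (A - w) v = dot (A - w) w + dot (A - w) (v - w) by rewrite -dotDr [w + _]addrC subrK.
rewrite lerD2l -(ler_pM2l t0).
rewrite E in h1; lra.
Qed.

End proj_norm.

(** * Khintchine inequalities and lower bounds for the injective norm *)

Section rademacher.
Context {R : realType}.
Implicit Types (F G : (nat -> R) -> R) (e : nat -> R).

Definition upd e (m : nat) (s : R) : nat -> R := fun i => if i == m then s else e i.

(** Expectation of [F] over independent uniform signs in the positions below [n], the other
    positions being 1. Sign sequences are functions on [nat], so that induction on [n] stays within
    one type. *)
Fixpoint rademacher n F : R :=
  if n is m.+1 then (rademacher m (fun e => F (upd e m 1)) + rademacher m (fun e => F (upd e m (-1)))) / 2
  else F (fun=> 1).

Definition signs e := forall i, `|e i| = 1.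

Lemma signs_upd e m s : signs e -> `|s| = 1 -> signs (upd e m s).
Proof. by move=> he hs i; rewrite /upd; case: ifP. Qed.

Lemma rad_le n F G : (forall e, signs e -> F e <= G e) -> rademacher n F <= rademacher n G.
Proof.
elim: n F G => [|n IH] F G h /=; first by apply: h => i; rewrite normr1.
rewrite ler_pM2r ?invr_gt0 //; apply: lerD; apply: IH => e he; apply: h;
  by apply: signs_upd; rewrite ?normrN1 ?normr1.
Qed.

Lemma radD n F G : rademacher n (fun e => F e + G e) = rademacher n F + rademacher n G.
Proof. by elim: n F G => [|n IH] F G //=; rewrite !IH; lra. Qed.

Lemma radZ n c F : rademacher n (fun e => c * F e) = c * rademacher n F.
Proof. by elim: n F => [|n IH] F //=; rewrite !IH; lra. Qed.

Lemma rad_cst n c : rademacher n (fun=> c) = c.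
Proof. by elim: n => [|n IH] //=; rewrite !IH; lra. Qed.

Lemma rad_sum n (I : Type) (s : seq I) (F : I -> (nat -> R) -> R) :
  rademacher n (fun e => \sum_(i <- s) F i e) = \sum_(i <- s) rademacher n (F i).
Proof.
elim: s => [|i s IH].
  by rewrite big_nil -[RHS](rad_cst n); congr rademacher; apply/funext => e; rewrite big_nil.
by rewrite big_cons -IH -radD; congr rademacher; apply/funext => e; rewrite big_cons.
Qed.

(** Some value is at least the average: this turns moment computations into concrete choices of
    signs. *)
Lemma rad_ge n F : exists2 e, signs e & rademacher n F <= F e.
Proof.
elim: n F => [|n IH] F /=; first by exists (fun=> 1) => // i; rewrite normr1.
have [e1 s1 h1] := IH (fun e => F (upd e n 1)).
have [e2 s2 h2] := IH (fun e => F (upd e n (-1))).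
have [h|h] := leP (rademacher n (fun e => F (upd e n 1))) (rademacher n (fun e => F (upd e n (-1)))).
  by exists (upd e2 n (-1)); [apply: signs_upd; rewrite ?normrN1|lra].
by exists (upd e1 n 1); [apply: signs_upd; rewrite ?normr1|lra].
Qed.

Definition slin n (a : 'I_n -> R) e : R := \sum_i a i * e i.

Lemma slin_upd n (a : 'I_n.+1 -> R) e s :
  slin a (upd e n s) = slin (fun i => a (widen_ord (leqnSn n) i)) e + a ord_max * s.
Proof.
rewrite /slin big_ord_recr /= {2}/upd eqxx; congr (_ + _).
by apply: eq_bigr => i _; rewrite /upd /= ltn_eqF.
Qed.

Lemma rad_slin2 n (a b : 'I_n -> R) : rademacher n (fun e => slin a e * slin b e) = \sum_i a i * b i.
Proof.
elim: n a b => [|n IH] a b; first by rewrite /= /slin !big_ord0 mulr0.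
rewrite big_ord_recr -IH [X in _ = X]/=; set c := a ord_max * b ord_max.
rewrite -(rad_cst n c) /c -radD /= -radD mulrC -radZ.
by congr rademacher; apply/funext => e; rewrite !slin_upd; field.
Qed.

Lemma sum_mul_sqr_le (I : finType) (a b : I -> R) :
  (\sum_i a i * b i) ^+ 2 <= (\sum_i a i ^+ 2) * (\sum_i b i ^+ 2).
Proof.
set A := \sum_i a i ^+ 2; set B := \sum_i b i ^+ 2; set C := \sum_i _.
have A0 : 0 <= A by apply: sumr_ge0 => i _; exact: sqr_ge0.
have B0 : 0 <= B by apply: sumr_ge0 => i _; exact: sqr_ge0.
have [Bz|Bn] := eqVneq B 0.
  have bz i : b i = 0.
    have /eqP := Bz; rewrite psumr_eq0 => [/allP /(_ i)|j _]; last exact: sqr_ge0.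
    by rewrite mem_index_enum /= sqrf_eq0 => /(_ isT)/eqP.
  by rewrite Bz mulr0 /C big1 ?expr0n // => i _; rewrite bz mulr0.
have : 0 <= \sum_i (B * a i - C * b i) ^+ 2 by apply: sumr_ge0 => i _; exact: sqr_ge0.
rewrite (eq_bigr (fun i => B ^+ 2 * a i ^+ 2 - 2 * B * C * (a i * b i) + C ^+ 2 * b i ^+ 2)); last first.
  by move=> i _; ring.
rewrite big_split sumrB /= -!mulr_sumr -/A -/B -/C => h.
have : 0 <= B * (A * B - C ^+ 2) by apply: le_trans h _; rewrite le_eqVlt; apply/orP; left; apply/eqP; ring.
by rewrite pmulr_rge0 ?subr_ge0 // lt_def Bn.
Qed.

(** The form with two vectors is dictated by the chaos of order two, where fixing one family of
    signs leaves mixed products of squares. *)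
Lemma rad_slin4 n (a b : 'I_n -> R) :
  rademacher n (fun e => slin a e ^+ 2 * slin b e ^+ 2) <= 3 * (\sum_i a i ^+ 2) * (\sum_i b i ^+ 2).
Proof.
elim: n a b => [|n IH] a b; first by rewrite /= /slin !big_ord0 !mulr0 expr0n mulr0.
pose a' i := a (widen_ord (leqnSn n) i); pose b' i := b (widen_ord (leqnSn n) i).
rewrite !big_ord_recr /=; set A := \sum_(i < n) _; set B := \sum_(i < n) _.
have hA : A = \sum_i a' i ^+ 2 by [].
have hB : B = \sum_i b' i ^+ 2 by [].
set s := a ord_max; set t := b ord_max.
(* Averaging over the last sign leaves only the terms of even degree in it. *)
have -> : (rademacher n (fun e => slin a (upd e n 1) ^+ 2 * slin b (upd e n 1) ^+ 2) +
    rademacher n (fun e => slin a (upd e n (-1)) ^+ 2 * slin b (upd e n (-1)) ^+ 2)) / 2 =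
    rademacher n (fun e => slin a' e ^+ 2 * slin b' e ^+ 2) + t ^+ 2 * A + s ^+ 2 * B
    + 4 * s * t * \sum_i a' i * b' i + s ^+ 2 * t ^+ 2.
  have sq (c : 'I_n -> R) : \sum_i c i ^+ 2 = rademacher n (fun e => slin c e * slin c e).
    by rewrite rad_slin2; apply: eq_bigr.
  rewrite hA hB !sq -rad_slin2 -!radZ -radD mulrC -radZ.
  rewrite -[s ^+ 2 * t ^+ 2 in RHS](rad_cst n) -!radD.
  congr rademacher; apply/funext => e; rewrite !slin_upd -/s -/t -/a' -/b'.
  by set x := slin a' e; set y := slin b' e; field.
have h1 := IH a' b'; rewrite -hA -hB in h1.
have h2 := sum_mul_sqr_le a' b'; rewrite -hA -hB in h2.
set C := \sum_i _ in h2 *.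
have A0 : 0 <= A by apply: sumr_ge0 => i _; exact: sqr_ge0.
have B0 : 0 <= B by apply: sumr_ge0 => i _; exact: sqr_ge0.
(* AM-GM for the cross term: 2 s t C <= t^2 A + s^2 B, because C^2 <= A B. *)
have h3 : 2 * s * t * C <= t ^+ 2 * A + s ^+ 2 * B.
  have D0 : 0 <= t ^+ 2 * A + s ^+ 2 * B by apply: addr_ge0; apply: mulr_ge0 => //; exact: sqr_ge0.
  apply: le_trans (ler_norm _) _; rewrite -(ger0_norm D0) -ler_sqr ?nnegrE //.
  rewrite !real_normK ?num_real //.
  apply: (@le_trans _ _ (4 * (t ^+ 2 * s ^+ 2) * (A * B))).
    have -> : (2 * s * t * C) ^+ 2 = 4 * (t ^+ 2 * s ^+ 2) * C ^+ 2 by ring.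
    by apply: ler_wpM2l => //; apply: mulr_ge0 => //; apply: mulr_ge0; exact: sqr_ge0.
  have := sqr_ge0 (t ^+ 2 * A - s ^+ 2 * B); nra.
have h4 : 0 <= s ^+ 2 * t ^+ 2 by apply: mulr_ge0 => //; exact: sqr_ge0.
have h5 : 0 <= t ^+ 2 * A by apply: mulr_ge0 => //; exact: sqr_ge0.
have h6 : 0 <= s ^+ 2 * B by apply: mulr_ge0 => //; exact: sqr_ge0.
lra.
Qed.

End rademacher.

Section khintchine.
Context {R : realType}.
Variables n m : nat.
Implicit Types t : 'I_n -> 'I_m -> R.

Definition chaos t (e d : nat -> R) : R := \sum_i \sum_j t i j * e i * d j.

Lemma chaosE t e d : chaos t e d = slin (fun i => slin (t i) d) e.
Proof.
apply: eq_bigr => i _; rewrite mulr_suml; apply: eq_bigr => j _; ring.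
Qed.

Lemma rad_chaos2 t : rademacher m (fun d => rademacher n (fun e => chaos t e d ^+ 2)) = \sum_i \sum_j t i j ^+ 2.
Proof.
have -> : (fun d => rademacher n (fun e => chaos t e d ^+ 2)) = fun d => \sum_i slin (t i) d * slin (t i) d.
  apply/funext => d; rewrite -rad_slin2; congr rademacher; apply/funext => e.
  by rewrite chaosE expr2.
rewrite rad_sum; apply: eq_bigr => i _; rewrite rad_slin2.
by apply: eq_bigr => j _; rewrite expr2.
Qed.

(** The fourth moment bound is used in [e] with [d] fixed, then in [d] for each mixed product, so
    the constant is 3 times 3. *)
Lemma rad_chaos4 t : rademacher m (fun d => rademacher n (fun e => chaos t e d ^+ 4)) <=
  9 * (\sum_i \sum_j t i j ^+ 2) ^+ 2.
Proof.
pose S i := \sum_j t i j ^+ 2.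
apply: (@le_trans _ _ (rademacher m (fun d => 3 * \sum_i \sum_l slin (t i) d ^+ 2 * slin (t l) d ^+ 2))).
  apply: rad_le => d _.
  have := rad_slin4 (fun i => slin (t i) d) (fun i => slin (t i) d).
  have -> : (fun e => slin (fun i => slin (t i) d) e ^+ 2 * slin (fun i => slin (t i) d) e ^+ 2) =
     fun e => chaos t e d ^+ 4.
    by apply/funext => e; rewrite chaosE -exprD.
  rewrite -mulrA mulr_suml; congr (_ <= _ * _).
  by apply: eq_bigr => i _; rewrite mulr_sumr.
rewrite radZ rad_sum -/(S _) expr2 mulr_suml.
have -> : 9 = 3 * 3 :> R by ring.
rewrite -mulrA ler_wpM2l // mulr_sumr; apply: ler_sum => i _.
rewrite rad_sum !mulr_sumr; apply: ler_sum => l _.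
by apply: le_trans (rad_slin4 _ _) _; rewrite mulrA.
Qed.

(* The pointwise bound [|x| >= (27 s^2 x^2 - x^4) / (54 s^3)] is
   [|x| (|x| - 3 s)^2 (|x| + 6 s) >= 0]; averaging it turns the second and fourth
   moments into a lower bound on the first one. *)
Lemma khintchine_lower t : exists2 g : (nat -> R) -> (nat -> R) -> R,
  forall e d, g e d <= `|chaos t e d| &
  Num.sqrt (\sum_i \sum_j t i j ^+ 2) / 3 <= rademacher m (fun d => rademacher n (fun e => g e d)).
Proof.
set Q := \sum_i _; have Q0 : 0 <= Q by apply: sumr_ge0 => i _; apply: sumr_ge0 => j _; exact: sqr_ge0.
have [Qz|Qn] := eqVneq Q 0.
  exists (fun _ _ => 0) => [e d|]; first exact: normr_ge0.
  by rewrite !rad_cst Qz sqrtr0 mul0r.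
pose s := Num.sqrt Q; have s0 : 0 < s by rewrite sqrtr_gt0 lt_def Qn.
have s2 : s ^+ 2 = Q by rewrite sqr_sqrtr.
have s30 : 0 < 54 * s ^+ 3 by rewrite mulr_gt0 // exprn_gt0.
exists (fun e d => (27 * s ^+ 2 / (54 * s ^+ 3)) * chaos t e d ^+ 2 +
                   (- (54 * s ^+ 3)^-1) * chaos t e d ^+ 4) => [e d|].
  set x := chaos t e d; have x2 : x ^+ 2 = `|x| ^+ 2 by rewrite real_normK ?num_real.
  have -> : x ^+ 4 = `|x| ^+ 4 by rewrite (exprM x 2 2) x2 -exprM.
  rewrite x2; set y := `|x|; have y0 : 0 <= y by exact: normr_ge0.
  rewrite -subr_ge0.
  have -> : y - (27 * s ^+ 2 / (54 * s ^+ 3) * y ^+ 2 + - (54 * s ^+ 3)^-1 * y ^+ 4) =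
     (y * (y - 3 * s) ^+ 2 * (y + 6 * s)) / (54 * s ^+ 3).
    by field; rewrite gt_eqF.
  apply: divr_ge0; last exact: ltW.
  apply: mulr_ge0; first by apply: mulr_ge0 => //; exact: sqr_ge0.
  by apply: addr_ge0 => //; apply: mulr_ge0 => //; exact: ltW.
have -> : (fun d => rademacher n (fun e => 27 * s ^+ 2 / (54 * s ^+ 3) * chaos t e d ^+ 2 +
      - (54 * s ^+ 3)^-1 * chaos t e d ^+ 4)) =
   (fun d => 27 * s ^+ 2 / (54 * s ^+ 3) * rademacher n (fun e => chaos t e d ^+ 2) +
      - (54 * s ^+ 3)^-1 * rademacher n (fun e => chaos t e d ^+ 4)).
  by apply/funext => d; rewrite radD !radZ.
rewrite radD !radZ rad_chaos2 -/Q -s2.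
have h4 := rad_chaos4 t; rewrite -/Q -s2 in h4.
set M := rademacher m _ in h4 *.
apply: (@le_trans _ _ (27 * s ^+ 2 / (54 * s ^+ 3) * s ^+ 2 + - (54 * s ^+ 3)^-1 * (9 * (s ^+ 2) ^+ 2))).
  rewrite le_eqVlt; apply/orP; left; apply/eqP; rewrite sqrtr_sqr gtr0_norm //.
  by field; rewrite gt_eqF.
rewrite lerD2l !mulNr lerN2 ler_wpM2l // invr_ge0 ltW //.
Qed.

End khintchine.

Section injective_lower.
Context {R : realType} {n : nat}.
Implicit Types (f : 'I_n -> 'I_n -> 'I_n -> R) (a b c x y z : 'I_n -> R).

(** One pair of sign sequences serves all [k] simultaneously because the minorants are summed before
    the signs are selected. *)
Lemma khintchine_sum f c : (forall k, 0 <= c k) -> exists e d : nat -> R,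
  [/\ signs e, signs d &
   (\sum_k c k * Num.sqrt (\sum_i \sum_j f i j k ^+ 2)) / 3 <=
   \sum_k c k * `|chaos (fun i j => f i j k) e d|].
Proof.
move=> c0.
have kh k : exists g : (nat -> R) -> (nat -> R) -> R,
    (forall e d, g e d <= `|chaos (fun i j => f i j k) e d|) /\
    Num.sqrt (\sum_i \sum_j f i j k ^+ 2) / 3 <= rademacher n (fun d => rademacher n (fun e => g e d)).
  by have [g h1 h2] := khintchine_lower (fun i j => f i j k); exists g.
have [g hg] := choice kh.
pose F d e := \sum_k c k * g k e d.
have [d sd hd] := rad_ge n (fun d => rademacher n (F d)).
have [e se he] := rad_ge n (F d).
exists e, d; split => //.
apply: (@le_trans _ _ (F d e)); last first.
  by apply: ler_sum => k _; rewrite ler_wpM2l //; have [h _] := hg k; exact: h.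
apply: le_trans he; apply: le_trans hd.
have -> : (fun d => rademacher n (F d)) = fun d => \sum_k c k * rademacher n (fun e => g k e d).
  apply/funext => d'; rewrite rad_sum; apply: eq_bigr => k _; exact: radZ.
rewrite rad_sum mulr_suml; apply: ler_sum => k _.
by rewrite radZ -mulrA ler_wpM2l //; have [_ h] := hg k.
Qed.

Definition tri f x y z : R := \sum_i \sum_j \sum_k f i j k * (x i * y j * z k).

Definition box_bound f a b c (K : R) : Prop := forall x y z,
  (forall i, `|x i| <= a i) -> (forall j, `|y j| <= b j) -> (forall k, `|z k| <= c k) ->
  tri f x y z <= K.

(** The first two vectors carry the signs found above; the third takes the sign of the resulting
    chaos, which produces the absolute values. *)
Lemma khintchine_box f a b c K : (forall i, 0 <= a i) -> (forall j, 0 <= b j) ->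
  (forall k, 0 <= c k) -> box_bound f a b c K ->
  (\sum_k c k * Num.sqrt (\sum_i \sum_j (f i j k * (a i * b j)) ^+ 2)) / 3 <= K.
Proof.
move=> a0 b0 c0 hf.
have [e [d [se sd]]] := khintchine_sum (fun i j k => f i j k * (a i * b j)) c0.
move=> h; apply: (le_trans h).
pose X k := chaos (fun i j => f i j k * (a i * b j)) e d.
apply: le_trans (hf (fun i => a i * e i) (fun j => b j * d j) (fun k => c k * Num.sg (X k)) _ _ _); last first.
- move=> k; rewrite normrM (ger0_norm (c0 k)) -[X in _ <= X]mulr1 ler_wpM2l //.
  by rewrite normr_sg; case: (_ != 0).
- by move=> j; rewrite normrM sd mulr1 ger0_norm.
- by move=> i; rewrite normrM se mulr1 ger0_norm.
rewrite le_eqVlt; apply/orP; left; apply/eqP.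
transitivity (\sum_k \sum_i \sum_j f i j k * (a i * e i * (b j * d j) * (c k * Num.sg (X k)))).
  apply: eq_bigr => k _; rewrite -/(X k) normrEsg {2}/X /chaos !mulr_sumr.
  apply: eq_bigr => i _; rewrite !mulr_sumr; apply: eq_bigr => j _; ring.
rewrite exchange_big; apply: eq_bigr => i _; exact: exchange_big.
Qed.

(** Cauchy-Schwarz in each slice [k] replaces the root of a weighted sum of squares by an expression
    linear in f^2. In this form the three choices of the distinguished variable can be averaged. *)
Lemma box_mass f a b c K : (forall i, 0 <= a i) -> (forall j, 0 <= b j) ->
  (forall k, 0 <= c k) -> box_bound f a b c K ->
  (\sum_i \sum_j \sum_k f i j k ^+ 2 * (a i * b j * c k) /
      Num.sqrt (\sum_i' \sum_j' f i' j' k ^+ 2)) / 3 <= K.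
Proof.
move=> a0 b0 c0 /(khintchine_box a0 b0 c0); apply: le_trans.
rewrite ler_wpM2r ?invr_ge0 //.
rewrite (eq_bigr (fun i => \sum_k \sum_j f i j k ^+ 2 * (a i * b j * c k) /
      Num.sqrt (\sum_i' \sum_j' f i' j' k ^+ 2))); last by move=> i _; exact: exchange_big.
rewrite exchange_big; apply: ler_sum => k _.
set w := \sum_i' _; set Q := \sum_i \sum_j (_ * _) ^+ 2.
have w0 : 0 <= w by apply: sumr_ge0 => i _; apply: sumr_ge0 => j _; exact: sqr_ge0.
have Q0 : 0 <= Q by apply: sumr_ge0 => i _; apply: sumr_ge0 => j _; exact: sqr_ge0.
pose S := \sum_i \sum_j f i j k * (f i j k * (a i * b j)).
have -> : \sum_i \sum_j f i j k ^+ 2 * (a i * b j * c k) / Num.sqrt w = c k * (S / Num.sqrt w).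
  rewrite mulrA /S mulr_sumr mulr_suml; apply: eq_bigr => i _.
  by rewrite mulr_sumr mulr_suml; apply: eq_bigr => j _; ring.
rewrite ler_wpM2l //.
have [wz|wn] := eqVneq w 0; first by rewrite wz sqrtr0 invr0 mulr0 sqrtr_ge0.
rewrite ler_pdivrMr ?sqrtr_gt0 ?lt_def ?wn // -sqrtrM //.
have CS : S ^+ 2 <= Q * w.
  rewrite mulrC /S /Q /w !pair_bigA /=.
  exact: (@sum_mul_sqr_le _ _ (fun u => f u.1 u.2 k) (fun u => f u.1 u.2 k * (a u.1 * b u.2))).
by apply: le_trans (ler_norm S) _; rewrite -sqrtr_sqr; exact: ler_wsqrtr.
Qed.

Lemma sum_rot (F : 'I_n -> 'I_n -> 'I_n -> R) :
  \sum_i \sum_j \sum_k F i j k = \sum_j \sum_k \sum_i F i j k.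
Proof. by rewrite exchange_big; apply: eq_bigr => j _; exact: exchange_big. Qed.

Lemma box_bound_rot f a b c K : box_bound f a b c K ->
  box_bound (fun j k i => f i j k) b c a K.
Proof.
move=> h x y z hx hy hz; have := h z x y hz hx hy; rewrite /tri sum_rot.
congr (_ <= _); apply: eq_bigr => j _; apply: eq_bigr => k _; apply: eq_bigr => i _; ring.
Qed.

(* The weights [u, v, w] are the marginals of [f^2] viewed as a probability distribution.
   Averaging [box_mass] over the three roles with weights [2 al], [2 be], [2 ga], the
   factors [u^al v^be w^ga] are cancelled by the weighted AM-GM inequality. *)
Lemma box_l2 f (al be ga K : R) : 0 <= al -> 0 <= be -> 0 <= ga -> al + be + ga = 2^-1 ->
  \sum_i \sum_j \sum_k f i j k ^+ 2 = 1 ->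
  box_bound f (fun i => (\sum_j \sum_k f i j k ^+ 2) `^ al)
              (fun j => (\sum_k \sum_i f i j k ^+ 2) `^ be)
              (fun k => (\sum_i \sum_j f i j k ^+ 2) `^ ga) K ->
  1 / 3 <= K.
Proof.
move=> al0 be0 ga0 s12 f1 hf.
set u := fun i => \sum_j \sum_k f i j k ^+ 2 in hf.
set v := fun j => \sum_k \sum_i f i j k ^+ 2 in hf.
set w := fun k => \sum_i \sum_j f i j k ^+ 2 in hf.
have u0 i : 0 <= u i by apply: sumr_ge0 => j _; apply: sumr_ge0 => k _; exact: sqr_ge0.
have v0 j : 0 <= v j by apply: sumr_ge0 => k _; apply: sumr_ge0 => i _; exact: sqr_ge0.
have w0 k : 0 <= w k by apply: sumr_ge0 => i _; apply: sumr_ge0 => j _; exact: sqr_ge0.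
pose G i j k := u i `^ al * v j `^ be * w k `^ ga.
have G0 i j k : 0 <= G i j k by rewrite /G !mulr_ge0 // powR_ge0.
have hw : (\sum_i \sum_j \sum_k f i j k ^+ 2 * G i j k / Num.sqrt (w k)) / 3 <= K.
  by apply: box_mass hf => ?; exact: powR_ge0.
have hu : (\sum_i \sum_j \sum_k f i j k ^+ 2 * G i j k / Num.sqrt (u i)) / 3 <= K.
  have := box_mass _ _ _ (box_bound_rot hf).
  move=> /(_ (fun=> powR_ge0 _ _) (fun=> powR_ge0 _ _) (fun=> powR_ge0 _ _)).
  rewrite [X in _ -> X / 3 <= _]sum_rot; congr (_ / 3 <= _).
  by apply: eq_bigr => j _; apply: eq_bigr => k _; apply: eq_bigr => i _; rewrite /G; congr (_ * _ / _); ring.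
have hv : (\sum_i \sum_j \sum_k f i j k ^+ 2 * G i j k / Num.sqrt (v j)) / 3 <= K.
  have := box_mass _ _ _ (box_bound_rot (box_bound_rot hf)).
  move=> /(_ (fun=> powR_ge0 _ _) (fun=> powR_ge0 _ _) (fun=> powR_ge0 _ _)).
  rewrite -[X in _ -> X / 3 <= _]sum_rot; congr (_ / 3 <= _).
  by apply: eq_bigr => j _; apply: eq_bigr => k _; apply: eq_bigr => i _; rewrite /G; congr (_ * _ / _); ring.
have comb : (\sum_i \sum_j \sum_k f i j k ^+ 2 * (G i j k * (2 * al / Num.sqrt (u i)
     + 2 * be / Num.sqrt (v j) + 2 * ga / Num.sqrt (w k)))) / 3 <= K.
  move: hu hv hw; set U := \sum_i _; set V := \sum_i _; set W := \sum_i _ => hu hv hw.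
  have -> : \sum_i \sum_j \sum_k f i j k ^+ 2 * (G i j k * (2 * al / Num.sqrt (u i)
     + 2 * be / Num.sqrt (v j) + 2 * ga / Num.sqrt (w k))) =
     2 * al * U + 2 * be * V + 2 * ga * W.
    rewrite /U /V /W !mulr_sumr -!big_split; apply: eq_bigr => i _ /=.
    rewrite !mulr_sumr -!big_split; apply: eq_bigr => j _ /=.
    rewrite !mulr_sumr -!big_split; apply: eq_bigr => k _ /=; ring.
  have := ler_wpM2l al0 hu; have := ler_wpM2l be0 hv; have := ler_wpM2l ga0 hw.
  have : K = 2 * al * K + 2 * be * K + 2 * ga * K by rewrite -!mulrDl -!mulrDr s12 divff ?mul1r.
  lra.
apply: le_trans comb; rewrite ler_wpM2r ?invr_ge0 // -[X in X <= _]f1.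
apply: ler_sum => i _; apply: ler_sum => j _; apply: ler_sum => k _.
(* Where [f] vanishes the term is 0; elsewhere all three marginals are positive and their inverse
   powers are genuine. *)
have [fz|fn] := eqVneq (f i j k) 0; first by rewrite fz expr0n /= mul0r.
have f20 : 0 < f i j k ^+ 2 by rewrite lt_def sqr_ge0 sqrf_eq0 fn.
have up : 0 < u i.
  apply: lt_le_trans f20 _; rewrite /u (bigD1 j) //= (bigD1 k) //= -addrA lerDl addr_ge0 //;
  by do ?[apply: sumr_ge0 => ? _|exact: sqr_ge0].
have vp : 0 < v j.
  apply: lt_le_trans f20 _; rewrite /v (bigD1 k) //= (bigD1 i) //= -addrA lerDl addr_ge0 //;
  by do ?[apply: sumr_ge0 => ? _|exact: sqr_ge0].
have wp : 0 < w k.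
  apply: lt_le_trans f20 _; rewrite /w (bigD1 i) //= (bigD1 j) //= -addrA lerDl addr_ge0 //;
  by do ?[apply: sumr_ge0 => ? _|exact: sqr_ge0].
rewrite -[X in X <= _]mulr1 ler_pM2l //.
have isq (s : R) (e : R) : 0 < s -> ((Num.sqrt s)^-1) `^ (2 * e) = (s `^ e)^-1.
  move=> s0; rewrite -(powR12_sqrt (ltW s0)) -!powRN -powRrM.
  by congr (_ `^ _); field.
(* With weights 2 al, 2 be, 2 ga, of sum 1, the geometric mean of the three inverse roots is exactly
   1 / [G i j k]. *)
have := @powR_amgm R 'I_3 (fun l => [:: 2 * al; 2 * be; 2 * ga]`_l)
  (fun l => [:: (Num.sqrt (u i))^-1; (Num.sqrt (v j))^-1; (Num.sqrt (w k))^-1]`_l).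
rewrite !big_ord_recl !big_ord0 /= !addr0 mulr1 => h.
have {h} := h _ _ _; rewrite !isq // => h.
rewrite -ler_pdivrMl; last by rewrite /G !mulr_gt0 // powR_gt0.
rewrite mulr1 -addrA; apply: le_trans (h _ _ _).
- by rewrite /G !invfM mulrA.
- by case=> [[|[|[|?]]]] //= _; rewrite mulr_ge0.
- by rewrite -!mulrDr addrA s12 divff.
- by case=> [[|[|[|?]]]] //= _; rewrite invr_ge0 sqrtr_ge0.
Qed.

End injective_lower.

(** * Euclidean and l_1 bounds for trilinear forms of given dual norm *)

Section tbound_consequences.
Context {R : realType}.
Variables (p q r : \bar R) (n : nat).
Hypotheses (p1 : (1%:E <= p)%E) (q1 : (1%:E <= q)%E) (r1 : (1%:E <= r)%E) (n0 : (0 < n)%N).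
Implicit Types (T A : 'rV[R]_(n * n * n)) (x y z : 'rV[R]_n) (K : R).
Notation pn := (@proj_norm R p q r n).
Notation tbound := (@tbound R p q r n).
Notation a := (rinv p).
Notation b := (rinv q).
Notation c := (rinv r).

(* The exponent lost when an [l_(1/s)] ball is compared with an [l_(1/t)] ball. *)
Definition loss (s t : R) : R := Num.max (s - t) 0.

Lemma natr_gt0 : 0 < n%:R :> R. Proof. by rewrite ltr0n. Qed.

Lemma natrX_ge0 (e : R) : 0 <= n%:R `^ e :> R. Proof. exact: powR_ge0. Qed.

Lemma natrX_gt0 (e : R) : 0 < n%:R `^ e :> R. Proof. by rewrite powR_gt0 ?natr_gt0. Qed.

Lemma natrXD (e f : R) : n%:R `^ (e + f) = n%:R `^ e * n%:R `^ f :> R.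
Proof. by rewrite powRD // (gt_eqF natr_gt0) implybT. Qed.

Lemma natrXN_le (e S K : R) : n%:R `^ (- e) * S / 3 <= K -> S <= 3 * (n%:R `^ e * K).
Proof.
have E : n%:R `^ e * n%:R `^ (- e) = 1 :> R by rewrite -natrXD subrr powRr0.
move=> h; have := ler_wpM2l (natrX_ge0 e) h.
by rewrite -mulrA [X in X <= _]mulrA E mul1r; lra.
Qed.

Lemma tbound_lpu T K al be ga x y z : tbound T K -> 0 <= al -> 0 <= be -> 0 <= ga ->
  lpu al x -> lpu be y -> lpu ga z ->
  dot T (tens3 x y z) <= n%:R `^ (loss a al + loss b be + loss c ga) * K.
Proof.
move=> hT al0 be0 ga0 hx hy hz; have K0 := tbound_ge0 p1 q1 r1 hT.
apply: (le_trans (dot_proj_norm p1 q1 r1 _ hT)); rewrite mulrC ler_wpM2r //.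
apply: le_trans (proj_norm_le (prep_tens p q r x y z)) _; rewrite !natrXD.
apply: ler_pM; rewrite ?mulr_ge0 ?lp_norm_ge0 //; last exact: lpu_lp_norm.
by apply: ler_pM; rewrite ?lp_norm_ge0 //; exact: lpu_lp_norm.
Qed.

Definition coef T (i j k : 'I_n) : R := T 0 (tidx i j k).

Lemma dot_tens3_tri T x y z : dot T (tens3 x y z) = tri (coef T) (x 0) (y 0) (z 0).
Proof. exact: dot_tens3. Qed.

Lemma dot_coef T : dot T T = \sum_i \sum_j \sum_k coef T i j k ^+ 2.
Proof.
by rewrite /dot sum_tidx; do 3 (apply: eq_bigr => ? _); rewrite expr2.
Qed.

(** After division by the Euclidean norm of [f], the marginals are probability weights, so the boxes
    of [box_l2] lie in the unit balls with exponents [al], [be], [ga]. *)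
Lemma lpu_l2 (f : 'I_n -> 'I_n -> 'I_n -> R) (al be ga K : R) :
  0 <= al -> 0 <= be -> 0 <= ga -> al + be + ga = 2^-1 ->
  (forall x y z, lpu al x -> lpu be y -> lpu ga z -> tri f (x 0) (y 0) (z 0) <= K) ->
  \sum_i \sum_j \sum_k f i j k ^+ 2 <= (3 * K) ^+ 2.
Proof.
move=> al0 be0 ga0 s12 hf; set Q := \sum_i _.
have Q0 : 0 <= Q by do 3 (apply: sumr_ge0 => ? _); exact: sqr_ge0.
have [->|Qn] := eqVneq Q 0; first exact: sqr_ge0.
pose s := Num.sqrt Q; have s0 : 0 < s by rewrite sqrtr_gt0 lt_def Qn.
have s2 : s ^+ 2 = Q by rewrite sqr_sqrtr.
pose g i j k := f i j k / s.
have g2 : \sum_i \sum_j \sum_k g i j k ^+ 2 = 1.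
  rewrite -(divff Qn) /Q mulr_suml; apply: eq_bigr => i _.
  rewrite mulr_suml; apply: eq_bigr => j _; rewrite mulr_suml; apply: eq_bigr => k _.
  by rewrite /g exprMn exprVn s2.
have key (u : 'I_n -> R) (e : R) x : (forall i, 0 <= u i) -> \sum_i u i = 1 ->
    (forall i, `|x 0 i| <= u i `^ e) -> lpu e x.
  by move=> u0 u1 hx; exists u; split => //; rewrite u1.
have : 1 / 3 <= K / s.
  apply: (box_l2 al0 be0 ga0 s12 g2) => x y z hx hy hz.
  have {hf} := hf (\row_i x i) (\row_i y i) (\row_i z i).
  rewrite ler_pdivlMr // => hf.
  have -> : tri g x y z * s = tri f ((\row_i x i) 0) ((\row_i y i) 0) ((\row_i z i) 0).
    rewrite /tri mulr_suml; apply: eq_bigr => i _; rewrite mulr_suml; apply: eq_bigr => j _.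
    rewrite mulr_suml; apply: eq_bigr => k _; rewrite !mxE /g mulrAC divfK ?gt_eqF //.
  apply: hf.
  - apply: key; last by move=> i; rewrite mxE; exact: hx.
      by move=> i; do 2 (apply: sumr_ge0 => ? _); exact: sqr_ge0.
    by [].
  - apply: key; last by move=> i; rewrite mxE; exact: hy.
      by move=> i; do 2 (apply: sumr_ge0 => ? _); exact: sqr_ge0.
    by rewrite -(sum_rot (fun i j k => g i j k ^+ 2)).
  apply: key; last by move=> i; rewrite mxE; exact: hz.
    by move=> i; do 2 (apply: sumr_ge0 => ? _); exact: sqr_ge0.
  by rewrite (sum_rot (fun k i j => g i j k ^+ 2)).
rewrite ler_pdivlMr // => h; rewrite -s2 ler_sqr ?nnegrE ?(ltW s0) //; lra.
Qed.

Lemma tbound_l2 T K al be ga : tbound T K ->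
  0 <= al -> 0 <= be -> 0 <= ga -> al + be + ga = 2^-1 ->
  dot T T <= (3 * n%:R `^ (loss a al + loss b be + loss c ga) * K) ^+ 2.
Proof.
move=> hT al0 be0 ga0 s12; rewrite dot_coef -mulrA.
apply: (lpu_l2 al0 be0 ga0 s12) => x y z hx hy hz.
by rewrite -dot_tens3_tri; exact: tbound_lpu.
Qed.

Definition mask_row (i0 : 'I_n) (x : 'rV[R]_n) : 'rV[R]_n := \row_i ((i == i0)%:R * x 0 i).

(** A vector with entries bounded by 1 becomes a multiple of a unit vector, hence lies in every l_p
    unit ball. Slices of a form therefore inherit its bound without loss. *)
Lemma lpu_mask i0 x : lpu 0 x -> lpu 1 (mask_row i0 x).
Proof.
move=> [u [u0 u1 xu]]; exists (fun i => (i == i0)%:R); split => [i||i].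
- exact: ler0n.
- by rewrite (bigD1 i0) //= eqxx big1 ?addr0 // => l /negPf ->.
rewrite mxE normrM normr_nat powRr1 ?ler0n // -[X in _ <= X]mulr1 ler_wpM2l //.
by have := xu i; rewrite powRr0.
Qed.

Lemma loss1 (t : \bar R) : (1%:E <= t)%E -> loss (rinv t) 1 = 0.
Proof. by move=> t1; apply: max_r; rewrite subr_le0; exact: rinv_le1. Qed.

(** Each slice T(e_i, ., .) is a form to which [lpu_l2] applies with first exponent 0; adding the
    squares of [n] slices produces the factor n^(1/2). *)
Lemma tbound_slice T K be ga : tbound T K -> 0 <= be -> 0 <= ga -> be + ga = 2^-1 ->
  dot T T <= (3 * n%:R `^ (2^-1 + (loss b be + loss c ga)) * K) ^+ 2.
Proof.
move=> hT be0 ga0 s12; set E := loss b be + loss c ga.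
have slice i0 : \sum_j \sum_k coef T i0 j k ^+ 2 <= (3 * (n%:R `^ E * K)) ^+ 2.
  have -> : \sum_j \sum_k coef T i0 j k ^+ 2 =
      \sum_i \sum_j \sum_k ((i == i0)%:R * coef T i j k) ^+ 2.
    rewrite [RHS](bigD1 i0) //= [X in _ = _ + X]big1 ?addr0.
      by do 2 (apply: eq_bigr => ? _); rewrite eqxx mul1r.
    by move=> i /negPf ->; rewrite big1 // => j _; rewrite big1 // => k _; rewrite mul0r expr0n.
  apply: (@lpu_l2 _ 0 be ga) => //; first by rewrite add0r.
  move=> x y z hx hy hz.
  have -> : tri (fun i j k => (i == i0)%:R * coef T i j k) (x 0) (y 0) (z 0) =
      dot T (tens3 (mask_row i0 x) y z).
    rewrite dot_tens3_tri /tri; apply: eq_bigr => i _; apply: eq_bigr => j _; apply: eq_bigr => k _.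
    by rewrite mxE; ring.
  apply: le_trans (tbound_lpu hT _ be0 ga0 (lpu_mask i0 hx) hy hz) _ => //.
  by rewrite (loss1 p1) add0r.
rewrite dot_coef; apply: le_trans (ler_sum _ (fun i _ => slice i)) _.
rewrite sumr_const card_ord -[X in X <= _]mulr_natl (natrXD 2^-1 E) !exprMn.
have -> : (n%:R `^ 2^-1) ^+ 2 = n%:R :> R by rewrite powR12_sqrt ?sqr_sqrtr ?ler0n.
by rewrite le_eqVlt; apply/orP; left; apply/eqP; ring.
Qed.

(** With two indices fixed the slices are vectors, the whole exponent 1/2 goes to the third
    variable, and n^2 slices produce the factor n. *)
Lemma tbound_slice2 T K : tbound T K ->
  dot T T <= (3 * n%:R `^ (1 + loss c 2^-1) * K) ^+ 2.
Proof.
move=> hT; set E := loss c 2^-1.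
have slice i0 j0 : \sum_k coef T i0 j0 k ^+ 2 <= (3 * (n%:R `^ E * K)) ^+ 2.
  have -> : \sum_k coef T i0 j0 k ^+ 2 =
      \sum_i \sum_j \sum_k ((i == i0)%:R * (j == j0)%:R * coef T i j k) ^+ 2.
    rewrite [RHS](bigD1 i0) //= [X in _ = _ + X]big1 ?addr0; last first.
      by move=> i /negPf ->; rewrite big1 // => j _; rewrite big1 // => k _; rewrite !mul0r expr0n.
    rewrite [RHS](bigD1 j0) //= [X in _ = _ + X]big1 ?addr0; last first.
      by move=> j /negPf ->; rewrite big1 // => k _; rewrite mulr0 !mul0r expr0n.
    by apply: eq_bigr => ? _; rewrite !eqxx !mul1r.
  apply: (@lpu_l2 _ 0 0 2^-1) => //; first by rewrite !add0r.
  move=> x y z hx hy hz.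
  have -> : tri (fun i j k => (i == i0)%:R * (j == j0)%:R * coef T i j k) (x 0) (y 0) (z 0) =
      dot T (tens3 (mask_row i0 x) (mask_row j0 y) z).
    rewrite dot_tens3_tri /tri; apply: eq_bigr => i _; apply: eq_bigr => j _; apply: eq_bigr => k _.
    by rewrite !mxE; ring.
  apply: le_trans (tbound_lpu hT _ _ _ (lpu_mask i0 hx) (lpu_mask j0 hy) hz) _ => //.
  by rewrite (loss1 p1) (loss1 q1) !add0r.
rewrite dot_coef; apply: le_trans (ler_sum _ (fun i _ => ler_sum _ (fun j _ => slice i j))) _.
rewrite !sumr_const card_ord -mulrnA -[X in X <= _]mulr_natl natrM (natrXD 1 E) !exprMn.
rewrite powRr1 ?ler0n //.
by rewrite le_eqVlt; apply/orP; left; apply/eqP; ring.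
Qed.

Lemma sum_norm_le_sqrt (I : finType) (t : I -> R) :
  \sum_i `|t i| <= Num.sqrt #|I|%:R * Num.sqrt (\sum_i t i ^+ 2).
Proof.
rewrite -sqrtrM ?ler0n // -(ger0_norm (sumr_ge0 _ (fun i _ => normr_ge0 (t i)))) -sqrtr_sqr.
apply: ler_wsqrtr; have := sum_mul_sqr_le (fun=> 1) (fun i => `|t i|).
have -> : \sum_i 1 * `|t i| = \sum_i `|t i| by apply: eq_bigr => i _; rewrite mul1r.
have -> : \sum_(i : I) (1 : R) ^+ 2 = #|I|%:R by rewrite expr1n sumr_const.
move=> h; apply: le_trans h _.
by rewrite ler_wpM2l ?ler0n //; apply: ler_sum => i _; rewrite real_normK ?num_real.
Qed.

Lemma lpu_cst (e : R) x : (forall i, `|x 0 i| <= n%:R^-1 `^ e) -> lpu e x.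
Proof.
move=> hx; exists (fun=> n%:R^-1); split => //.
by rewrite sumr_const card_ord -[_ *+ n]mulr_natl divff // gt_eqF ?natr_gt0.
Qed.

Lemma loss_refl e : loss e e = 0.
Proof. by rewrite /loss subrr maxxx. Qed.

Lemma sum_norm_coef T : \sum_m `|T 0 m| = \sum_i \sum_j \sum_k `|coef T i j k|.
Proof. exact: sum_tidx. Qed.

Lemma invnX (e : R) : n%:R^-1 `^ e = n%:R `^ (- e) :> R.
Proof. by rewrite -powR_inv1 ?ler0n // -powRrM mulN1r. Qed.

(** Flat vectors with entries n^(-a), n^(-b), n^(-c) lie in the unit balls. Khintchine then bounds a
    sum of Euclidean norms of slices, and passing to the l_1 norm of a slice with n^2 entries costs
    the factor n. *)
Lemma tbound_l1 T K : tbound T K -> \sum_m `|T 0 m| <= 3 * n%:R `^ (a + b + c + 1) * K.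
Proof.
move=> hT.
have h : box_bound (coef T) (fun=> n%:R^-1 `^ a) (fun=> n%:R^-1 `^ b) (fun=> n%:R^-1 `^ c) K.
  move=> x y z hx hy hz.
  have := tbound_lpu (x := \row_i x i) (y := \row_i y i) (z := \row_i z i) hT
    (rinv_ge0 p1) (rinv_ge0 q1) (rinv_ge0 r1).
  rewrite dot_tens3_tri !loss_refl !addr0 powRr0 mul1r.
  have -> : tri (coef T) ((\row_i x i) 0) ((\row_i y i) 0) ((\row_i z i) 0) = tri (coef T) x y z.
    by do 3 (apply: eq_bigr => ? _); rewrite !mxE.
  by apply; apply: lpu_cst => i; rewrite mxE.
have := khintchine_box (fun=> powR_ge0 _ _) (fun=> powR_ge0 _ _) (fun=> powR_ge0 _ _) h.
set X := _ / 3 => h1.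
have E : X = n%:R `^ (- (a + b + c)) * (\sum_k Num.sqrt (\sum_i \sum_j coef T i j k ^+ 2)) / 3.
  rewrite /X mulr_sumr; congr (_ / 3); apply: eq_bigr => k _.
  have -> : \sum_i \sum_j (coef T i j k * (n%:R^-1 `^ a * n%:R^-1 `^ b)) ^+ 2 =
     (n%:R^-1 `^ a * n%:R^-1 `^ b) ^+ 2 * \sum_i \sum_j coef T i j k ^+ 2.
    rewrite mulr_sumr; apply: eq_bigr => i _; rewrite mulr_sumr; apply: eq_bigr => j _.
    by rewrite exprMn mulrC.
  rewrite sqrtrM ?sqr_ge0 // sqrtr_sqr ger0_norm ?mulr_ge0 ?powR_ge0 // !invnX mulrA.
  by rewrite -!natrXD; congr (n%:R `^ _ * _); ring.
have le : \sum_m `|T 0 m| <= n%:R * \sum_k Num.sqrt (\sum_i \sum_j coef T i j k ^+ 2).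
  rewrite sum_norm_coef sum_rot sum_rot mulr_sumr; apply: ler_sum => k _.
  have := sum_norm_le_sqrt (fun u : 'I_n * 'I_n => coef T u.1 u.2 k).
  by rewrite !pair_bigA card_prod card_ord natrM -expr2 sqrtr_sqr ger0_norm ?ler0n.
apply: (le_trans le); rewrite E in h1.
rewrite natrXD powRr1 ?ler0n //.
have := ler_wpM2l (ler0n R n) (natrXN_le h1); lra.
Qed.

(** A unit vector in the first variable avoids the factor n^a of the flat one. Columns of [n]
    entries cost n^(1/2) and the sum over the fixed index costs n, whence 3/2. *)
Lemma tbound_slice_l1 T K : tbound T K ->
  \sum_m `|T 0 m| <= 3 * n%:R `^ (b + c + 3 / 2) * K.
Proof.
move=> hT.
have slice i0 : \sum_k Num.sqrt (\sum_j coef T i0 j k ^+ 2) <= 3 * (n%:R `^ (b + c) * K).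
  have h : box_bound (coef T) (fun i => (i == i0)%:R) (fun=> n%:R^-1 `^ b) (fun=> n%:R^-1 `^ c) K.
    move=> x y z hx hy hz.
    have := tbound_lpu (x := \row_i x i) (y := \row_i y i) (z := \row_i z i) hT
      ler01 (rinv_ge0 q1) (rinv_ge0 r1).
    rewrite dot_tens3_tri !loss_refl !addr0 (loss1 p1) powRr0 mul1r.
    have -> : tri (coef T) ((\row_i x i) 0) ((\row_i y i) 0) ((\row_i z i) 0) = tri (coef T) x y z.
      by do 3 (apply: eq_bigr => ? _); rewrite !mxE.
    apply; [|by apply: lpu_cst => i; rewrite mxE|by apply: lpu_cst => i; rewrite mxE].
    exists (fun i => (i == i0)%:R); split => [i||i].
    - exact: ler0n.
    - by rewrite (bigD1 i0) //= eqxx big1 ?addr0 // => l /negPf ->.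
    by rewrite mxE powRr1 ?ler0n.
  have := khintchine_box (fun=> ler0n _ _) (fun=> powR_ge0 _ _) (fun=> powR_ge0 _ _) h.
  set X := _ / 3 => h1.
  have E : X = n%:R `^ (- (b + c)) * (\sum_k Num.sqrt (\sum_j coef T i0 j k ^+ 2)) / 3.
    rewrite /X mulr_sumr; congr (_ / 3); apply: eq_bigr => k _.
    have -> : \sum_i \sum_j (coef T i j k * ((i == i0)%:R * n%:R^-1 `^ b)) ^+ 2 =
       (n%:R^-1 `^ b) ^+ 2 * \sum_j coef T i0 j k ^+ 2.
      rewrite (bigD1 i0) //= [X in _ + X]big1 ?addr0; last first.
        by move=> i /negPf ->; rewrite big1 // => j _; rewrite mul0r mulr0 expr0n.
      by rewrite mulr_sumr; apply: eq_bigr => j _; rewrite eqxx mul1r exprMn mulrC.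
    rewrite sqrtrM ?sqr_ge0 // sqrtr_sqr ger0_norm ?powR_ge0 // !invnX mulrA.
    by rewrite -!natrXD; congr (n%:R `^ _ * _); ring.
  by rewrite E in h1; exact: natrXN_le.
have le i0 : \sum_j \sum_k `|coef T i0 j k| <= n%:R `^ 2^-1 * (3 * (n%:R `^ (b + c) * K)).
  apply: le_trans (ler_wpM2l (natrX_ge0 _) (slice i0)); rewrite exchange_big mulr_sumr.
  apply: ler_sum => k _; have := sum_norm_le_sqrt (fun j => coef T i0 j k).
  by rewrite card_ord -powR12_sqrt ?ler0n.
rewrite sum_norm_coef; apply: le_trans (ler_sum _ (fun i _ => le i)) _.
rewrite sumr_const card_ord -[X in X <= _]mulr_natl.
have -> : b + c + 3 / 2 = 1 + (2^-1 + (b + c)) by field.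
by rewrite (natrXD 1) powRr1 ?ler0n // (natrXD 2^-1) le_eqVlt; apply/orP; left; apply/eqP; ring.
Qed.

End tbound_consequences.

(** * Covering the unit ball by Maurey's method *)

Section lattice.
Context {R : realType}.
Variables (t : R) (M D : nat).
Hypothesis t12 : 1 <= t <= 2.

Notation idx := {ffun 'I_M -> 'I_(D + D).+1}.

(** Integer vectors with entries in [-D, D] are stored shifted by [D], in a finite type, so that
    they can be counted. *)
Definition latv (f : idx) (i : 'I_M) : R := (f i)%:R - D%:R.

Definition lat : {set idx} := [set f | \sum_i `|latv f i| `^ t <= D%:R].

Definition ndist (d m : nat) : nat := ((d - m) + (m - d))%N.

Lemma norm_latv f i : `|latv f i| = (ndist D (f i))%:R.
Proof.
rewrite /latv /ndist; have [h|h] := leqP (f i) D.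
  by rewrite distrC ger0_norm ?subr_ge0 ?ler_nat // -natrB // natrD (eqP h) addr0.
have h' := ltnW h.
by rewrite ger0_norm ?subr_ge0 ?ler_nat // -natrB // natrD (eqP h') add0r.
Qed.

Lemma sum_half_ndist d : \sum_(m < (d + d).+1) (2^-1 : R) ^+ ndist d m = 3 - 2 * 2^-1 ^+ d.
Proof.
elim: d => [|d IH]; first by rewrite big_ord1 /ndist /= expr0; lra.
have -> : (d.+1 + d.+1).+1 = (d + d).+1.+2 by rewrite addSn addnS.
rewrite big_ord_recl big_ord_recr /=.
rewrite (eq_bigr (fun m : 'I_(d + d).+1 => 2^-1 ^+ ndist d m)); last first.
  by move=> m _; rewrite /ndist /= /bump leq0n add1n !subSS.
rewrite IH /ndist /= /bump leq0n add1n !subSS subn0 sub0n addn0.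
have -> : ((d - (d + d).+1) + ((d + d).+1 - d) = d.+1)%N by lia.
rewrite exprS; lra.
Qed.

Lemma natr_powR_ge (k : nat) : k%:R <= k%:R `^ t.
Proof.
have /andP[t1 _] := t12.
case: k => [|k]; first exact: powR_ge0.
by rewrite le1r_powR // ler1n.
Qed.

(** Exponential counting. Since |k| <= |k|^t for integers, points of [lat] have l_1 norm at most
    [D], so 2^D times the product of the 2^(-|k_i|) is at least 1 on them. Summed over all vectors
    this product factorises, each factor being at most 3. *)
Lemma card_lat : #|lat|%:R <= (2 : R) ^+ D * 3 ^+ M.
Proof.
have half0 (k : nat) : 0 <= (2^-1 : R) ^+ k by rewrite exprn_ge0.
have le f : f \in lat -> 1 <= (2 : R) ^+ D * \prod_i 2^-1 ^+ ndist D (f i).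
  rewrite inE => hf; rewrite prodrXr.
  have h : (\sum_i ndist D (f i) <= D)%N.
    rewrite -(ler_nat R) natr_sum; apply: le_trans hf; apply: ler_sum => i _.
    by rewrite norm_latv; exact: natr_powR_ge.
  rewrite exprVn ler_pdivlMr ?exprn_gt0 // mul1r.
  by rewrite ler_weXn2l // ler1n.
rewrite -sumr_const.
apply: (@le_trans _ _ (\sum_(f in lat) (2 : R) ^+ D * \prod_i 2^-1 ^+ ndist D (f i))).
  by apply: ler_sum => f; exact: le.
apply: (@le_trans _ _ (\sum_(f : idx) (2 : R) ^+ D * \prod_i 2^-1 ^+ ndist D (f i))).
  rewrite [X in _ <= X](bigID (mem lat)) /= lerDl; apply: sumr_ge0 => f _.
  by rewrite mulr_ge0 ?exprn_ge0 //; apply: prodr_ge0.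
rewrite -mulr_sumr ler_wpM2l ?exprn_ge0 //.
rewrite -(bigA_distr_bigA (fun (i : 'I_M) (m : 'I_(D + D).+1) => (2^-1 : R) ^+ ndist D m)) /=.
have h1 : (2^-1 : R) ^+ D <= 1 by apply: exprn_ile1; lra.
have h2 := half0 D.
by rewrite sum_half_ndist prodr_const card_ord; apply: lerXn2r; rewrite ?nnegrE; lra.
Qed.

Lemma lat_intro (m : 'I_M -> int) : \sum_i `|(m i)%:~R| `^ t <= D%:R ->
  exists2 f, f \in lat & forall i, latv f i = (m i)%:~R.
Proof.
move=> hm.
have hD i : (`|m i| <= D)%N.
  rewrite -(ler_nat R); apply: le_trans hm; rewrite (bigD1 i) //=.
  apply: (@le_trans _ _ (`|(m i)%:~R : R| `^ t)).
    by have := natr_powR_ge (absz (m i)); rewrite natr_absz intr_norm.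
  by rewrite lerDl; apply: sumr_ge0 => j _; exact: powR_ge0.
pose g i : nat := absz (m i + D%:Z)%R.
have gE i : (g i)%:Z = m i + D%:Z by rewrite /g; have := hD i; lia.
have gD i : (g i < (D + D).+1)%N by have := hD i; have := gE i; lia.
have vE i : latv [ffun i => Ordinal (gD i)] i = (m i)%:~R.
  rewrite /latv ffunE /= (_ : (absz (m i + D%:Z)%R)%:R = ((g i)%:Z)%:~R) // gE rmorphD /=.
  by rewrite addrK.
exists [ffun i => Ordinal (gD i)] => //.
by rewrite inE (eq_bigr (fun i => `|(m i)%:~R| `^ t)) // => i _; rewrite vE.
Qed.

(** Rounding towards 0 does not increase absolute values, so the rounded vector stays in [lat]. *)
Lemma lat_cover (h : R) (w : 'I_M -> R) : 0 < h -> \sum_i `|w i / h| `^ t <= D%:R ->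
  exists2 f, f \in lat & forall i, `|w i - h * latv f i| <= h.
Proof.
move=> h0 hw; have /andP[t1 _] := t12.
pose k i := Num.truncn (`|w i| / h).
have k1 i : (k i)%:R <= `|w i| / h by rewrite /k truncn_le // divr_ge0 // ltW.
have k2 i : `|w i| / h < (k i).+1%:R by exact: truncnS_gt.
pose m i : int := if 0 <= w i then (k i)%:Z else - (k i)%:Z.
have mE i : (m i)%:~R = (if 0 <= w i then (k i)%:R else - (k i)%:R) :> R.
  by rewrite /m; case: ifP; rewrite ?rmorphN /= ?pmulrn.
have mn i : `|(m i)%:~R| = (k i)%:R :> R.
  by rewrite mE; case: ifP => _; rewrite ?normrN normr_nat.
have hm : \sum_i `|(m i)%:~R| `^ t <= D%:R.
  apply: le_trans hw; apply: ler_sum => i _; rewrite mn normrM normfV (gtr0_norm h0).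
  by apply: ge0_ler_powR; rewrite ?nnegrE ?divr_ge0 ?(ltW h0) //; lra.
have [f fl fm] := lat_intro hm; exists f => // i; rewrite fm mE.
have := k1 i; have := k2 i; rewrite ler_pdivlMr // ltr_pdivrMr // -natr1.
case: (leP 0 (w i)) => hi; [rewrite (ger0_norm hi)|rewrite (ltr0_norm hi)];
  by rewrite ler_norml => *; apply/andP; split; lra.
Qed.

Lemma lat0 : exists2 f, f \in lat & forall i, latv f i = 0.
Proof.
have [|f fl fm] := @lat_intro (fun=> 0).
  by rewrite big1 ?ler0n // => i _; rewrite normr0 powR0 //; have /andP[] := t12; lra.
by exists f => // i; rewrite fm.
Qed.

End lattice.

Section round.
Context {R : realType}.
Variables (t : R) (n : nat).
Hypotheses (t12 : 1 <= t <= 2) (n0 : (0 < n)%N).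

Notation D := (8 * n)%N.
Notation idx := {ffun 'I_n -> 'I_(D + D).+1}.

Definition Phi N (v : 'rV[R]_N) : R := \sum_m `|v 0 m| `^ t.

Definition lpt (f : idx) : 'rV[R]_n := \row_i (n%:R `^ (- t^-1) * latv f i).

Let t0 : t != 0. Proof. by have /andP[] := t12; lra. Qed.
Let N0 : 0 < n%:R :> R. Proof. by rewrite ltr0n. Qed.

Lemma Phi_lpt f : f \in lat t n D -> Phi (lpt f) <= 8.
Proof.
rewrite inE => hf.
have -> : Phi (lpt f) = n%:R^-1 * \sum_i `|latv f i| `^ t.
  rewrite /Phi mulr_sumr; apply: eq_bigr => i _; rewrite mxE normrM powRM //.
  rewrite ger0_norm ?powR_ge0 // -powRrM mulNr mulVf // powR_inv1 ?ltW //.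
rewrite mulrC ler_pdivrMr // -natrM; exact: hf.
Qed.

(** Each coordinate is rounded up or down according to the sign of [g i], so the functional cannot
    decrease. *)
Lemma round_lpu (g : 'I_n -> R) (x : 'rV[R]_n) : lpu t^-1 x ->
  exists2 f, f \in lat t n D & \sum_i g i * x 0 i <= \sum_i g i * lpt f 0 i.
Proof.
move=> [u [u0 u1 xu]]; have /andP[t1 t2] := t12.
pose h : R := n%:R `^ (- t^-1); have h0 : 0 < h by rewrite powR_gt0.
pose m i : int := if 0 <= g i then Num.floor (x 0 i / h) + 1 else Num.floor (x 0 i / h).
have fl i : (Num.floor (x 0 i / h))%:~R <= x 0 i / h by exact: floor_le.
have fu i : x 0 i / h < (Num.floor (x 0 i / h))%:~R + 1 by have := floorD1_gt (x 0 i / h); rewrite rmorphD.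
have mE i : (m i)%:~R = (if 0 <= g i then (Num.floor (x 0 i / h))%:~R + 1 else (Num.floor (x 0 i / h))%:~R) :> R.
  by rewrite /m; case: ifP => _ //; rewrite rmorphD.
(* Rounding moves a rescaled coordinate by at most 1; summed over [i] the bound gives 4 (n + n) =
   8n, the value of [D]. *)
have le i : `|(m i)%:~R| `^ t <= 4 * (n%:R * u i + 1).
  have -> : (m i)%:~R = x 0 i / h + ((m i)%:~R - x 0 i / h) by rewrite addrC subrK.
  apply: le_trans (powR_normD _ _ t12) _; rewrite ler_wpM2l //; apply: lerD.
    rewrite normrM normfV (gtr0_norm h0) powRM ?invr_ge0 ?(ltW h0) //.
    have -> : h^-1 `^ t = n%:R by rewrite -powRN opprK -powRrM mulVf // powRr1 ?ltW.
    rewrite mulrC ler_wpM2l ?(ltW N0) //.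
    rewrite -[X in _ <= X](powRVK (u0 i) t0); apply: ge0_ler_powR; rewrite ?nnegrE ?powR_ge0 //; lra.
  rewrite [X in _ <= X](powR_one t); apply: ge0_ler_powR; rewrite ?nnegrE //; first by lra.
  by rewrite mE ler_norml; have := fl i; have := fu i; case: ifP => _ *; apply/andP; split; lra.
have hm : \sum_i `|(m i)%:~R| `^ t <= D%:R.
  apply: le_trans (ler_sum _ (fun i _ => le i)) _.
  rewrite -mulr_sumr big_split /= -mulr_sumr sumr_const card_ord natrM.
  set S := \sum_i _ in u1 *; have := ler_wpM2l (ltW N0) u1; lra.
have [f fL fm] := lat_intro t12 hm; exists f => //.
apply: ler_sum => i _; rewrite mxE fm -/h mE.
have := fl i; have := fu i; rewrite ler_pdivlMr // ltr_pdivrMr // => h1 h2.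
case: (leP 0 (g i)) => hg; first by rewrite ler_wpM2l // mulrC ltW.
by rewrite ler_wnM2l ?(ltW hg) // mulrC.
Qed.

End round.

Section maurey.
Context {R : realType}.
Variables (p q r : \bar R) (n : nat) (t : R).
Hypotheses (p1 : (1%:E <= p)%E) (q1 : (1%:E <= q)%E) (r1 : (1%:E <= r)%E) (n0 : (0 < n)%N).
Hypothesis t12 : 1 <= t <= 2.
Implicit Types (T A : 'rV[R]_(n * n * n)) (x y z : 'rV[R]_n) (K : R).
Notation pn := (@proj_norm R p q r n).
Notation tbound := (@tbound R p q r n).
Notation D := (8 * n)%N.
Notation idx := {ffun 'I_n -> 'I_(D + D).+1}.
Notation idx3 := ((idx * idx) * idx)%type.
Notation Phi := (Phi t).

Definition lat3 : {set idx3} := finset.setX (finset.setX (lat t n D) (lat t n D)) (lat t n D).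

Definition lpt3 (u : idx3) : 'rV[R]_(n * n * n) := tens3 (lpt t u.1.1) (lpt t u.1.2) (lpt t u.2).

(** The product of the norms of the inclusions of l_p, l_q and l_r into l_t. *)
Definition wide : R :=
  n%:R `^ (loss t^-1 (rinv p) + loss t^-1 (rinv q) + loss t^-1 (rinv r)).

Let tV0 : 0 <= t^-1. Proof. by have /andP[] := t12; rewrite invr_ge0; lra. Qed.

Lemma wide_gt0 : 0 < wide. Proof. exact: natrX_gt0. Qed.

(** The vectors are rounded one after another, each against the linear functional determined by the
    current values of the other two. *)
Lemma round_tens T x y z : lpu t^-1 x -> lpu t^-1 y -> lpu t^-1 z ->
  exists2 u, u \in lat3 & dot T (tens3 x y z) <= dot T (lpt3 u).
Proof.
move=> hx hy hz.
have [f fL hf] := round_lpu t12 n0 (fun i => \sum_j \sum_k coef T i j k * (y 0 j * z 0 k)) hx.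
have [g gL hg] := round_lpu t12 n0 (fun j => \sum_k \sum_i coef T i j k * (lpt t f 0 i * z 0 k)) hy.
have [k kL hk] := round_lpu t12 n0 (fun k => \sum_i \sum_j coef T i j k * (lpt t f 0 i * lpt t g 0 j)) hz.
exists ((f, g), k); first by rewrite !finset.in_setX /= fL gL kL.
rewrite !dot_tens3_tri /tri /lpt3 /=.
have e1 (x' : 'I_n -> R) : \sum_i (\sum_j \sum_k coef T i j k * (y 0 j * z 0 k)) * x' i =
   \sum_i \sum_j \sum_k coef T i j k * (x' i * y 0 j * z 0 k) :> R.
  apply: eq_bigr => i _; rewrite mulr_suml; apply: eq_bigr => j _.
  by rewrite mulr_suml; apply: eq_bigr => l _; ring.
have e2 (x' y' : 'I_n -> R) : \sum_j (\sum_k \sum_i coef T i j k * (x' i * z 0 k)) * y' j =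
   \sum_i \sum_j \sum_k coef T i j k * (x' i * y' j * z 0 k) :> R.
  rewrite [RHS]sum_rot; apply: eq_bigr => j _; rewrite mulr_suml; apply: eq_bigr => l _.
  by rewrite mulr_suml; apply: eq_bigr => i _; ring.
have e3 (x' y' z' : 'I_n -> R) : \sum_k (\sum_i \sum_j coef T i j k * (x' i * y' j)) * z' k =
   \sum_i \sum_j \sum_k coef T i j k * (x' i * y' j * z' k) :> R.
  rewrite -[RHS](sum_rot (fun l i j => coef T i j l * (x' i * y' j * z' l))).
  apply: eq_bigr => l _; rewrite mulr_suml; apply: eq_bigr => i _.
  by rewrite mulr_suml; apply: eq_bigr => j _; ring.
rewrite -e1; apply: (le_trans hf); rewrite e1 -e2; apply: (le_trans hg).
by rewrite e2 -e3; apply: (le_trans hk); rewrite e3.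
Qed.

(** In terms of support functions, the rescaled unit ball lies in the convex hull of the lattice
    products: the best product for [T] bounds [T] on all triples from the l_t balls, hence in dual
    norm. *)
Lemma maurey_support T A : pn A <= 1 ->
  exists2 u, u \in lat3 & dot T (wide^-1 *: A) <= dot T (lpt3 u).
Proof.
move=> A1; have W0 := wide_gt0.
(* The zero product makes the candidate set nonempty and the maximum [K] nonnegative. *)
have [f0 f0L f0v] := @lat0 R t n D t12.
have u0L : ((f0, f0), f0) \in lat3.
  by rewrite !finset.in_setX /= f0L.
case: (@Order.TotalTheory.arg_maxP _ R _ ((f0, f0), f0) (fun u => u \in lat3) (fun u => dot T (lpt3 u)) u0L).
move=> u uL umax; exists u => //.
set K := dot T (lpt3 u) in umax *.
have K0 : 0 <= K.
  apply: le_trans (umax _ u0L); rewrite dot_tens3_tri.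
  have z i : lpt t f0 0 i = 0 by rewrite mxE f0v mulr0.
  by rewrite /tri big1 // => i _; rewrite big1 // => j _; rewrite big1 // => k _; rewrite z /= !mul0r mulr0.
have hT : tbound T (wide * K).
  move=> x y z hx hy hz.
  have ex := lpu_embed n0 (rinv_ge0 p1) tV0 (iffLR (lp_norm_le1 x p1) hx).
  have ey := lpu_embed n0 (rinv_ge0 q1) tV0 (iffLR (lp_norm_le1 y q1) hy).
  have ez := lpu_embed n0 (rinv_ge0 r1) tV0 (iffLR (lp_norm_le1 z r1) hz).
  have [v vL] := round_tens T ex ey ez.
  rewrite tens3Z dotZr -!invfM -!natrXD // -/wide => h.
  by rewrite -ler_pdivrMl //; apply: (le_trans h); exact: umax.
have := dot_proj_norm p1 q1 r1 A hT.
move=> h; rewrite dotZr ler_pdivrMl //; apply: (le_trans h).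
by rewrite -[X in _ <= X]mulr1 ler_wpM2l // mulr_ge0 // ltW.
Qed.

Lemma Phi_tens3 x y z : Phi (tens3 x y z) = Phi x * Phi y * Phi z.
Proof.
rewrite /Phi sum_tidx !big_distrl /=; apply: eq_bigr => i _.
rewrite -mulrA big_distrl big_distrr /=; apply: eq_bigr => j _.
rewrite !big_distrr /=; apply: eq_bigr => k _.
by rewrite tens3E !normrM !powRM ?mulr_ge0 // mulrA.
Qed.

Lemma Phi_ge0 N (v : 'rV[R]_N) : 0 <= Phi v.
Proof. by apply: sumr_ge0 => m _; exact: powR_ge0. Qed.

Lemma Phi_lpt3 u : u \in lat3 -> Phi (lpt3 u) <= 8 ^+ 3.
Proof.
case: u => [[f g] k]; rewrite !finset.in_setX => /andP[/andP[h1 h2] h3].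
have p1' := Phi_lpt t12 n0 h1; have p2' := Phi_lpt t12 n0 h2; have p3' := Phi_lpt t12 n0 h3.
rewrite Phi_tens3 exprS expr2 mulrA; apply: ler_pM; rewrite ?mulr_ge0 ?Phi_ge0 //.
by apply: ler_pM; rewrite ?Phi_ge0.
Qed.

Lemma Phi_slope N (v : 'rV[R]_N) : exists c : 'rV[R]_N, forall d : 'rV[R]_N,
  0 <= Phi (v + d) - Phi v - dot c d <= 2 * Phi d.
Proof.
have [c hc] := choice (fun m => powR_slope (v 0 m) t12).
exists (\row_m c m) => d.
have -> : Phi (v + d) - Phi v - dot (\row_m c m) d =
    \sum_m (`|v 0 m + d 0 m| `^ t - `|v 0 m| `^ t - c m * d 0 m).
  by rewrite !sumrB; congr (_ - _ - _); apply: eq_bigr => m _; rewrite mxE.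
apply/andP; split; first by apply: sumr_ge0 => m _; have /andP[] := hc m (d 0 m).
by rewrite mulr_sumr; apply: ler_sum => m _; have /andP[] := hc m (d 0 m).
Qed.

(** By convexity [Phi] lies above its tangent at the rescaled [A], and some lattice product lies on
    the side where the linear term is nonnegative. *)
Lemma Phi_body A : pn A <= 1 -> Phi (wide^-1 *: A) <= 8 ^+ 3.
Proof.
move=> A1; have [c hc] := Phi_slope (wide^-1 *: A).
have [u uL hu] := maurey_support c A1.
apply: le_trans (Phi_lpt3 uL).
have /andP[h _] := hc (lpt3 u - wide^-1 *: A); move: h.
by rewrite [_ *: A + _]addrC subrK dotBr; lra.
Qed.

Lemma Phi_sub N (v w : 'rV[R]_N) : Phi (v - w) <= 4 * (Phi v + Phi w).
Proof.
rewrite -big_split mulr_sumr; apply: ler_sum => m _; rewrite !mxE.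
by apply: le_trans (powR_normD _ _ t12) _; rewrite normrN.
Qed.

(** A greedy choice takes the place of random sampling: the next product makes the linear term of
    [Phi] at the current error nonpositive. Only the smoothness remainder is added, at most 2 times
    4 (8^3 + 8^3), which is 16 times 8^3 per step. *)
Lemma maurey A (k : nat) : pn A <= 1 ->
  exists2 s : 'I_k -> idx3, forall l, s l \in lat3 &
  Phi (\sum_l lpt3 (s l) - k%:R *: (wide^-1 *: A)) <= 16 * 8 ^+ 3 * k%:R.
Proof.
move=> A1; set B := wide^-1 *: A; have hB := Phi_body A1.
elim: k => [|k [s sL hs]].
  have [f0 f0L f0v] := @lat0 R t n D t12.
  exists (fun=> ((f0, f0), f0)); first by case=> ?.
  rewrite big_ord0 scale0r subrr mulr0 /Phi big1 // => m _.
  by rewrite mxE normr0 powR0 //; have /andP[] := t12; lra.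
set S := _ - _ in hs; have [c hc] := Phi_slope S.
have [u uL hu] := maurey_support (- c) A1.
exists (fun l => if fintype.unlift ord_max l is Some l' then s l' else u).
  by move=> l; case: unliftP => [l' _|_].
rewrite big_ord_recr /= unlift_none.
rewrite (eq_bigr (fun l => lpt3 (s l))); last first.
  move=> l _; suff -> : fintype.unlift ord_max (widen_ord (leqnSn k) l) = Some l by [].
  have -> : widen_ord (leqnSn k) l = lift ord_max l.
    by apply/val_inj; rewrite /= /bump leqNgt ltn_ord.
  by rewrite liftK.
have -> : \sum_(l < k) lpt3 (s l) + lpt3 u - k.+1%:R *: B = S + (lpt3 u - B).
  have -> : k.+1%:R = k%:R + 1 :> R by rewrite natr1.
  by rewrite /S scalerDl scale1r opprD addrACA.
have /andP[_ h] := hc (lpt3 u - B).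
have h2 := Phi_sub (lpt3 u) B; have h3 := Phi_lpt3 uL; rewrite -/B in hB.
have h4 : dot c (lpt3 u - B) <= 0 by move: hu; rewrite !dotNl dotBr; lra.
have -> : k.+1%:R = k%:R + 1 :> R by rewrite natr1.
rewrite mulrDr mulr1; move: hs h h2 h3 hB h4.
move: (Phi S) (Phi (S + _)) (Phi (lpt3 u - B)) (Phi (lpt3 u)) (Phi B) (dot c _) (k%:R : R) (8 ^+ 3 : R) => *; lra.
Qed.

Notation N := (n * n * n)%N.

(** Chosen so that N mesh^t equals the error bound of [maurey] after n^2 steps; divided by [mesh],
    the error falls under the count of [lat t N N]. *)
Definition mesh : R := (16 * 8 ^+ 3 / n%:R) `^ t^-1.

Lemma mesh_gt0 : 0 < mesh.
Proof. by rewrite powR_gt0 // divr_gt0 ?mulr_gt0 ?exprn_gt0 ?ltr0n. Qed.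

Lemma mesh_le : mesh <= 16 * 8 ^+ 3 * n%:R `^ (- t^-1).
Proof.
have /andP[t1 t2] := t12.
have c1 : 1 <= 16 * 8 ^+ 3 :> R by rewrite -natrX -natrM ler1n.
have c0 : 0 <= 16 * 8 ^+ 3 :> R by apply: le_trans c1.
have nV0 : 0 <= n%:R^-1 :> R by rewrite invr_ge0.
rewrite /mesh (powRM _ c0 nV0) -(powR_inv1 (ler0n _ n)) -powRrM mulN1r.
by rewrite ler_wpM2r ?powR_ge0 // ler1_powR // invf_le1; lra.
Qed.

(** The pair codes n^2 lattice products and the rounded error of their sum; the prefactor undoes the
    normalisations by [wide] and by n^2. *)
Definition maurey_center (S : {ffun 'I_(n * n) -> idx3} * {ffun 'I_N -> 'I_(N + N).+1}) : 'rV[R]_N :=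
  (wide / (n * n)%:R) *: (\sum_l lpt3 (S.1 l) - mesh *: \row_m latv S.2 m).

Definition maurey_centers := finset.setX [set s : {ffun 'I_(n * n) -> idx3} | s \in ffun_on lat3] (lat t N N).

(** Three lattice points with at most 2^(8n) 3^n choices each, taken n^2 times, give (2^24 3^3)^N;
    the rounded error gives the factor (2 times 3)^N. *)
Lemma card_centers : (#|maurey_centers|%:R : R) <= (2 ^+ 24 * 3 ^+ 3 * (2 * 3)) ^+ N.
Proof.
rewrite finset.cardsX finset.cardsE card_ffun_on !finset.cardsX card_ord natrM.
have h := @card_lat R t n D t12.
have hN := @card_lat R t N N t12.
rewrite exprMn [(2 * 3) ^+ N]exprMn.
apply: ler_pM => //.
have E (x y : R) (e f m d g l k : nat) : (e * m = d * (l * k))%N -> (f * m = g * (l * k))%N ->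
    (x ^+ e * y ^+ f) ^+ m = ((x ^+ d * y ^+ g) ^+ l) ^+ k.
  by move=> h1 h2; rewrite -[in RHS]exprM !exprMn -!exprM h1 h2.
rewrite (E _ _ _ _ _ D n 3%N (n * n)%N); [|lia..].
rewrite natrX; apply: lerXn2r; rewrite ?nnegrE ?ler0n //.
rewrite !natrM exprS expr2 mulrA.
by apply: ler_pM; rewrite ?mulr_ge0 //; apply: ler_pM.
Qed.

Lemma maurey_cover A : pn A <= 1 ->
  exists2 S, S \in maurey_centers & cube (maurey_center S) (wide * mesh / (n * n)%:R) A.
Proof.
move=> A1; have [s sL hs] := maurey (n * n) A1.
have W0 := wide_gt0; have m0 := mesh_gt0.
have M0 : 0 < (n * n)%:R :> R by rewrite ltr0n muln_gt0 n0.
have N0 : 0 < n%:R :> R by rewrite ltr0n.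
set w := _ - _ in hs.
have hw : \sum_m `|w 0 m / mesh| `^ t <= N%:R.
  have -> : \sum_m `|w 0 m / mesh| `^ t = Phi w / (16 * 8 ^+ 3 / n%:R).
    rewrite mulr_suml; apply: eq_bigr => m _.
    rewrite normrM normfV (gtr0_norm m0) powRM ?invr_ge0 ?(ltW m0) //; congr (_ * _).
    have c0 : 0 <= 16 * 8 ^+ 3 / n%:R :> R by rewrite divr_ge0 ?mulr_ge0 ?exprn_ge0.
    have mt : mesh `^ t = 16 * 8 ^+ 3 / n%:R.
      by rewrite /mesh powRVK //; have /andP[] := t12; lra.
    by rewrite -(powR_inv1 (ltW m0)) powRAC mt powR_inv1.
  rewrite ler_pdivrMr ?divr_gt0 ?mulr_gt0 ?exprn_gt0 //; apply: (le_trans hs).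
  rewrite [N%:R]natrM le_eqVlt; apply/orP; left; apply/eqP.
  by field; rewrite gt_eqF.
have [f fL fh] := lat_cover t12 m0 hw.
exists ([ffun l => s l], f).
  rewrite finset.in_setX /= fL andbT inE.
  by apply/ffun_onP => l; rewrite ffunE.
move=> m; have := fh m; rewrite /w /maurey_center /=.
have -> : \sum_l lpt3 ([ffun l => s l] l) = \sum_l lpt3 (s l).
  by apply: eq_bigr => l _; rewrite ffunE.
set P := \sum_l _; rewrite !mxE => h.
have -> : A 0 m - wide / (n * n)%:R * (P 0 m - mesh * latv f m) =
  - (wide / (n * n)%:R) * (P 0 m - (n * n)%:R * (wide^-1 * A 0 m) - mesh * latv f m).
  by field; rewrite !gt_eqF.
have c0 : 0 < wide / (n * n)%:R by rewrite divr_gt0.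
rewrite normrM normrN (gtr0_norm c0) [wide * mesh / _]mulrAC; apply: ler_wpM2l => //.
exact: ltW.
Qed.

End maurey.

(** * The ellipsoid of maximal volume *)

Section cholesky.
Local Open Scope classical_set_scope.
Context {R : realType}.

Lemma dotE N (u v : 'rV[R]_N) : dot u v = (u *m v^T) 0 0.
Proof. by rewrite mxE; apply: eq_bigr => i _; rewrite mxE. Qed.

Lemma dot_mulmx N (u v : 'rV[R]_N) (M : 'M[R]_N) : dot (u *m M) v = dot u (v *m M^T).
Proof. by rewrite !dotE trmx_mul trmxK mulmxA. Qed.

Lemma dot_row_mx m N (u v : 'rV[R]_m) (w y : 'rV[R]_N) :
  dot (row_mx u w) (row_mx v y) = dot u v + dot w y.
Proof.
by rewrite /dot big_split_ord; congr (_ + _); apply: eq_bigr => i _; rewrite ?row_mxEl ?row_mxEr.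
Qed.

Lemma dot0l N (u : 'rV[R]_N) : dot 0 u = 0.
Proof. by rewrite dotE mul0mx mxE. Qed.

Definition posdef N (G : 'M[R]_N) : Prop := forall x : 'rV[R]_N, x != 0 -> 0 < dot (x *m G) x.

(** Induction through the Schur complement of the first diagonal entry. *)
Lemma cholesky N (G : 'M[R]_N) : G^T = G -> posdef G -> exists U : 'M[R]_N,
  [/\ forall i j : 'I_N, (j < i)%N -> U i j = 0, forall i, 0 < U i i & U^T *m U = G].
Proof.
elim: N G => [|N IH] G symG posG.
  by exists 0; split; [case|case|apply/matrixP; case].
change ('M[R]_(1 + N)) in G.
pose a := G 0 0; pose b := ursubmx G; pose C := drsubmx G.
have Gblock : G = block_mx a%:M b b^T C.
  rewrite -[LHS]submxK -/b -/C; congr block_mx.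
    by apply/matrixP => i j; rewrite !ord1 !mxE eqxx mulr1n; congr (G _ _); apply/val_inj.
  by rewrite -[in LHS]symG /b trmx_ursub.
have a0 : 0 < a.
  have /posG : delta_mx 0 0 != 0 :> 'rV[R]_(1 + N).
    by apply/eqP => /rowP /(_ 0) /eqP; rewrite !mxE !eqxx oner_eq0.
  by rewrite -rowE dotC /dot (bigD1 0) //= big1 ?addr0 => [|i /negPf i0];
    rewrite !mxE ?eqxx ?mul1r ?i0 ?mul0r.
have symC : (C - a^-1 *: (b^T *m b))^T = C - a^-1 *: (b^T *m b).
  rewrite linearB linearZ /= trmx_mul trmxK; congr (_ - _).
  by rewrite /C trmx_drsub symG.
have posC : posdef (C - a^-1 *: (b^T *m b)).
  (* This [s] minimises the quadratic form for given [y]: it annihilates the first block of the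
     product with [G] and leaves the Schur complement. *)
  move=> y y0; pose s : 'M[R]_1 := - (a^-1 *: (y *m b^T)).
  have /posG : row_mx s y != 0.
    by apply: contraNneq y0; rewrite -row_mx0 => /eq_row_mx[_ ->].
  have -> : row_mx s y *m G = row_mx 0 (y *m (C - a^-1 *: (b^T *m b))).
    rewrite [in LHS]Gblock mul_row_block; congr row_mx.
      by rewrite mul_mx_scalar /s scalerN scalerA divff ?gt_eqF // scale1r addNr.
    by rewrite /s mulNmx -scalemxAl mulmxBr -scalemxAr mulmxA addrC.
  move=> h; have E := dot_row_mx 0 s (y *m (C - a^-1 *: (b^T *m b))) y.
  by rewrite dot0l add0r in E; rewrite -E; exact: h.
have [U [Ut U0 UG]] := IH _ symC posC.
change (exists U : 'M[R]_(1 + N), [/\ forall i j : 'I_(1 + N), (j < i)%N -> U i j = 0,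
  forall i : 'I_(1 + N), 0 < U i i & U^T *m U = G]).
exists (block_mx (Num.sqrt a)%:M ((Num.sqrt a)^-1 *: b) 0 U); split.
- move=> i j; case: (split_ordP i) => [i' ->|i' ->]; case: (split_ordP j) => [j' ->|j' ->] /=.
  + by rewrite !ord1.
  + by rewrite !ord1.
  + by rewrite block_mxEdl mxE.
  by rewrite ltn_add2l => h; rewrite block_mxEdr Ut.
- move=> i; case: (split_ordP i) => i' ->.
    by rewrite block_mxEul !ord1 mxE eqxx mulr1n sqrtr_gt0.
  by rewrite block_mxEdr.
have s0 : Num.sqrt a != 0 by rewrite gt_eqF // sqrtr_gt0.
have sa : Num.sqrt a * Num.sqrt a = a by rewrite -expr2 sqr_sqrtr ?ltW.
rewrite tr_block_mx mulmx_block Gblock; congr block_mx.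
- by rewrite trmx0 mul0mx addr0 tr_scalar_mx -scalar_mxM sa.
- by rewrite trmx0 mul0mx addr0 tr_scalar_mx mul_scalar_mx scalerA divff // scale1r.
- by rewrite mulmx0 addr0 linearZ /= mul_mx_scalar scalerA divff // scale1r.
have -> : ((Num.sqrt a)^-1 *: b)^T = (Num.sqrt a)^-1 *: b^T by rewrite linearZ.
rewrite -scalemxAl -scalemxAr scalerA -invfM sa UG.
by rewrite addrC subrK.
Qed.

(** With row vectors u T = (u Q) U, and [Q] preserves the Euclidean ball, so every ellipsoid is a
    triangular image of the ball. *)
Lemma qr_decomposition N (T : 'M[R]_N) : T \in unitmx -> exists U Q : 'M[R]_N,
  [/\ forall i j : 'I_N, (j < i)%N -> U i j = 0, forall i, 0 < U i i,
      U \in unitmx, T = Q *m U & Q *m Q^T = 1%:M].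
Proof.
move=> Tu; have [|x x0|U [Ut U0 UG]] := @cholesky N (T^T *m T).
- by rewrite trmx_mul trmxK.
- rewrite mulmxA dot_mulmx lt_def dot_ge0 andbT; apply: contraNneq x0 => h.
  have xT : x *m T^T = 0.
    apply/rowP => i; rewrite [RHS]mxE; apply/eqP; rewrite -sqrf_eq0 expr2; apply/eqP.
    by apply: (psumr_eq0P _ h) => // j _; exact: sqr_ge0.
  by rewrite -[x](mulmxK (_ : T^T \in unitmx)) ?unitmx_tr // xT mul0mx.
have Uu : U \in unitmx.
  have : T^T *m T \in unitmx by rewrite unitmx_mul unitmx_tr Tu.
  by rewrite -UG unitmx_mul => /andP[].
exists U, (T *m invmx U); split => //; first by rewrite mulmxKV.
apply: mulmx1C; rewrite trmx_mul trmx_inv -!mulmxA (mulmxA T^T) -UG.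
by rewrite (mulmxK Uu) mulVmx ?unitmx_tr.
Qed.

End cholesky.

Section euclidean.
Local Open Scope classical_set_scope.
Context {R : realType} {N : nat}.
Notation TR := (measurableTypeR R).

Definition ball2 (s : R) : set 'rV[R]_N := [set x | dot x x <= s ^+ 2].

Lemma unit_ball_lp2 : unit_ball (lp_norm 2%:E (n := N)) = ball2 1.
Proof.
rewrite /unit_ball /ball2; apply/seteqP; split => x /=.
  move=> h; have D0 := dot_ge0 x.
  have -> : dot x x = \sum_(i < N) `|x ord0 i| `^ 2.
    by apply: eq_bigr => i _; rewrite powR_mulrn // real_normK ?num_real.
  have S0 : 0 <= \sum_(i < N) `|x ord0 i| `^ 2 by apply: sumr_ge0 => i _; exact: powR_ge0.
  rewrite expr1n -[X in X <= _](powRVK S0 (_ : 2 != 0)) //.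
  rewrite [X in _ <= X](powR_one 2); apply: ge0_ler_powR => //; rewrite nnegrE ?powR_ge0 //.
rewrite expr1n => h.
have E : \sum_(i < N) `|x ord0 i| `^ 2 = dot x x.
  by apply: eq_bigr => i _; rewrite powR_mulrn // real_normK ?num_real.
rewrite E [X in _ <= X](powR_one 2^-1); apply: ge0_ler_powR; rewrite ?nnegrE ?dot_ge0 //.
Qed.

Lemma tmeasurable_affine_ball (M : 'M[R]_N) (c : 'rV[R]_N) (s : R) :
  tmeasurable [set x | dot ((x - c) *m M) ((x - c) *m M) <= s].
Proof.
apply: (@tmeasurable_fun _ _ (fun x => dot ((x - c) *m M) ((x - c) *m M))).
have m1 j : measurable_fun setT (fun v : N.-tuple TR => ((row_tuple v - c) *m M) 0 j : TR).
  rewrite (_ : (fun _ => _) = fun v : N.-tuple TR => \sum_i (row_tuple v 0 i - c 0 i) * M i j); last first.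
    by apply/funext => v; rewrite mxE; apply: eq_bigr => i _; rewrite !mxE.
  apply: measurable_sum => i; apply: measurable_funM => //; apply: measurable_funB => //.
  exact: measurable_coord.
by apply: measurable_sum => j; apply: measurable_funM; exact: m1.
Qed.

Lemma tmeasurable_ball2 s : tmeasurable (ball2 s).
Proof.
have := tmeasurable_affine_ball 1%:M 0 (s ^+ 2); congr tmeasurable.
by apply/seteqP; split => x /=; rewrite subr0 mulmx1.
Qed.

Lemma vol_ellipsoid_triangular (U : 'M[R]_N) (c : 'rV[R]_N) s :
  (forall i j : 'I_N, (j < i)%N -> U i j = 0) -> (forall i, 0 < U i i) -> U \in unitmx ->
  tmeasurable [set c + u *m U | u in ball2 s] /\
  vol [set c + u *m U | u in ball2 s] = ((\prod_(i < N) U i i)%:E * vol (ball2 s))%E.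
Proof.
move=> hU U0 Uu; have mE : tmeasurable [set c + u *m U | u in ball2 s].
  have := tmeasurable_affine_ball (invmx U) c (s ^+ 2); congr tmeasurable.
  apply/seteqP; split => x /=.
    by move=> h; exists ((x - c) *m invmx U) => //; rewrite mulmxKV // addrC subrK.
  by move=> [u hu <-]; rewrite [c + _]addrC addrK mulmxK.
split => //; rewrite (vol_triangular c hU U0 mE); congr (_ * vol _)%E.
apply/seteqP; split => u /=; last by exists u.
by move=> [v hv] /addrI /(can_inj (mulmxK Uu)) <-.
Qed.

Lemma ball2_scale s : 0 < s -> ball2 s = [set 0 + u *m s%:M | u in ball2 1].
Proof.
move=> s0; have sn : s != 0 by rewrite gt_eqF.
apply/seteqP; split => x /=.
  rewrite /ball2 /= => h; exists (s^-1 *: x); last by rewrite add0r mul_mx_scalar scalerA divff // scale1r.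
  rewrite dotZr dotC dotZr expr1n mulrA -invfM mulrC ler_pdivrMr ?mulr_gt0 //.
  by rewrite mul1r -expr2.
move=> [u hu <-]; rewrite /ball2 /= add0r mul_mx_scalar dotZr dotC dotZr mulrA -expr2.
by rewrite -[X in _ <= X]mulr1 ler_wpM2l ?sqr_ge0 //; move: hu; rewrite /ball2 /= expr1n.
Qed.

Lemma scalar_mx_unit s : 0 < s -> s%:M \in @unitmx R N.
Proof. by move=> s0; rewrite unitmxE det_scalar unitfE expf_neq0 ?gt_eqF. Qed.

Lemma vol_ball2 (s : R) : 0 < s -> vol (ball2 s) = ((s ^+ N)%:E * vol (ball2 1))%E.
Proof.
move=> s0; rewrite {1}(ball2_scale s0).
have [||_ ->] := @vol_ellipsoid_triangular s%:M 0 1 _ _ (scalar_mx_unit s0).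
- by move=> i j ij; rewrite mxE; case: eqP => // e; rewrite e ltnn in ij.
- by move=> i; rewrite mxE eqxx mulr1n.
congr (_%:E * _)%E; rewrite -[X in _ = _ ^+ X](card_ord N) -prodr_const.
by apply: eq_bigr => i _; rewrite mxE eqxx mulr1n.
Qed.

Lemma vol_ball2_ge (s : R) : 0 <= s -> (0 < N)%N -> (((2 * (s / Num.sqrt N%:R)) ^+ N)%:E <= vol (ball2 s))%E.
Proof.
move=> s0 N0; have h0 : 0 <= s / Num.sqrt N%:R by rewrite divr_ge0 ?sqrtr_ge0.
apply: (@vol_ge_cube _ _ _ 0) => //; first exact: tmeasurable_ball2.
move=> x hx; rewrite /ball2 /=.
apply: (@le_trans _ _ (\sum_(i < N) s ^+ 2 / N%:R)); last first.
  by rewrite sumr_const card_ord -[X in X <= _]mulr_natr divfK // pnatr_eq0 -lt0n.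
apply: ler_sum => i _; have := hx i; rewrite mxE subr0 => hi.
have -> : s ^+ 2 / N%:R = (s / Num.sqrt N%:R) ^+ 2 by rewrite exprMn exprVn sqr_sqrtr ?ler0n.
rewrite -expr2 -(real_normK (num_real (x 0 i))).
by rewrite ler_sqr ?nnegrE.
Qed.

(** [lat_cover] with exponent 2 covers the ball by at most 2^N 3^N cubes of side 2s / sqrt N, and 12
    = 2 times 3 times 2. Together with the inscribed cube this gives the volume up to C^N. *)
Lemma vol_ball2_le (s : R) : 0 < s -> (0 < N)%N -> (vol (ball2 s) <= ((12 * (s / Num.sqrt N%:R)) ^+ N)%:E)%E.
Proof.
move=> s0 N0; set h := s / Num.sqrt N%:R.
have NR : 0 < N%:R :> R by rewrite ltr0n.
have h0 : 0 < h by rewrite divr_gt0 ?sqrtr_gt0.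
have t12 : ((1 : R) <= 2) && ((2 : R) <= 2) by apply/andP; split; lra.
have cov x : ball2 s x -> exists2 f, f \in lat (2 : R) N N & cube (\row_i (h * latv f i)) h x.
  rewrite /ball2 /= => hx.
  have [|f fL fh] := @lat_cover _ 2 N N t12 h (fun i => x 0 i) h0.
    have -> : \sum_i `|x 0 i / h| `^ 2 = dot x x / h ^+ 2.
      rewrite mulr_suml; apply: eq_bigr => i _; rewrite powR_mulrn // real_normK ?num_real //.
      by rewrite exprMn exprVn expr2.
    rewrite ler_pdivrMr ?exprn_gt0 // /h exprMn exprVn sqr_sqrtr ?ler0n //.
    by rewrite mulrCA divff ?mulr1 // gt_eqF.
  by exists f => // i; rewrite mxE.
apply: le_trans (vol_le_cover (ltW h0) (tmeasurable_ball2 s) cov) _.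
rewrite lee_fin (_ : 12 * h = 2 * 3 * (2 * h)); last by ring.
rewrite [X in _ <= X]exprMn [(2 * 3) ^+ N]exprMn ler_wpM2r ?card_lat //.
by rewrite exprn_ge0 // mulr_ge0 // ltW.
Qed.

End euclidean.

Section symmetry.
Local Open Scope classical_set_scope.
Context {R : realType}.
Variables (p q r : \bar R) (n' : nat).
Notation n := n'.+1.
Hypotheses (p1 : (1%:E <= p)%E) (q1 : (1%:E <= q)%E) (r1 : (1%:E <= r)%E).
Implicit Types (T A : 'rV[R]_(n * n * n)) (K : R).
Notation pn := (@proj_norm R p q r n).
Notation tbound := (@tbound R p q r n).
Notation N := (n * n * n)%N.

(** The symmetries acting on forms: signs [e], [d], [h] and a cyclic shift in each variable.
    Addition is that of ['I_n] for [n] a successor, which is why the section works with [n'.+1]. *)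
Definition move_tensor (e d h : nat -> R) (s : 'I_n * 'I_n * 'I_n) T : 'rV[R]_N :=
  mkten (fun i j k => e i * d j * h k * coef T (i + s.1.1) (j + s.1.2) (k + s.2)).

Lemma lp_norm_shift (t : \bar R) (e : nat -> R) (s : 'I_n) (x : 'rV[R]_n) :
  (1%:E <= t)%E -> signs e ->
  lp_norm t x <= 1 -> lp_norm t (\row_i (e (i - s) * x 0 (i - s)) : 'rV[R]_n) <= 1.
Proof.
move=> t1 se /(lp_norm_le1 _ t1)[u [u0 u1 xu]]; apply/(lp_norm_le1 _ t1).
exists (fun i => u (i - s)); split => // [|i].
  by rewrite (reindex_inj (addIr s)) /=; under eq_bigr do rewrite addrK.
by rewrite mxE normrM se mul1r.
Qed.

Lemma tbound_move e d h s T K : signs e -> signs d -> signs h ->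
  tbound T K -> tbound (move_tensor e d h s T) K.
Proof.
move=> se sd sh hT x y z hx hy hz.
have := hT _ _ _ (lp_norm_shift s.1.1 p1 se hx) (lp_norm_shift s.1.2 q1 sd hy)
  (lp_norm_shift s.2 r1 sh hz).
congr (_ <= _); rewrite !dot_tens3.
rewrite (reindex_inj (addIr s.1.1)); apply: eq_bigr => i _.
rewrite (reindex_inj (addIr s.1.2)); apply: eq_bigr => j _.
rewrite (reindex_inj (addIr s.2)); apply: eq_bigr => k _.
by rewrite mktenE !mxE !addrK /coef; ring.
Qed.

Variable U : 'M[R]_N.
Hypothesis hU : forall u, dot u u <= 1 -> pn (u *m U) <= 1.

(** The inclusion of the ellipsoid in the unit ball, read dually: [T] is evaluated at the image
    under [U] of the normalised vector [T *m U^T]. *)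
Lemma dot_image_le T K : tbound T K -> dot (T *m U^T) (T *m U^T) <= K ^+ 2.
Proof.
move=> hT; set w := T *m U^T.
have K0 := tbound_ge0 p1 q1 r1 hT.
have [w0|wn] := eqVneq (dot w w) 0; first by rewrite w0 sqr_ge0.
pose s := Num.sqrt (dot w w).
have s0 : 0 < s by rewrite sqrtr_gt0 lt_def wn dot_ge0.
have s2 : s ^+ 2 = dot w w by rewrite sqr_sqrtr ?dot_ge0.
have u1 : dot (s^-1 *: w) (s^-1 *: w) <= 1.
  by rewrite dotZr dotC dotZr mulrA -s2 -invfM -expr2 mulVf // sqrf_eq0 gt_eqF.
have := dot_proj_norm p1 q1 r1 ((s^-1 *: w) *m U) hT.
have -> : dot T (s^-1 *: w *m U) = s.
  rewrite dotC dot_mulmx -/w dotC dotZr -s2 expr2 mulrA mulVf ?mul1r // gt_eqF //.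
move=> h; rewrite -s2 ler_sqr ?nnegrE ?(ltW s0) //; apply: (le_trans h).
by rewrite -[X in _ <= X]mulr1 ler_wpM2l // hU.
Qed.

(** Averaging over the signs of the three variables removes all cross terms from the squared norm,
    and some choice of signs reaches at least the average. *)
Lemma sum_sqr_image_le T K s : tbound T K ->
  \sum_l \sum_i \sum_j \sum_k (coef T (i + s.1.1) (j + s.1.2) (k + s.2) * U l (tidx i j k)) ^+ 2
  <= K ^+ 2.
Proof.
move=> hT.
pose a l i j k := coef T (i + s.1.1) (j + s.1.2) (k + s.2) * U l (tidx i j k).
pose X l h e d := chaos (fun i j => slin (a l i j) h) e d.
have E e d h : dot (move_tensor e d h s T *m U^T) (move_tensor e d h s T *m U^T) =
    \sum_l X l h e d ^+ 2.
  rewrite /dot; apply: eq_bigr => l _; rewrite -expr2; congr (_ ^+ 2).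
  rewrite mxE sum_tidx; apply: eq_bigr => i _; apply: eq_bigr => j _.
  rewrite /slin !mulr_suml; apply: eq_bigr => k _.
  by rewrite mktenE mxE /a; ring.
have [h sh hh] := rad_ge n (fun h => rademacher n (fun d => rademacher n (fun e => \sum_l X l h e d ^+ 2))).
have [d sd hd] := rad_ge n (fun d => rademacher n (fun e => \sum_l X l h e d ^+ 2)).
have [e se he] := rad_ge n (fun e => \sum_l X l h e d ^+ 2).
have := dot_image_le (tbound_move s se sd sh hT); rewrite E; apply: le_trans.
apply: le_trans he; apply: le_trans hd; apply: le_trans hh.
rewrite le_eqVlt; apply/orP; left; apply/eqP.
have -> : (fun h => rademacher n (fun d => rademacher n (fun e => \sum_l X l h e d ^+ 2))) =
   fun h => \sum_l \sum_i \sum_j slin (a l i j) h * slin (a l i j) h.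
  apply/funext => h'.
  have -> : (fun d => rademacher n (fun e => \sum_l X l h' e d ^+ 2)) =
     fun d => \sum_l rademacher n (fun e => X l h' e d ^+ 2).
    by apply/funext => d'; rewrite rad_sum.
  rewrite rad_sum; apply: eq_bigr => l _; rewrite rad_chaos2.
  by apply: eq_bigr => i _; apply: eq_bigr => j _; rewrite expr2.
rewrite rad_sum; apply: eq_bigr => l _; rewrite rad_sum; apply: eq_bigr => i _.
rewrite rad_sum; apply: eq_bigr => j _; rewrite rad_slin2.
by apply: eq_bigr => k _; rewrite expr2.
Qed.

(** Over the N shifts each coefficient of [T] visits each position once, which decouples [T] from
    [U]. Dually, the ball whose radius is the Frobenius norm of [U] over sqrt N lies in the unit
    ball. *)
Lemma frobenius_le T K : tbound T K ->
  (\sum_l \sum_m U l m ^+ 2) * dot T T <= N%:R * K ^+ 2.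
Proof.
move=> hT.
have le : \sum_(s : 'I_n * 'I_n * 'I_n) \sum_l \sum_i \sum_j \sum_k
    (coef T (i + s.1.1) (j + s.1.2) (k + s.2) * U l (tidx i j k)) ^+ 2 <= N%:R * K ^+ 2.
  apply: le_trans (ler_sum _ (fun s _ => sum_sqr_image_le s hT)) _.
  by rewrite sumr_const !card_prod card_ord mulr_natl.
apply: le_trans le; rewrite le_eqVlt; apply/orP; left; apply/eqP.
have Eij i j k : \sum_(s : 'I_n * 'I_n * 'I_n) coef T (i + s.1.1) (j + s.1.2) (k + s.2) ^+ 2 = dot T T.
  rewrite dot_coef -(pair_bigA _ (fun s1 s2 => coef T (i + s1.1) (j + s1.2) (k + s2) ^+ 2)) /=.
  rewrite -(pair_bigA _ (fun s1 s2 => \sum_s3 coef T (i + s1) (j + s2) (k + s3) ^+ 2)) /=.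
  rewrite [RHS](reindex_inj (addrI i)); apply: eq_bigr => s1 _.
  rewrite [RHS](reindex_inj (addrI j)); apply: eq_bigr => s2 _.
  by rewrite [RHS](reindex_inj (addrI k)).
rewrite [RHS]exchange_big mulr_suml; apply: eq_bigr => l _ /=.
rewrite sum_tidx [RHS]exchange_big mulr_suml; apply: eq_bigr => i _ /=.
rewrite [RHS]exchange_big mulr_suml; apply: eq_bigr => j _ /=.
rewrite [RHS]exchange_big mulr_suml; apply: eq_bigr => k _ /=.
by rewrite -(Eij i j k) mulr_sumr; apply: eq_bigr => s _; rewrite exprMn mulrC.
Qed.

End symmetry.

Section max_ellipsoid.
Local Open Scope classical_set_scope.
Context {R : realType}.
Variables (p q r : \bar R) (n : nat).
Hypotheses (p1 : (1%:E <= p)%E) (q1 : (1%:E <= q)%E) (r1 : (1%:E <= r)%E) (n0 : (0 < n)%N).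
Notation pn := (@proj_norm R p q r n).
Notation N := (n * n * n)%N.
Notation B := (unit_ball pn).

Lemma frobenius_le_pos (U : 'M[R]_N) (T : 'rV[R]_N) K :
  (forall u, dot u u <= 1 -> pn (u *m U) <= 1) -> tbound p q r T K ->
  (\sum_l \sum_m U l m ^+ 2) * dot T T <= N%:R * K ^+ 2.
Proof. by case: n n0 U T => // m _ U T hU; exact: frobenius_le. Qed.

Lemma tmeasurable_unit_ball : tmeasurable B.
Proof.
apply: tmeasurable_lipschitz => x y; apply: le_trans (proj_normB p1 q1 r1 x y) _.
by apply: le_trans (proj_norm_l1 p1 q1 r1 _) _; apply: ler_sum => m _; rewrite !mxE.
Qed.

Lemma dot_sqr_le (M : nat) (u v : 'rV[R]_M) : dot u v ^+ 2 <= dot u u * dot v v.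
Proof.
have := sum_mul_sqr_le (fun m => u 0 m) (fun m => v 0 m).
by rewrite /dot; congr (_ <= _ * _); apply: eq_bigr => m _; rewrite expr2.
Qed.

Lemma inner_radius_le1 (s : R) : 0 < s -> ball2 s `<=` B -> s <= 1.
Proof.
move=> s0 sB; have N0 : (0 < N)%N by rewrite !muln_gt0 n0.
pose m := Ordinal N0.
have : B (s *: delta_mx 0 m).
  apply: sB; rewrite /ball2 /= dotZr dotC dotZr mulrA -expr2 /dot (bigD1 m) //= big1 => [|l /negPf lm].
    by rewrite !mxE !eqxx addr0 !mulr1.
  by rewrite mxE lm mulr0.
rewrite /unit_ball /=; apply: le_trans.
have := coord_proj_norm p1 q1 r1 (s *: delta_mx 0 m) m.
by rewrite !mxE !eqxx mulr1 ger0_norm // ltW.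
Qed.

(** The supremum of admissible radii is attained: a point of norm above 1 in that ball could be
    shrunk slightly into a smaller admissible ball, still with norm above 1. *)
Lemma inner_radius : exists2 s : R, 0 < s /\ ball2 s `<=` B &
  forall s', s < s' -> ~ (ball2 s' `<=` B).
Proof.
have N0 : (0 < N)%N by rewrite !muln_gt0 n0.
have NR : 0 < N%:R :> R by rewrite ltr0n.
pose S : set R := [set s | 0 < s /\ ball2 s `<=` B].
have S1 : S N%:R^-1.
  split; first by rewrite invr_gt0.
  move=> x; rewrite /ball2 /unit_ball /= => hx; apply: le_trans (proj_norm_l1 p1 q1 r1 x) _.
  rewrite -[X in _ <= X]ger0_norm // -[X in X <= _]ger0_norm ?sumr_ge0 // -ler_sqr ?nnegrE //.
  rewrite !real_normK ?num_real //; apply: le_trans (sum_norm_sqr_le x) _.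
  have h : N%:R * (N%:R^-1) ^+ 2 <= 1 :> R.
    by rewrite expr2 mulrA divff ?gt_eqF // mul1r invf_le1 // ler1n.
  rewrite expr1n; apply: le_trans h; exact: (ler_wpM2l (ltW NR)).
have ubS : ubound S 1 by move=> s [s0 sB]; exact: inner_radius_le1.
have hS : has_sup S by split; [exists N%:R^-1|exists 1].
have s0 : 0 < sup S by apply: lt_le_trans (_ : N%:R^-1 <= _); [rewrite invr_gt0|apply: ub_le_sup => //; exists 1].
exists (sup S); last first.
  move=> s' ss' h; have : s' <= sup S by apply: ub_le_sup; [exists 1|split => //; apply: lt_trans ss'].
  by rewrite leNgt ss'.
split => // A; rewrite /ball2 /unit_ball /= => hA; rewrite leNgt; apply/negP => A1.
have pA0 : 0 < pn A by apply: lt_trans A1.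
have [|s [sp sB] hs] := @sup_adherent _ S (sup S - sup S / pn A) _ hS.
  by rewrite subr_gt0 ltr_pdivrMr // ltr_pMr.
rewrite opprB addrC subrK in hs.
have : B ((s / sup S) *: A).
  apply: sB; rewrite /ball2 /= dotZr dotC dotZr mulrA -expr2.
  apply: (@le_trans _ _ ((s / sup S) ^+ 2 * sup S ^+ 2)).
    by rewrite ler_wpM2l ?sqr_ge0.
  by rewrite -exprMn divfK // gt_eqF.
rewrite /unit_ball /= proj_normZ // ger0_norm ?divr_ge0 ?(ltW sp) ?(ltW s0) //.
by rewrite leNgt mulrAC ltr_pdivlMr // mul1r -ltr_pdivrMr // hs.
Qed.

(** By AM-GM on the squared diagonal, det(U)^(1/N) is at most the Frobenius norm of [U] over sqrt N,
    the radius of a ball inside B. An ellipsoid with too large a volume would thus yield a ball of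
    radius above [s] in B. *)
Lemma ellipsoid_vol_le (s : R) (E : set 'rV[R]_N) : 0 < s ->
  (forall s', s < s' -> ~ (ball2 s' `<=` B)) ->
  ellipsoid E -> E `<=` B -> tmeasurable E /\ (vol E <= (s ^+ N)%:E * vol (@ball2 R N 1))%E.
Proof.
move=> s0 hs [c [T [Tu ->]]] EB; rewrite unit_ball_lp2 in EB *.
have [U [Q [Ut U0 Uu TQU QQ]]] := qr_decomposition Tu.
have QQ' : Q^T *m Q = 1%:M by exact: mulmx1C.
have EU : [set c + u *m T | u in ball2 1] = [set c + u *m U | u in ball2 1].
  apply/seteqP; split => _ /= [u hu <-].
    exists (u *m Q); last by rewrite TQU mulmxA.
    by rewrite /ball2 /= dot_mulmx -mulmxA QQ mulmx1.
  exists (u *m Q^T); last by rewrite TQU !mulmxA -(mulmxA u) QQ' mulmx1.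
  by rewrite /ball2 /= dot_mulmx trmxK -mulmxA QQ' mulmx1.
rewrite EU in EB *; have [mE ->] := vol_ellipsoid_triangular c 1 Ut U0 Uu; split => //.
apply: lee_wpmul2r; first exact: vol_ge0.
rewrite lee_fin leNgt; apply/negP => lt.
have N0 : (0 < N)%N by rewrite !muln_gt0 n0.
have NR : 0 < N%:R :> R by rewrite ltr0n.
set P := \prod_(i < N) U i i in lt.
have P0 : 0 < P by apply: prodr_gt0.
pose s' := P `^ N%:R^-1.
have s'0 : 0 < s' by rewrite powR_gt0.
have s'N : s' ^+ N = P by rewrite -powR_mulrn ?ltW // powRVK ?gt_eqF ?ltW.
have ss' : s < s'.
  rewrite ltNge; apply/negP => h; move: lt; rewrite -s'N ltNge => /negP; apply.
  by apply: lerXn2r => //; rewrite nnegrE ltW.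
(* B is convex and symmetric, so moving the centre of the ellipsoid to 0 keeps it inside. *)
have UB u : dot u u <= 1 -> pn (u *m U) <= 1.
  move=> u1; have h (v : 'rV[R]_N) : dot v v <= 1 -> pn (c + v *m U) <= 1.
    by move=> v1; apply: (EB (c + v *m U)); exists v => //; rewrite /ball2 /= expr1n.
  have h1 := h u u1; have h2 : pn (c + (- u) *m U) <= 1 by apply: h; rewrite dotNr dotNl opprK.
  have -> : u *m U = 2^-1 *: ((c + u *m U) - (c + (- u) *m U)).
    by rewrite mulNmx; move: (u *m U) => w; apply/rowP => m; rewrite !mxE; field.
  rewrite proj_normZ // ger0_norm //.
  have := proj_normD p1 q1 r1 (c + u *m U) (- (c + (- u) *m U)); rewrite proj_normN //; lra.
have := hs s' ss'; apply => A; rewrite /ball2 /unit_ball /= => hA.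
apply: proj_norm_separation => // X K hX; rewrite leNgt; apply/negP => KX.
have K0 := tbound_ge0 p1 q1 r1 hX.
have X0 : 0 < dot X X.
  rewrite lt_def dot_ge0 andbT; apply/negP => /eqP X0.
  have := dot_sqr_le X A; rewrite X0 mul0r => h.
  by have : 0 < dot X A ^+ 2 by [rewrite exprn_gt0 // (le_lt_trans K0)]; lra.
have fr : (\sum_l \sum_m U l m ^+ 2) * dot X X <= N%:R * K ^+ 2.
  exact: frobenius_le_pos hX.
have tr : \sum_l U l l ^+ 2 <= \sum_l \sum_m U l m ^+ 2.
  by apply: ler_sum => l _; rewrite (bigD1 l) //= lerDl; apply: sumr_ge0 => m _; exact: sqr_ge0.
have K2 : K ^+ 2 < dot X X * s' ^+ 2.
  apply: (@lt_le_trans _ _ (dot X A ^+ 2)); first by rewrite ltr_sqr ?nnegrE // (le_trans K0) // ltW.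
  by apply: le_trans (dot_sqr_le X A) _; rewrite ler_wpM2l // dot_ge0.
have : (\sum_l U l l ^+ 2) / N%:R < s' ^+ 2.
  rewrite ltr_pdivrMr // -(ltr_pM2r X0).
  apply: (@le_lt_trans _ _ (N%:R * K ^+ 2)).
    by apply: le_trans fr; apply: ler_wpM2r => //; exact: ltW.
  have -> : s' ^+ 2 * N%:R * dot X X = N%:R * (dot X X * s' ^+ 2) by ring.
  by rewrite ltr_pM2l.
have [amgm _] := @leif_AGM R 'I_N 'I_N (fun l => U l l ^+ 2) (fun l _ => sqr_ge0 _).
move: amgm; rewrite prodrXl card_ord -/P => amgm h.
have : P ^+ 2 < P ^+ 2; last by rewrite ltxx.
apply: (le_lt_trans amgm); rewrite -s'N exprAC.
rewrite ltr_pXn2r ?nnegrE ?sqr_ge0 //.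
by rewrite divr_ge0 // sumr_ge0 // => l _; exact: sqr_ge0.
Qed.

(** The largest ball is a maximal ellipsoid, so [xget] also returns a maximal one, and any two of
    them have equal volume. *)
Lemma max_ellipsoid_ball : exists2 s : R, 0 < s /\ ball2 s `<=` B &
  [/\ vol (max_ellipsoid B) = vol (@ball2 R N s) &
      forall s', 0 < s' -> ball2 s' `<=` B -> s' <= s].
Proof.
have [s [s0 sB] hs] := inner_radius; exists s => //; split; last first.
  by move=> s' _ h; rewrite leNgt; apply/negP => ss'; exact: (hs s' ss').
have mB : is_max_ellipsoid B (ball2 s).
  split => //.
    exists 0, s%:M; split; first exact: scalar_mx_unit.
    by rewrite unit_ball_lp2; exact: ball2_scale.
  by move=> E hE EB; rewrite vol_ball2 //; have [] := ellipsoid_vol_le s0 hs hE EB.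
have [mE EB Emax] : is_max_ellipsoid B (max_ellipsoid B) by exact: (xgetPex set0 (ex_intro _ _ mB)).
apply/eqP; rewrite eq_le; apply/andP; split.
  by have [_ _] := mB; apply.
by apply: Emax; have [] := mB.
Qed.

End max_ellipsoid.

(** * Bounds on the volume ratio *)

Section volume_ratio_bounds.
Local Open Scope classical_set_scope.
Context {R : realType}.
Variables (p q r : \bar R) (n : nat).
Hypotheses (p1 : (1%:E <= p)%E) (q1 : (1%:E <= q)%E) (r1 : (1%:E <= r)%E) (n0 : (0 < n)%N).
Notation pn := (@proj_norm R p q r n).
Notation N := (n * n * n)%N.
Notation B := (unit_ball pn).
Notation tbound := (@tbound R p q r n).
Notation a := (rinv p).
Notation b := (rinv q).
Notation c := (rinv r).
Implicit Types s M H K sg : R.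

Let N0 : (0 < N)%N. Proof. by rewrite !muln_gt0 n0. Qed.

Lemma sqrtN : Num.sqrt N%:R = n%:R `^ (3 / 2) :> R.
Proof.
rewrite -powR12_sqrt ?ler0n // (_ : N%:R = n%:R `^ 3) -?powRrM //.
by rewrite powR_mulrn ?ler0n // !natrM !exprS expr0 mulr1 mulrA.
Qed.

(** Cauchy-Schwarz against each form, followed by separation. *)
Lemma ball2_sub M : 0 < M -> (forall T K, tbound T K -> dot T T <= (M * K) ^+ 2) ->
  ball2 M^-1 `<=` B.
Proof.
move=> M0 hM A; rewrite /ball2 /= => hA; apply: proj_norm_separation => // T K hT.
have K0 := tbound_ge0 p1 q1 r1 hT.
apply: le_trans (ler_norm _) _; rewrite -ler_sqr ?nnegrE // real_normK ?num_real //.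
apply: le_trans (dot_sqr_le T A) _.
apply: (@le_trans _ _ ((M * K) ^+ 2 * M^-1 ^+ 2)).
  by apply: ler_pM; rewrite ?dot_ge0 //; exact: hM.
by rewrite -exprMn mulrAC divff ?gt_eqF // mul1r.
Qed.

Lemma cube_sub M : 0 < M -> (forall T K, tbound T K -> \sum_m `|T 0 m| <= M * K) ->
  cube 0 M^-1 `<=` B.
Proof.
move=> M0 hM A hA; apply: proj_norm_separation => // T K hT.
apply: (@le_trans _ _ ((\sum_m `|T 0 m|) * M^-1)).
  rewrite mulr_suml; apply: ler_sum => m _; apply: le_trans (ler_norm _) _.
  by rewrite normrM ler_wpM2l //; have := hA m; rewrite mxE subr0.
by rewrite ler_pdivrMr // mulrC; exact: hM.
Qed.

(** [T] is evaluated at its own multiple of Euclidean length [s]. *)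
Lemma ball2_radius_le s T K : 0 < s -> ball2 s `<=` B -> tbound T K ->
  s * Num.sqrt (dot T T) <= K.
Proof.
move=> s0 sB hT; have K0 := tbound_ge0 p1 q1 r1 hT; have T0 := dot_ge0 T.
have [->|Tn] := eqVneq (dot T T) 0; first by rewrite sqrtr0 mulr0.
set l := Num.sqrt _; have l0 : 0 < l by rewrite sqrtr_gt0 lt_def Tn.
have l2 : l ^+ 2 = dot T T by rewrite sqr_sqrtr.
have hA : B ((s / l) *: T).
  apply: sB; rewrite /ball2 /= dotZr dotC dotZr -l2 mulrA -expr2 -exprMn divfK //.
  by rewrite gt_eqF.
have := dot_proj_norm p1 q1 r1 ((s / l) *: T) hT.
rewrite dotZr -l2 expr2 mulrA divfK ?gt_eqF // => h; apply: (le_trans h).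
by rewrite -[X in _ <= X]mulr1 ler_wpM2l.
Qed.

Lemma vol_pos s : 0 < s -> (0 < vol (@ball2 R N s))%E.
Proof.
move=> s0; apply: lt_le_trans (vol_ball2_ge (ltW s0) N0).
by rewrite lte_fin exprn_gt0 // mulr_gt0 // divr_gt0 // sqrtr_gt0 ltr0n.
Qed.

(** The covering cubes have half-side wide mesh / n^2: the losses come from [wide], -1/t from
    [mesh], and -2 from averaging n^2 products. *)
Lemma vol_unit_ball_le t : 1 <= t <= 2 ->
  (vol B <= ((2 ^+ 24 * 3 ^+ 3 * (2 * 3) * (2 * (16 * 8 ^+ 3)) *
     n%:R `^ (loss t^-1 a + loss t^-1 b + loss t^-1 c - 2 - t^-1)) ^+ N)%:E)%E.
Proof.
move=> t12; have W0 := wide_gt0 p q r t n0; have m0 := mesh_gt0 t n0.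
have M0 : 0 < (n * n)%:R :> R by rewrite ltr0n muln_gt0 n0.
set h := wide p q r n t * mesh n t / (n * n)%:R.
have h0 : 0 <= h by rewrite divr_ge0 // mulr_ge0 // ltW.
apply: le_trans (vol_le_cover h0 (tmeasurable_unit_ball p1 q1 r1) (maurey_cover p1 q1 r1 n0 t12)) _.
rewrite lee_fin.
apply: (@le_trans _ _ ((2 ^+ 24 * 3 ^+ 3 * (2 * 3)) ^+ N * (2 * h) ^+ N)).
  apply: ler_wpM2r; last exact: card_centers.
  by apply: exprn_ge0; apply: mulr_ge0.
rewrite -exprMn; apply: lerXn2r; rewrite ?nnegrE.
- by do ?[exact: h0|apply: mulr_ge0|apply: exprn_ge0].
- by do ?[apply: powR_ge0|apply: mulr_ge0|apply: exprn_ge0].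
rewrite -!(mulrA (2 ^+ 24 * 3 ^+ 3 * (2 * 3))) ler_wpM2l //.
rewrite -mulrA ler_wpM2l //.
have -> : n%:R `^ (loss t^-1 a + loss t^-1 b + loss t^-1 c - 2 - t^-1) =
    wide p q r n t * (n%:R `^ (- t^-1) / (n * n)%:R) :> R.
  rewrite /wide; set L := loss t^-1 a + _ + _.
  rewrite -addrA (natrXD n0 L) [- 2 - _]addrC (natrXD n0 (- t^-1)); congr (_ * (_ * _)).
  by rewrite powRN natrM -expr2 powR_mulrn ?ler0n.
apply: (@le_trans _ _ (wide p q r n t * (16 * 8 ^+ 3 * n%:R `^ (- t^-1)) / (n * n)%:R)); last first.
  by rewrite le_eqVlt; apply/orP; left; apply/eqP; ring.
apply: ler_wpM2r; first by rewrite invr_ge0 ltW.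
by apply: ler_wpM2l; [exact: ltW|exact: mesh_le].
Qed.

Lemma vol_unit_ball_fin : vol B \is a fin_num.
Proof.
rewrite ge0_fin_numE ?vol_ge0 //; apply: le_lt_trans (vol_unit_ball_le (_ : 1 <= 1 <= 2)) _.
  by apply/andP; split; lra.
exact: ltry.
Qed.

Lemma vol_ball2_fin s : 0 < s -> vol (@ball2 R N s) \is a fin_num.
Proof.
move=> s0; rewrite ge0_fin_numE ?vol_ge0 //; apply: le_lt_trans (vol_ball2_le s0 N0) _.
exact: ltry.
Qed.

Lemma fine_vol_pos s : 0 < s -> 0 < fine (vol (@ball2 R N s)).
Proof.
move=> s0; apply: fine_gt0; apply/andP; split; first exact: vol_pos.
by rewrite -ge0_fin_numE ?vol_ge0 // vol_ball2_fin.
Qed.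

Lemma vr_ge1 : 1 <= vr pn.
Proof.
have [s [s0 sB] [vE _]] := max_ellipsoid_ball p1 q1 r1 n0.
rewrite /vr vE [X in X <= _](powR_one (N%:R^-1)); apply: ge0_ler_powR; rewrite ?nnegrE ?invr_ge0 ?ler0n //.
  by rewrite divr_ge0 ?fine_ge0 ?vol_ge0.
have h := vol_ball2_fin s0.
rewrite ler_pdivlMr ?fine_vol_pos // mul1r fine_le ?vol_unit_ball_fin //.
by apply: vol_le => //; [exact: tmeasurable_ball2|exact: tmeasurable_unit_ball].
Qed.

Lemma powR_rootN (x : R) : 0 <= x -> (x ^+ N) `^ N%:R^-1 = x.
Proof.
by move=> x0; rewrite -powR_mulrn // -powRrM divff ?powRr1 // pnatr_eq0 -lt0n.
Qed.

(** The ratio of V to 2 / (M sqrt N), the side of the cube inscribed in the ball of radius 1/M. *)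
Lemma vr_le M V : 0 < M -> 0 <= V -> ball2 M^-1 `<=` B -> (vol B <= (V ^+ N)%:E)%E ->
  vr pn <= V * n%:R `^ (3 / 2) * M / 2.
Proof.
move=> M0 V0 MB BV; have [s [s0 sB] [vE hs]] := max_ellipsoid_ball p1 q1 r1 n0.
have Ms : M^-1 <= s by apply: hs; rewrite ?invr_gt0.
have q0 : 0 < n%:R `^ (3 / 2) :> R by rewrite powR_gt0 // ltr0n.
have X0 : 0 <= V * n%:R `^ (3 / 2) * M / 2 by rewrite !mulr_ge0 // ltW.
rewrite -(powR_rootN X0) /vr vE; apply: ge0_ler_powR; rewrite ?nnegrE ?invr_ge0 ?ler0n ?exprn_ge0 //.
  by rewrite divr_ge0 ?fine_ge0 ?vol_ge0.
have fB : fine (vol B) <= V ^+ N by rewrite -lee_fin fineK ?vol_unit_ball_fin.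
have fE : (2 * (M^-1 / n%:R `^ (3 / 2))) ^+ N <= fine (vol (@ball2 R N s)).
  rewrite -lee_fin fineK ?vol_ball2_fin //; apply: le_trans (vol_ball2_ge (ltW s0) N0).
  rewrite lee_fin sqrtN; apply: lerXn2r; rewrite ?nnegrE.
  - by rewrite mulr_ge0 // divr_ge0 ?invr_ge0 // ltW.
  - by rewrite mulr_ge0 // divr_ge0 // ltW.
  by rewrite ler_wpM2l // ler_wpM2r // invr_ge0 ltW.
have d0 : 0 < (2 * (M^-1 / n%:R `^ (3 / 2))) ^+ N by rewrite exprn_gt0 // mulr_gt0 // divr_gt0 // invr_gt0.
rewrite ler_pdivrMr; last exact: lt_le_trans d0 fE.
apply: (le_trans fB); apply: le_trans (ler_wpM2l (exprn_ge0 N X0) fE).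
rewrite -exprMn (_ : V * n%:R `^ (3 / 2) * M / 2 * (2 * (M^-1 / n%:R `^ (3 / 2))) = V) //.
by field; rewrite !gt_eqF.
Qed.

(** The ratio of the side 2/M of the cube in B to 12 sg / sqrt N, which bounds the N-th root of the
    volume of the largest ball. *)
Lemma vr_ge M sg : 0 < M -> cube 0 M^-1 `<=` B -> 0 < sg ->
  (forall s, 0 < s -> ball2 s `<=` B -> s <= sg) ->
  n%:R `^ (3 / 2) / (6 * M * sg) <= vr pn.
Proof.
move=> M0 MB sg0 hsg; have [s [s0 sB] [vE _]] := max_ellipsoid_ball p1 q1 r1 n0.
have ssg : s <= sg by exact: hsg.
have q0 : 0 < n%:R `^ (3 / 2) :> R by rewrite powR_gt0 // ltr0n.
have X0 : 0 <= n%:R `^ (3 / 2) / (6 * M * sg) by rewrite divr_ge0 ?(ltW q0) // !mulr_ge0 // ltW.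
rewrite -(powR_rootN X0) /vr vE; apply: ge0_ler_powR; rewrite ?nnegrE ?invr_ge0 ?ler0n ?exprn_ge0 //.
  by rewrite divr_ge0 ?fine_ge0 ?vol_ge0.
have fB : (2 * M^-1) ^+ N <= fine (vol B).
  rewrite -lee_fin fineK ?vol_unit_ball_fin //.
  by apply: (vol_ge_cube _ (tmeasurable_unit_ball p1 q1 r1) MB); rewrite invr_ge0 ltW.
have fE : fine (vol (@ball2 R N s)) <= (12 * (sg / n%:R `^ (3 / 2))) ^+ N.
  rewrite -lee_fin fineK ?vol_ball2_fin //; apply: le_trans (vol_ball2_le s0 N0) _.
  rewrite lee_fin sqrtN; apply: lerXn2r; rewrite ?nnegrE.
  - by rewrite mulr_ge0 // divr_ge0 // ltW.
  - by rewrite mulr_ge0 // divr_ge0 // ltW.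
  by rewrite ler_wpM2l // ler_wpM2r // invr_ge0 ltW.
have v0 := fine_vol_pos s0.
rewrite ler_pdivlMr //; apply: le_trans fB.
apply: le_trans (ler_wpM2l (exprn_ge0 N X0) fE) _.
rewrite -exprMn (_ : n%:R `^ (3 / 2) / (6 * M * sg) * (12 * (sg / n%:R `^ (3 / 2))) = 2 * M^-1) //.
by field; rewrite !gt_eqF.
Qed.

End volume_ratio_bounds.

(** * Volume ratio bounds as powers of n, and the diagonal form *)

Section cases.
Context {R : realType}.
Variables (p q r : \bar R) (n : nat).
Hypotheses (p1 : (1%:E <= p)%E) (q1 : (1%:E <= q)%E) (r1 : (1%:E <= r)%E) (n0 : (0 < n)%N).
Notation pn := (@proj_norm R p q r n).
Notation tbound := (@tbound R p q r n).
Notation a := (rinv p).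
Notation b := (rinv q).
Notation c := (rinv r).

(** The constant of [vol_unit_ball_le], times the 3 of the form estimates, over the 2 of [vr_le]. *)
Definition upper_cst : R := 2 ^+ 24 * 3 ^+ 3 * (2 * 3) * (2 * (16 * 8 ^+ 3)) * 3 / 2.

Lemma upper_cst_gt0 : 0 < upper_cst.
Proof.
by do ?[apply: mulr_gt0|apply: exprn_gt0|rewrite invr_gt0].
Qed.

(** The exponent adds the covering's -2 - 1/t and losses, 3/2 from sqrt N, and [e] from the inner
    radius. *)
Lemma vr_le_powR (t e g : R) : 1 <= t <= 2 ->
  (forall T K, tbound T K -> dot T T <= (3 * n%:R `^ e * K) ^+ 2) ->
  g = loss t^-1 a + loss t^-1 b + loss t^-1 c + e - 2^-1 - t^-1 ->
  vr pn <= upper_cst * n%:R `^ g.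
Proof.
move=> t12 he ->.
have M0 : 0 < 3 * n%:R `^ e :> R by rewrite mulr_gt0 // natrX_gt0.
have V0 : 0 <= 2 ^+ 24 * 3 ^+ 3 * (2 * 3) * (2 * (16 * 8 ^+ 3)) *
     n%:R `^ (loss t^-1 a + loss t^-1 b + loss t^-1 c - 2 - t^-1) :> R.
  by do ?[apply: powR_ge0|apply: mulr_ge0|apply: exprn_ge0].
have := vr_le p1 q1 r1 n0 M0 V0 (ball2_sub p1 q1 r1 M0 he) (vol_unit_ball_le p1 q1 r1 n0 t12).
move/le_trans; apply; rewrite /upper_cst le_eqVlt; apply/orP; left; apply/eqP.
set L := loss t^-1 a + _ + _; set C := 2 ^+ 24 * _ * _ * _.
have -> : L + e - 2^-1 - t^-1 = (L - 2 - t^-1) + (3 / 2 + e) by field; have /andP[] := t12; lra.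
by rewrite (natrXD n0 (L - 2 - t^-1)) (natrXD n0 (3 / 2)); ring.
Qed.

Lemma vr_ge_powR (e f g : R) : g = 3 / 2 - e - f ->
  (forall T K, tbound T K -> \sum_m `|T 0 m| <= 3 * n%:R `^ e * K) ->
  (forall s, 0 < s -> (ball2 s `<=` unit_ball pn)%classic -> s <= n%:R `^ f) ->
  n%:R `^ g <= 18 * vr pn.
Proof.
move=> -> he hf.
have M0 : 0 < 3 * n%:R `^ e :> R by rewrite mulr_gt0 // natrX_gt0.
have := vr_ge p1 q1 r1 n0 M0 (cube_sub p1 q1 r1 M0 he) (natrX_gt0 n0 f) hf.
have six : 0 < 6 :> R by [].
rewrite (ler_pdivrMr _ _ (mulr_gt0 (mulr_gt0 six M0) (natrX_gt0 n0 f))).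
have -> : n%:R `^ (3 / 2) = n%:R `^ (3 / 2 - e - f) * (n%:R `^ e * n%:R `^ f) :> R.
  by rewrite -!(natrXD n0); congr (_ `^ _); ring.
have h0 : 0 < n%:R `^ e * n%:R `^ f :> R by rewrite mulr_gt0 ?natrX_gt0.
move=> h; rewrite -(ler_pM2r h0); apply: (le_trans h).
by rewrite le_eqVlt; apply/orP; left; apply/eqP; ring.
Qed.

(* For [a + b + c <= 1], Hoelder's inequality in the form of a pointwise weighted AM-GM. *)
Lemma lpu_hoelder3 (al be ga : R) (x y z : 'rV[R]_n) : 0 <= al -> 0 <= be -> 0 <= ga ->
  al + be + ga <= 1 -> lpu al x -> lpu be y -> lpu ga z ->
  \sum_i `|x 0 i * y 0 i * z 0 i| <= n%:R `^ (1 - (al + be + ga)).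
Proof.
move=> al0 be0 ga0 s1 [u [u0 u1 xu]] [v [v0 v1 yv]] [w [w0 w1 zw]].
set d := 1 - (al + be + ga); have d0 : 0 <= d by rewrite subr_ge0.
have N0 : 0 < n%:R :> R by rewrite ltr0n.
have le i : `|x 0 i * y 0 i * z 0 i| <=
    n%:R `^ d * (al * u i + be * v i + ga * w i + d * n%:R^-1).
  apply: (@le_trans _ _ (u i `^ al * v i `^ be * w i `^ ga)).
    rewrite !normrM; apply: ler_pM; rewrite ?mulr_ge0 //.
    by apply: ler_pM.
  have := @powR_amgm R 'I_4 (fun l => [:: al; be; ga; d]`_l)
    (fun l => [:: u i; v i; w i; n%:R^-1]`_l).
  rewrite !big_ord_recl !big_ord0 /= !addr0 mulr1 => h.
  have -> : u i `^ al * v i `^ be * w i `^ ga =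
     n%:R `^ d * (u i `^ al * (v i `^ be * (w i `^ ga * n%:R^-1 `^ d))).
    rewrite invnX.
    have : n%:R `^ d * n%:R `^ (- d) = 1 :> R by rewrite -natrXD // subrr powRr0.
    move=> e; transitivity (u i `^ al * v i `^ be * w i `^ ga * (n%:R `^ d * n%:R `^ (- d))).
      by rewrite e mulr1.
    by ring.
  rewrite ler_wpM2l ?powR_ge0 // -!addrA; apply: h.
  - by case=> [[|[|[|[|?]]]]].
  - by rewrite /d; ring.
  by case=> [[|[|[|[|?]]]]] //= _; rewrite invr_ge0 ler0n.
apply: le_trans (ler_sum _ (fun i _ => le i)) _; rewrite -mulr_sumr.
rewrite -[X in _ <= X]mulr1 ler_wpM2l ?powR_ge0 //.
rewrite !big_split /= -!mulr_sumr sumr_const card_ord -[_ *+ n]mulr_natl divff ?gt_eqF //.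
have := ler_wpM2l al0 u1; have := ler_wpM2l be0 v1; have := ler_wpM2l ga0 w1.
rewrite /d; lra.
Qed.

Definition diag_tensor : 'rV[R]_(n * n * n) := mkten (fun i j k => ((i == j) && (j == k))%:R).

Lemma dot_diag_tensor x y z : dot diag_tensor (tens3 x y z) = \sum_i x 0 i * y 0 i * z 0 i.
Proof.
rewrite dot_tens3; apply: eq_bigr => i _.
rewrite (bigD1 i) //= [X in _ + X]big1 ?addr0; last first.
  by move=> j ji; rewrite big1 // => k _; rewrite mktenE eq_sym (negPf ji) mul0r.
rewrite (bigD1 i) //= [X in _ + X]big1 ?addr0; first by rewrite mktenE eqxx mul1r.
by move=> k ki; rewrite mktenE eqxx /= eq_sym (negPf ki) mul0r.
Qed.

Lemma dot_diag_diag : dot diag_tensor diag_tensor = n%:R.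
Proof.
rewrite dot_coef -[X in _ = X%:R](card_ord n) -sumr_const; apply: eq_bigr => i _.
rewrite (bigD1 i) //= [X in _ + X]big1 ?addr0; last first.
  by move=> j ji; rewrite big1 // => k _; rewrite /coef mktenE eq_sym (negPf ji) expr0n.
rewrite (bigD1 i) //= [X in _ + X]big1 ?addr0; first by rewrite /coef mktenE eqxx expr1n.
by move=> k ki; rewrite /coef mktenE eqxx /= eq_sym (negPf ki) expr0n.
Qed.

(** Hoelder's inequality if a + b + c <= 1. Otherwise dividing the exponents by their sum enlarges
    the balls and brings the sum to 1, where the bound is n^0. *)
Lemma diag_tbound : tbound diag_tensor (n%:R `^ Num.max (1 - (a + b + c)) 0).
Proof.
move=> x y z /(lp_norm_le1 _ p1) hx /(lp_norm_le1 _ q1) hy /(lp_norm_le1 _ r1) hz.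
rewrite dot_diag_tensor; apply: le_trans (_ : \sum_i `|x 0 i * y 0 i * z 0 i| <= _).
  by apply: ler_sum => i _; exact: ler_norm.
have a0 := rinv_ge0 p1; have b0 := rinv_ge0 q1; have c0 := rinv_ge0 r1.
have [s1|s1] := leP (a + b + c) 1.
  by rewrite max_l ?subr_ge0 //; exact: lpu_hoelder3.
rewrite max_r ?subr_le0 ?(ltW s1) //.
set s := a + b + c in s1 *; have s0 : 0 < s by lra.
have shrink e (v : 'rV[R]_n) : 0 <= e -> lpu e v -> lpu (e / s) v.
  move=> e0 hv; have := lpu_embed n0 e0 (divr_ge0 e0 (ltW s0)) hv.
  have -> : Num.max (e / s - e) 0 = 0.
    by apply: max_r; rewrite subr_le0 ler_pdivrMr // -[X in X <= _]mulr1 ler_wpM2l // ltW.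
  by rewrite powRr0 invr1 scale1r.
have := lpu_hoelder3 (divr_ge0 a0 (ltW s0)) (divr_ge0 b0 (ltW s0)) (divr_ge0 c0 (ltW s0)) _
  (shrink _ _ a0 hx) (shrink _ _ b0 hy) (shrink _ _ c0 hz).
by rewrite -!mulrDl -/s divff ?gt_eqF // subrr; apply.
Qed.

Lemma inner_radius_diag s : 0 < s -> (ball2 s `<=` unit_ball pn)%classic ->
  s <= n%:R `^ (Num.max (1 - (a + b + c)) 0 - 2^-1).
Proof.
move=> s0 sB; have := ball2_radius_le p1 q1 r1 s0 sB diag_tbound.
rewrite dot_diag_diag -powR12_sqrt ?ler0n // natrXD // powRN => h.
by rewrite ler_pdivlMr // natrX_gt0.
Qed.

End cases.

(** * Combination of the bounds into the stated cases *)

Section assembly.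
Context {R : realType}.
Implicit Types (p q r : \bar R) (x y : R).

Lemma loss_sub x y : y <= x -> loss x y = x - y.
Proof. by move=> h; apply: max_l; rewrite subr_ge0. Qed.

Lemma loss_0 x y : x <= y -> loss x y = 0.
Proof. by move=> h; apply: max_r; rewrite subr_le0. Qed.

Lemma half_scale2 x y : 0 < 2 * (x + y) -> x * (2 * (x + y))^-1 + y * (2 * (x + y))^-1 = 2^-1.
Proof. by move=> h; field; lra. Qed.

Lemma half_scale3 x y (z : R) : 0 < 2 * (x + y + z) ->
  x * (2 * (x + y + z))^-1 + y * (2 * (x + y + z))^-1 + z * (2 * (x + y + z))^-1 = 2^-1.
Proof. by move=> h; field; lra. Qed.

Lemma one_two_two : ((1 : R) <= 2) && ((2 : R) <= 2).
Proof. by apply/andP; split; lra. Qed.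

(** For g <= 0 the lower estimate follows from n^g <= 1 <= vr, so a maximum with 0 calls for a
    specific lower bound only where it is positive. *)
Lemma asymp_powR p q r (g : R) : (1%:E <= p)%E -> (1%:E <= q)%E -> (1%:E <= r)%E ->
  (forall n, (0 < n)%N -> vr_proj p q r n <= upper_cst * n%:R `^ g) ->
  (g <= 0 \/ forall n, (0 < n)%N -> n%:R `^ g <= 18 * vr_proj p q r n) ->
  asymp (vr_proj p q r) (fun n => n%:R `^ g).
Proof.
move=> p1 q1 r1 up lo; split.
  by exists upper_cst => [|n n0]; [exact: upper_cst_gt0|exact: up].
exists 18 => // n n0; have v1 := vr_ge1 p1 q1 r1 n0; case: lo => [g0|]; last by apply.
have : n%:R `^ g <= n%:R `^ 0 :> R by rewrite ler_powR // ler1n.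
by rewrite powRr0 /vr_proj; lra.
Qed.

End assembly.

Theorem theorem1 (R : realType) (p q r : \bar R)
    (hp : (1%:E <= p)%E) (hpq : (p <= q)%E) (hqr : (q <= r)%E) :
  [/\ (r <= 2%:E)%E ->
        asymp (vr_proj p q r) (fun=> 1),
      (p <= 2%:E)%E -> (2%:E <= q)%E -> 1 <= rinv p + rinv q + rinv r ->
        asymp (vr_proj p q r)
          (fun n => n%:R `^ Num.max (2^-1 - rinv q - rinv r) 0),
      (p <= 2%:E)%E -> (2%:E <= q)%E -> rinv p + rinv q + rinv r <= 1 ->
        asymp (vr_proj p q r) (fun n => n%:R `^ (rinv p - 2^-1)),
      (2%:E <= p)%E ->
        asymp (vr_proj p q r)
          (fun n => n%:R `^ Num.max (2^-1 - rinv p - rinv q - rinv r) 0) &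
      (q <= 2%:E)%E -> (2%:E <= r)%E ->
        lesssim (fun=> 1) (vr_proj p q r) /\
        lesssim (vr_proj p q r)
          (fun n => n%:R `^ Num.min (2^-1 - rinv r) (rinv q - 2^-1))].
Proof.
have hq : (1%:E <= q)%E by exact: le_trans hpq.
have hr : (1%:E <= r)%E by exact: le_trans hqr.
have t2 := @one_two_two R.
have a0 := rinv_ge0 hp; have b0 := rinv_ge0 hq; have c0 := rinv_ge0 hr.
have ab := rinv_le hp hpq; have bc := rinv_le hq hqr.
have ge2 (x : \bar R) : (1%:E <= x)%E -> (x <= 2%:E)%E -> 2^-1 <= rinv x.
  by move=> x1 x2; rewrite -rinv2; exact: rinv_le.
have two1 : (1%:E <= (2%:E : \bar R))%E by rewrite lee_fin; lra.
have le2 (x : \bar R) : (2%:E <= x)%E -> rinv x <= 2^-1.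
  by move=> x2; rewrite -rinv2; exact: rinv_le two1 x2.
split.
- move=> r2; have c2 := ge2 r hr r2.
  have -> : (fun=> 1) = (fun n => n%:R `^ 0) :> (nat -> R) by apply/funext => n; rewrite powRr0.
  apply: asymp_powR => //; [move=> n n0|by left].
  have rfin : exists2 s, r = s%:E & 1 <= s <= 2.
    case: (r) hr r2 => [s||] //; rewrite !lee_fin => s1 s2; exists s => //.
    by rewrite s1 s2.
  have [s rs s12] := rfin.
  have cs : rinv r = s^-1 by rewrite rs rinv_fin.
  (* With t = r no ball loses anything on entering l_t, and e = 1 + (c - 1/2), so the exponent is
     0. *)
  apply: (vr_le_powR hp hq hr n0 s12); first by move=> T K; exact: tbound_slice2.
  rewrite -cs (loss_sub c2) (loss_0 bc) loss_refl loss_0; [by field|lra].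
- move=> p2 q2 s1; have a2 := ge2 p hp p2; have b2 := le2 q q2; set g := Num.max _ _.
  apply: asymp_powR => //; last first.
    have [h|h] := leP (2^-1 - rinv q - rinv r) 0; [left|right]; first by rewrite /g max_r.
    (* As a + b + c >= 1, the diagonal form bounds the inner radius by n^(-1/2), and 3/2 - (b + c +
       3/2) + 1/2 is the claimed exponent. *)
    move=> n n0; apply: (@vr_ge_powR R p q r n hp hq hr n0 (rinv q + rinv r + 3 / 2)
      (Num.max (1 - (rinv p + rinv q + rinv r)) 0 - 2^-1)).
    + by rewrite /g max_l ?ltW // max_r ?subr_le0 //; field.
    + by move=> T K; exact: tbound_slice_l1.
    + by move=> s s0 sB; exact: inner_radius_diag.
  move=> n n0; have [h|h] := leP (2^-1) (rinv q + rinv r).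
    have bc0 : 0 < 2 * (rinv q + rinv r) by lra.
    (* A common scaling brings the shares of [b] and [c] to total 1/2; the losses then add up to b +
       c - 1/2 and the final exponent is 0. *)
    pose th := (2 * (rinv q + rinv r))^-1; have th0 : 0 <= th by rewrite invr_ge0 ltW.
    have th1 : th <= 1 by rewrite invf_le1 //; lra.
    have bth : rinv q * th <= rinv q by rewrite -[X in _ <= X]mulr1 ler_wpM2l.
    have cth : rinv r * th <= rinv r by rewrite -[X in _ <= X]mulr1 ler_wpM2l.
    have sth : rinv q * th + rinv r * th = 2^-1 by exact: half_scale2.
    apply: (vr_le_powR hp hq hr n0 t2).
      by move=> T K hT; exact: (tbound_slice hp hq hr n0 hT (mulr_ge0 b0 th0) (mulr_ge0 c0 th0) sth).
    rewrite (loss_0 a2) !loss_sub //; [|lra..].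
    by rewrite /g max_r; [lra|lra].
  (* Here b + c < 1/2, so the shares 1/2 - c >= b and c lose nothing and e = 1/2. *)
  apply: (vr_le_powR hp hq hr n0 t2).
    move=> T K hT; apply: (tbound_slice (be := 2^-1 - rinv r) (ga := rinv r) hp hq hr n0 hT) => //; [lra|ring].
  rewrite (loss_0 a2) (loss_sub b2) (@loss_sub _ 2^-1 (rinv r)) ?(@loss_0 _ (rinv q)) ?loss_0 //; [|lra..].
  by rewrite /g max_l; [lra|lra].
- move=> p2 q2 s1; have a2 := ge2 p hp p2; have b2 := le2 q q2.
  apply: asymp_powR => //; [|right] => n n0.
    (* The first variable receives 1/2 - b - c, nonnegative because a >= 1/2 and a + b + c <= 1; its
       loss a + b + c - 1/2 is the only one. *)
    apply: (vr_le_powR hp hq hr n0 t2).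
      move=> T K hT; apply: (tbound_l2 (al := 2^-1 - rinv q - rinv r) (be := rinv q) (ga := rinv r)
      hp hq hr n0 hT) => //; [lra|ring].
    rewrite (loss_0 a2) (loss_sub b2) (@loss_sub _ 2^-1 (rinv r)) ?loss_sub ?loss_refl //; [|lra..].
    by field.
  apply: (@vr_ge_powR R p q r n hp hq hr n0 (rinv q + rinv r + 3 / 2)
      (Num.max (1 - (rinv p + rinv q + rinv r)) 0 - 2^-1)).
  + by rewrite max_l ?subr_ge0 //; field.
  + by move=> T K; exact: tbound_slice_l1.
  + by move=> s s0 sB; exact: inner_radius_diag.
- move=> p2; have a2 := le2 p p2; set g := Num.max _ _.
  apply: asymp_powR => //; last first.
    have [h|h] := leP (2^-1 - rinv p - rinv q - rinv r) 0; [left|right]; first by rewrite /g max_r.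
    (* The inner radius is bounded by 1 through a coordinate vector, so f = 0. *)
    move=> n n0; apply: (@vr_ge_powR R p q r n hp hq hr n0 (rinv p + rinv q + rinv r + 1) 0).
    + by rewrite /g max_l ?ltW //; field.
    + by move=> T K; exact: tbound_l1.
    + by move=> s s0 sB; rewrite powRr0; exact: (inner_radius_le1 hp hq hr n0).
  move=> n n0; have [h|h] := leP (2^-1) (rinv p + rinv q + rinv r).
    have bc0 : 0 < 2 * (rinv p + rinv q + rinv r) by lra.
    pose th := (2 * (rinv p + rinv q + rinv r))^-1; have th0 : 0 <= th by rewrite invr_ge0 ltW.
    have th1 : th <= 1 by rewrite invf_le1 //; lra.
    have ath : rinv p * th <= rinv p by rewrite -[X in _ <= X]mulr1 ler_wpM2l.
    have bth : rinv q * th <= rinv q by rewrite -[X in _ <= X]mulr1 ler_wpM2l.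
    have cth : rinv r * th <= rinv r by rewrite -[X in _ <= X]mulr1 ler_wpM2l.
    have sth : rinv p * th + rinv q * th + rinv r * th = 2^-1 by exact: half_scale3.
    apply: (vr_le_powR hp hq hr n0 t2).
      by move=> T K hT; exact: (tbound_l2 hp hq hr n0 hT (mulr_ge0 a0 th0) (mulr_ge0 b0 th0) (mulr_ge0 c0 th0) sth).
    rewrite !loss_sub //; [|lra..].
    by rewrite /g max_r; [lra|lra].
  (* Now 1/2 - b - c > a, so none of the three shares loses anything and e = 0. *)
  apply: (vr_le_powR hp hq hr n0 t2).
    move=> T K hT; apply: (tbound_l2 (al := 2^-1 - rinv q - rinv r) (be := rinv q) (ga := rinv r)
      hp hq hr n0 hT) => //; [lra|ring].
  rewrite (loss_sub a2) (@loss_sub _ 2^-1 (rinv q)) ?(@loss_sub _ 2^-1 (rinv r))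
    ?(@loss_0 _ (rinv p)) ?loss_refl //; [|lra..].
  by rewrite /g max_l; [lra|lra].
move=> q2 r2; have b2 := ge2 q hq q2; have c2 := le2 r r2.
have a2 : 2^-1 <= rinv p by lra.
split.
  by exists 1 => // n n0; rewrite mul1r; exact: (vr_ge1 hp hq hr n0).
exists upper_cst => [|n n0]; first exact: upper_cst_gt0.
(* Slicing in two indices yields the exponent 1/2 - c, slicing in one yields b - 1/2; the smaller is
   used. *)
have [h|h] := leP (2^-1 - rinv r) (rinv q - 2^-1).
  apply: (vr_le_powR hp hq hr n0 t2); first by move=> T K; exact: tbound_slice2.
  by rewrite (loss_0 a2) (loss_0 b2) (loss_sub c2) (loss_0 c2); field.
apply: (vr_le_powR hp hq hr n0 t2).
  move=> T K hT; apply: (tbound_slice (be := 2^-1 - rinv r) (ga := rinv r) hp hq hr n0 hT) => //; [lra|ring].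
rewrite (loss_0 a2) (loss_0 b2) (loss_sub c2) loss_refl loss_sub; [|lra].
by field.
Qed.
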